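(* For every $\varepsilon>0$ and $\delta>0$, there is an integer $k$ so that for all sufficiently large $x$ and at least $(1-\delta)x$ integers $n\le x$, $P^+(\phi_k(n))\le x^{\varepsilon}$.
   Context: $P^+(m)$ denotes the largest prime factor of the positive integer $m$ (with $P^+(1)=1$), and $\phi_k$ is the $k$-th iterate of Euler's totient function $\phi$. The integers $n$ are positive. *)

(* Defs.v *)
From mathcomp Require Import all_boot all_order all_algebra.
From mathcomp Require Import all_classical all_reals all_analysis.

Set Implicit Arguments.
Unset Strict Implicit.
Unset Printing Implicit Defensive.

(* The number of positive integers n <= x satisfying P; for x < 1 it is 0,
   since Num.truncn is the floor on [0, +oo[ and 0 on negative numbers. *)
Definition count_le (R : realType) (x : R) (P : pred nat) : nat :=
  count P (index_iota 1 (Num.truncn x).+1).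

(* Main.v *)
Require Import Defs.
From mathcomp Require Import all_boot all_order all_algebra.
From mathcomp Require Import all_classical all_reals all_analysis.
From mathcomp Require Import zify ring lra.
Import Order.TTheory GRing.Theory Num.Theory numFieldNormedType.Exports.

(** Write X for the integer part of x and fix E >= 1 / eps. A prime factor q
    > X ^ (1 / E) of phi_k(n) yields a chain of primes q = p_0, p_1, ...,
    p_K, p_{i+1} = m p_i + 1, with p_K dividing n and K >= k / E - 1. Below
    its top l_0 links, cut the chain into J blocks of lengths l_0, 2 l_0, 4
    l_0, ...: since the product of the multipliers is at most X, one block
    has product at most X ^ (1 / J), so n sits above a chain of 2 l links, l
    = l_0 2^j, whose lower l links have multipliers of product at most X ^
    (1 / J).

    Such n are rare. For given multipliers the bottom prime is sifted by 2 l
    + 1 linear forms, and Selberg's sieve loses a factor (C E l)^(2l+1) against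
    the expected density (log X)^(-2l-1); Rankin's trick bounds the sum over
    the multipliers by (C log X)^(2l+1) / (l^(2l) J^l), the singular series
    being 1 on average. The powers of l cancel and the proportion is at most
    C (C E^2 / J)^l, which is summable over j as soon as J is a large
    multiple of E^2. *)

(** * Prime chains below the iterates of the totient *)

(** The blocks double in length because only the top of the chain divides n: a short block of l
    links can be used only together with all links above it. These upper links have no constraint
    beyond the bound X on the full product, and each costs a factor C E, while only the links of the
    block save a factor J. With doubling lengths a block is as long as the part above it, so l
    factors J pay for 2 l links; this is also why the top l_0 links lie in no block. Each half
    brings its own power E ^ l: the bottom prime runs over an interval longer than X ^ (1 / E), so
    the sieving limit z has ln z of order (ln X) / (E l).

    The obstacle is uniformity in l. As l is fixed while X grows, the threshold for X may depend on
    l in any way, but the final proportion can afford no more than C ^ l. The singular series of the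
    2 l + 1 forms is not bounded for individual multipliers; hence small primes are treated exactly
    and the effect of degenerate larger primes is averaged. *)

(* Sequences of multipliers are listed from the bottom of a prime chain to its
   top: the value p is followed by m p + 1. *)
Definition chain (q : nat) (s : seq nat) : nat := foldl (fun p m => (m * p).+1) q s.

Fixpoint prime_chain (q : nat) (s : seq nat) : bool :=
  prime q && (if s is m :: s' then prime_chain (m * q).+1 s' else true).

Lemma chain_cat q s1 s2 : chain q (s1 ++ s2) = chain (chain q s1) s2.
Proof. exact: foldl_cat. Qed.

Lemma prime_chain_cat q s1 s2 :
  prime_chain q (s1 ++ s2) -> prime_chain (chain q s1) s2.
Proof. by elim: s1 q => [|m s IH] q //= /andP[_ /IH]. Qed.

Lemma prime_chain_head q s : prime_chain q s -> prime q.
Proof. by case: s => [|m s] /andP[]. Qed.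

Lemma chain_ge q s : 0 < q -> all (leq 1) s -> (\prod_(m <- s) m) * q <= chain q s.
Proof.
elim: s q => [|m s IH] q q0 /=; first by rewrite big_nil mul1n.
case/andP=> m0 s0; rewrite big_cons.
apply: leq_trans (IH (m * q).+1 isT s0).
by rewrite (mulnC m) -mulnA leq_mul2l leqnSn orbT.
Qed.

Lemma leq_chain p q s : p <= q -> chain p s <= chain q s.
Proof.
elim: s p q => [|m s IH] p q pq //=.
by apply: IH; rewrite ltnS leq_mul2l pq orbT.
Qed.

Lemma totient_le n : totient n <= n.
Proof.
rewrite totient_count_coprime.
apply: leq_trans (_ : \sum_(0 <= d < n) 1 <= n).
  by apply: leq_sum => i _; case: coprime.
by rewrite sum_nat_const_nat subn0 muln1.
Qed.

Lemma iter_totient_gt0 k n : 0 < n -> 0 < iter k totient n.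
Proof. by move=> n0; elim: k => //= k IH; rewrite totient_gt0. Qed.

Lemma iter_totient_le k n : iter k totient n <= n.
Proof. elim: k => //= k IH; exact: leq_trans (totient_le _) IH. Qed.

(** In phi(m), the product of the (p - 1) p ^ (e_p - 1), a factor p - 1 adds to the exponent of q
    only if p = 1 mod q. If no such p divides m, the exponent of q in phi(m) is one less than in m,
    or zero if q does not divide m. *)
Lemma dvdn_totient_step q e m : prime q -> 0 < e -> 0 < m -> q ^ e %| totient m ->
  (exists2 p, prime p /\ p %| m & q %| p.-1) \/ q ^ e.+1 %| m.
Proof.
move=> qp e0 m0 qe.
have [/hasP[p pm qd]|/hasPn noP] := boolP (has (fun p => q %| p.-1) (primes m)).
  left; exists p => //; move: pm; rewrite mem_primes => /and3P[-> _ ->] //.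
right.
have lt : logn q (totient m) = (logn q m).-1.
  rewrite totientE // .
  have -> : forall r : seq nat, uniq r -> all prime r -> all (fun p => ~~ (q %| p.-1)) r ->
     logn q (\prod_(p <- r) (p.-1 * p ^ (logn p m).-1)) = if q \in r then (logn q m).-1 else 0.
  - elim=> [|p r IH] /=; first by rewrite big_nil logn1.
    case/andP=> pr ur /andP[pp pps] /andP[qn qns].
    have p1 : 0 < p.-1 by case: (p) pp => [|[]].
    rewrite big_cons lognM; last 2 first.
    + by rewrite muln_gt0 p1 expn_gt0 prime_gt0.
    + rewrite big_seq; apply: prodn_cond_gt0 => i /(allP pps) ip.
      by rewrite muln_gt0 expn_gt0 (prime_gt0 ip) /= andbT; case: (i) ip => [|[]].
    rewrite lognM // ?expn_gt0 ?prime_gt0 // IH // (lognE q p.-1) (negbTE qn) !andbF lognX (logn_prime q pp).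
    rewrite in_cons; have [->|qNp] := eqVneq q p; first by rewrite (negbTE pr) muln1 addn0.
    by rewrite muln0.
  - case: ifP => //; rewrite mem_primes qp m0 /= => /negbT qm.
    by rewrite lognE (negbTE qm) !andbF.
  - exact: primes_uniq.
  - by apply/allP => p; rewrite mem_primes => /andP[].
  - exact/allP.
rewrite pfactor_dvdn ?totient_gt0 // lt in qe.
by rewrite pfactor_dvdn //; lia.
Qed.

(* Going down the iterates, the exponent of q grows by one at each step until a
   prime p = 1 mod q shows up; as q ^ E > X this happens within E steps. *)
Lemma dvdn_iter_totient_step X E k n q : 0 < E -> 0 < n <= X -> prime q -> X < q ^ E ->
  q %| iter k totient n ->
  (q %| n /\ k <= E) \/
  exists p j, [/\ prime p, q %| p.-1, p %| iter j totient n & j < k <= j + E].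
Proof.
move=> E0 /andP[n0 nX] qp qE qk.
have H : forall i, i <= k -> q ^ i.+1 %| iter (k - i) totient n \/
    exists p j, [/\ prime p, q %| p.-1, p %| iter j totient n & j < k <= j + i].
  elim=> [|i IH] ik; first by left; rewrite subn0.
  case: (IH (ltnW ik)) => [|[p [j [? ? ? ?]]]]; last by right; exists p, j; split => //; lia.
  have -> : k - i = (k - i.+1).+1 by lia.
  rewrite iterS => /(dvdn_totient_step _ _ _ qp (ltn0Sn i) (iter_totient_gt0 _ _ n0)) [[p [pp pd] qd]|]; last by left.
  by right; exists p, (k - i.+1); split; rewrite // subnK // ltn_subrL leqnn (leq_trans _ ik).
have [kE|Ek] := leqP k E.
  case: (H k (leqnn k)); rewrite ?subnn /=; last by move=> [p [j [? ? ? ?]]]; right; exists p, j; split => //; lia.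
  by rewrite expnS => /(dvdn_trans (dvdn_mulr _ (dvdnn q))); left.
case: (H E (ltnW Ek)) => [/dvdn_leq|]; last by right.
move=> /(_ (iter_totient_gt0 _ _ n0)).
have := iter_totient_le (k - E) n.
rewrite expnS; have := leq_pmull (q ^ E) (prime_gt0 qp); lia.
Qed.

(** Each link uses up at most [E] iterates, and the last prime reaches [n] itself after at most [E]
    more, whence the factor [(size s).+1]. The next prime is larger than q, so the hypothesis X < q
    ^ E passes to it. *)
Lemma dvdn_iter_totient_chain X E k n q : 0 < E -> 0 < n <= X -> prime q -> X < q ^ E ->
  q %| iter k totient n ->
  exists s, [/\ prime_chain q s, all (leq 1) s, chain q s %| n & k <= E * (size s).+1].
Proof.
move=> E0 nX; elim/ltn_ind: k q => k IH q qp qE qk.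
case: (dvdn_iter_totient_step _ _ _ _ _ E0 nX qp qE qk) => [[qn kE]|].
  by exists [::]; rewrite /= qp; split => //; lia.
move=> [p [j [pp qd pj /andP[jk kj]]]].
have q0 := prime_gt0 qp; have p1 := prime_gt1 pp.
have qp1 : (p.-1 %/ q * q).+1 = p by rewrite divnK //; lia.
have p10 : 0 < p.-1 by lia.
have qlep : q <= p by have := dvdn_leq p10 qd; lia.
have pE : X < p ^ E by apply: leq_trans qE _; rewrite leq_exp2r.
have [s [s1 s2 s3 s4]] := IH j jk p pp pE pj.
exists (p.-1 %/ q :: s) => /=; rewrite qp qp1 s1 s2 andbT; split => //; last by lia.
by rewrite divn_gt0 // dvdn_leq.
Qed.

(** Dropping links at the bottom only raises the bottom prime, so a lower bound for it survives when
    the chain is cut to a prescribed length. *)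
Lemma prime_chain_suffix K q s : prime_chain q s -> all (leq 1) s -> K <= size s ->
  exists q' s', [/\ size s' = K, prime_chain q' s', all (leq 1) s', q <= q' & chain q' s' = chain q s].
Proof.
move=> qs s1 Ks; exists (chain q (take (size s - K) s)), (drop (size s - K) s).
have e : take (size s - K) s ++ drop (size s - K) s = s by exact: cat_take_drop.
split.
- by rewrite size_drop; lia.
- by apply: prime_chain_cat; rewrite e.
- by move: s1; rewrite -{1}e all_cat => /andP[].
- have := s1; rewrite -{1}e all_cat => /andP[t1 _].
  apply: leq_trans (chain_ge _ _ (prime_gt0 (prime_chain_head _ _ qs)) t1).
  rewrite leq_pmull // big_seq; apply: prodn_cond_gt0 => i /(allP t1) //.
- by rewrite -chain_cat e.
Qed.

(* The j-th block of s consists of the positions between l and 2l counted from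
   the top, where l = l0 2^j. *)
Lemma short_block J l0 e B s : all (leq 1) s -> size s = l0 * 2 ^ J ->
  (exists j s1 s2, [/\ j < J, s = s1 ++ s2, size s2 = 2 * (l0 * 2 ^ j) &
     (\prod_(m <- take (l0 * 2 ^ j) s2) m) ^ e < B]) \/
  B ^ J <= (\prod_(m <- s) m) ^ e.
Proof.
elim: J s => [|J IH] s s1 sz.
  right; rewrite expn0 expn_gt0; apply/orP; left.
  by rewrite big_seq; apply: prodn_cond_gt0 => i /(allP s1).
have es : take (l0 * 2 ^ J) s ++ drop (l0 * 2 ^ J) s = s by exact: cat_take_drop.
have [lt|ge] := ltnP ((\prod_(m <- take (l0 * 2 ^ J) s) m) ^ e) B.
  by left; exists J, [::], s; split => //; rewrite sz expnS; lia.
have d1 : all (leq 1) (drop (l0 * 2 ^ J) s).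
  by move: s1; rewrite -{1}es all_cat => /andP[].
have dsz : size (drop (l0 * 2 ^ J) s) = l0 * 2 ^ J by rewrite size_drop sz expnS; lia.
have [[j [t1 [t2 [jJ et st lt]]]]|H] := IH _ d1 dsz.
  left; exists j, (take (l0 * 2 ^ J) s ++ t1), t2; split => //; first lia.
  by rewrite -catA -et es.
by right; rewrite -[in X in _ <= X]es big_cat /= expnS expnMn leq_mul.
Qed.

(** A chain grows at least like the product of its multipliers, so this product is at most [X]. If
    the J-th power of the product exceeded [X] in every one of the [J] blocks, multiplying over the
    blocks would give (X + 1) ^ J <= X ^ J. The number of iterates is what forces at least
    [l0 * 2 ^ J] links. *)
Lemma large_prime_factor_short_block X E J l0 n q : 0 < E -> 0 < J -> 0 < n <= X -> prime q -> X < q ^ E ->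
  q %| iter (E * (l0 * 2 ^ J).+1) totient n ->
  exists j m0 q' s, [/\ j < J, size s = 2 * (l0 * 2 ^ j), X < q' ^ E, prime_chain q' s &
    [/\ all (leq 1) s, 0 < m0, n = m0 * chain q' s & (\prod_(m <- take (l0 * 2 ^ j) s) m) ^ J <= X]].
Proof.
move=> E0 J0 nX qp qE qn.
have [s0 [c0 p0 d0 k0]] := dvdn_iter_totient_chain _ _ _ _ _ E0 nX qp qE qn.
have Ks : l0 * 2 ^ J <= size s0 by rewrite leq_pmul2l // in k0.
have [q1 [s [sz c1 p1 qq1 e1]]] := prime_chain_suffix _ _ _ c0 p0 Ks.
have qE1 : X < q1 ^ E by apply: leq_trans qE _; rewrite leq_exp2r.
have /andP[n0 nX'] := nX.
have q10 := prime_gt0 (prime_chain_head _ _ c1).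
have sX : \prod_(m <- s) m <= X.
  apply: leq_trans nX'; apply: leq_trans (dvdn_leq n0 d0); rewrite -e1.
  by apply: leq_trans (chain_ge _ _ q10 p1); rewrite leq_pmulr.
have [[j [s1 [s2 [jJ es ss lt]]]]|] := short_block J l0 J X.+1 _ p1 sz; last first.
  move=> H; have := leq_trans H (_ : _ <= X ^ J); rewrite leq_exp2r // => /(_ sX) H'.
  by move: H'; rewrite leq_exp2r // ltnn.
have s1p : all (leq 1) s1 by move: p1; rewrite es all_cat => /andP[].
exists j, (n %/ chain q s0), (chain q1 s1), s2; split => //.
- apply: leq_trans qE1 _; rewrite leq_exp2r //.
  apply: leq_trans (chain_ge _ _ q10 s1p).
  rewrite leq_pmull // big_seq; apply: prodn_cond_gt0 => i /(allP s1p) //.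
- by apply: prime_chain_cat; rewrite -es.
- split => //.
  + by move: p1; rewrite es all_cat => /andP[].
  + rewrite divn_gt0; [exact: dvdn_leq n0 d0 | exact: dvdn_gt0 n0 d0].
  + by rewrite -chain_cat -es e1 divnK.
Qed.

(** * Selberg's upper bound sieve *)

Section SelbergSieve.
Local Open Scope ring_scope.
Variables (R : realFieldType) (I : finType).
Implicit Types (S T U V : {set I}).

Lemma prod1D_subset (a : I -> R) T :
  \prod_(i in T) (1 + a i) = \sum_(S : {set I} | S \subset T) \prod_(i in S) a i.
Proof.
rewrite big_mkcond /= (eq_bigr (fun i => (if i \in T then a i else 0) + 1)); last first.
  by move=> i _; case: ifP => _; rewrite ?add0r // addrC.
rewrite bigA_distr [RHS]big_mkcond /=; apply: eq_bigr => S _; case: ifPn => ST.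
  rewrite [RHS]big_mkcond; apply: eq_bigr => i _; case: ifP => // iS.
  by rewrite (fintype.subsetP ST).
have [i iS iT] := fintype.subsetPn ST.
by rewrite (bigD1 i) //= iS (negbTE iT) mul0r.
Qed.

(** Moebius inversion on the interval from V to T. The sum is the expansion of the product over i of
    -[i in T] + [i not in V], which has a zero factor as soon as some i lies in T but not in V. *)
Lemma sum_sign_interval V T : V \subset T ->
  \sum_(S : {set I} | (V \subset S) && (S \subset T)) (-1) ^+ #|S| = (V == T)%:R * (-1) ^+ #|V| :> R.
Proof.
move=> VT.
have -> : \sum_(S : {set I} | (V \subset S) && (S \subset T)) (-1) ^+ #|S| =
   \prod_i ((if i \in T then -1 else 0) + (if i \in V then 0 else 1)) :> R.
  rewrite bigA_distr big_mkcond /=; apply: eq_bigr => S _; case: ifPn => [/andP[VS ST]|].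
    rewrite -prodr_const big_mkcond; apply: eq_bigr => i _; case: ifP => [iS|/negbT iS].
      by rewrite (fintype.subsetP ST).
    by case: ifP => // /(fintype.subsetP VS); rewrite (negbTE iS).
  rewrite negb_and => /orP[/fintype.subsetPn[i iV iS]|/fintype.subsetPn[i iS iT]].
    by rewrite (bigD1 i) //= (negbTE iS) iV mul0r.
  by rewrite (bigD1 i) //= iS (negbTE iT) mul0r.
have [->|VnT] := eqVneq V T.
  rewrite mul1r -prodr_const [RHS]big_mkcond; apply: eq_bigr => i _.
  by case: ifP; rewrite ?addr0 ?add0r.
have /fintype.subsetPn[i iT iV] : ~~ (T \subset V) by apply: contraNN VnT => TV; rewrite finset.eqEsubset VT.
by rewrite mul0r (bigD1 i) //= iT (negbTE iV) addNr mul0r.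
Qed.

Variables (g : I -> R) (F : pred {set I}).
Hypothesis g_gt0 : forall i, 0 < g i.
Hypothesis g_lt1 : forall i, g i < 1.
Hypothesis F0 : F finset.set0.

(** Index sets stand for squarefree integers: [g] is the density of a sifting condition, [F]
    replaces the usual restriction d <= Q, and [sel_G] is Selberg's sum of the multiplicative
    function h = g / (1 - g). *)
Definition sel_h i := g i / (1 - g i).
Definition sel_G := \sum_(T : {set I} | F T) \prod_(i in T) sel_h i.
Definition sel_tail S := \sum_(T : {set I} | F T && (S \subset T)) \prod_(i in T) sel_h i.
(* Selberg's optimal weights, which diagonalize the quadratic form below. *)
Definition sel_lambda S := (-1) ^+ #|S| * (\prod_(i in S) g i)^-1 * sel_tail S / sel_G.

Lemma sel_h_gt0 i : 0 < sel_h i.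
Proof. by rewrite divr_gt0 // subr_gt0. Qed.

Lemma sel_G_ge1 : 1 <= sel_G.
Proof.
rewrite /sel_G (bigD1 finset.set0) //= big_set0 lerDl.
by apply: sumr_ge0 => T _; apply: prodr_ge0 => i _; apply/ltW/sel_h_gt0.
Qed.

Lemma sel_tail_ge0 S : 0 <= sel_tail S.
Proof. by apply: sumr_ge0 => T _; apply: prodr_ge0 => i _; apply/ltW/sel_h_gt0. Qed.

Lemma sel_tail_le S : sel_tail S <= sel_G.
Proof.
rewrite /sel_tail /sel_G big_mkcond [leRHS]big_mkcond; apply: ler_sum => T _.
case: ifP => [/andP[->] //|_]; case: ifP => // _.
by apply: prodr_ge0 => i _; apply/ltW/sel_h_gt0.
Qed.

Lemma prodg_gt0 S : 0 < \prod_(i in S) g i.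
Proof. by apply: prodr_gt0. Qed.

Lemma sel_lambda0 : sel_lambda finset.set0 = 1.
Proof.
rewrite /sel_lambda cards0 expr0 big_set0 invr1 !mul1r.
have -> : sel_tail finset.set0 = sel_G by apply: eq_bigl => T; rewrite finset.sub0set andbT.
by rewrite divff // gt_eqF // (lt_le_trans ltr01 sel_G_ge1).
Qed.

(** A tail is at most the whole sum. This is cruder than the classical bound 1, but costs only a
    power of the sieve level in the remainder. *)
Lemma sel_lambda_le S : `|sel_lambda S| <= (\prod_(i in S) g i)^-1.
Proof.
have G0 := lt_le_trans ltr01 sel_G_ge1.
rewrite /sel_lambda !normrM normrX normrN1 expr1n mul1r -mulrA ger0_norm ?invr_ge0 ?(ltW (prodg_gt0 _)) //.
rewrite ler_piMr ?invr_ge0 ?(ltW (prodg_gt0 _)) // ger0_norm ?sel_tail_ge0 // ger0_norm ?invr_ge0 ?(ltW G0) //.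
by rewrite ler_pdivrMr // mul1r sel_tail_le.
Qed.

Lemma sel_lambda_eq0 S : (forall T, F T -> ~~ (S \subset T)) -> sel_lambda S = 0.
Proof.
move=> H; rewrite /sel_lambda (_ : sel_tail S = 0) ?mulr0 ?mul0r //.
by apply: big1 => T /andP[FT]; rewrite (negbTE (H T FT)).
Qed.

(** Since 1 / g = 1 + 1 / h, the inverse of the product of g over the intersection of S and S' is a
    sum over its subsets V. This turns the form into the sum over V of 1 / h_V times the square of
    the sum of [c S] over all S containing V, and for the chosen weights that inner sum is h_V / G
    up to sign if V is in [F], and 0 otherwise. *)
Lemma sel_quadratic :
  \sum_S \sum_S' sel_lambda S * sel_lambda S' * \prod_(i in S :|: S') g i = sel_G^-1.
Proof.
have G0 := lt_le_trans ltr01 sel_G_ge1.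
pose c S := sel_lambda S * \prod_(i in S) g i.
have cE S : c S = (-1) ^+ #|S| * sel_tail S / sel_G.
  rewrite /c /sel_lambda; have := lt0r_neq0 (prodg_gt0 S); move: (\prod_(i in S) g i) (lt0r_neq0 G0) => x y0 x0.
  by field; rewrite x0 y0.
have split S S' : \prod_(i in S :|: S') g i =
   \prod_(i in S) g i * \prod_(i in S') g i * \sum_(V : {set I} | V \subset S :&: S') \prod_(i in V) (sel_h i)^-1.
  have -> : \sum_(V : {set I} | V \subset S :&: S') \prod_(i in V) (sel_h i)^-1 = (\prod_(i in S :&: S') g i)^-1.
    rewrite -prod1D_subset -prodfV; apply: eq_bigr => i _; rewrite /sel_h.
    have := lt0r_neq0 (g_gt0 i); have : 1 - g i != 0 by rewrite subr_eq0 gt_eqF.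
    by move=> ? ?; field; apply/andP.
  have -> : \prod_(i in S :|: S') g i = \prod_(i in S) g i * \prod_(i in S' :\: S) g i.
    have e1 : (S :|: S') :&: S = S by apply/finset.setP => i; rewrite !inE; case: (i \in S); rewrite ?andbF.
    have e2 : (S :|: S') :\: S = S' :\: S by apply/finset.setP => i; rewrite !inE; case: (i \in S).
    by rewrite (big_setID S) /= e1 e2.
  rewrite [X in _ = _ * X * _](big_setID S) /= finset.setIC.
  have := lt0r_neq0 (prodg_gt0 (S :&: S')).
  move: (\prod_(i in S :&: S') g i) (\prod_(i in S) g i) (\prod_(i in S' :\: S) g i) => x y t x0.
  by field.
(* Moebius inversion enters here: once the sums are exchanged, the signs of the S between V and T
   cancel unless T = V. *)
have sumc V : \sum_(S : {set I} | V \subset S) c S = (F V)%:R * (-1) ^+ #|V| * \prod_(i in V) sel_h i / sel_G.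
  rewrite (eq_bigr _ (fun S _ => cE S)).
  rewrite -mulr_suml; congr (_ / _).
  rewrite (eq_bigr _ (fun S _ => mulr_sumr _ _ _ _)) /=.
  rewrite (exchange_big_dep F) /=; last by move=> S T _ /andP[].
  rewrite (eq_bigr (fun T => (V == T)%:R * (-1) ^+ #|V| * \prod_(i in T) sel_h i)); last first.
    move=> T FT; rewrite -mulr_suml.
    have [VT|VT] := boolP (V \subset T).
      by rewrite -(sum_sign_interval _ _ VT); congr (_ * _); apply: eq_bigl => S; rewrite FT.
    have -> : V == T = false by apply: contraNF VT => /eqP ->.
    rewrite (_ : \sum_(S | _) _ = 0) ?mul0r //; apply: big1 => S /andP[VS /andP[_ ST]].
    by case/negP: VT; apply: fintype.subset_trans VS ST.
  rewrite big_mkcond (bigD1 V) //= [X in _ + X]big1 ?addr0 => [|T TV].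
    by rewrite eqxx mul1r; case: (F V); rewrite ?mul1r ?mul0r.
  by rewrite eq_sym (negbTE TV) !mul0r if_same.
transitivity (\sum_(S : {set I}) \sum_(S' : {set I}) \sum_(V : {set I} | (V \subset S) && (V \subset S')) c S * c S' * \prod_(i in V) (sel_h i)^-1).
  apply: eq_bigr => S _; apply: eq_bigr => S' _.
  rewrite split -mulr_sumr; under [in RHS]eq_bigl do rewrite -finset.subsetI.
  by rewrite /c; ring.
transitivity (\sum_(V : {set I}) (\prod_(i in V) (sel_h i)^-1) * (\sum_(S : {set I} | V \subset S) c S) ^+ 2).
  under eq_bigr do rewrite (exchange_big_dep xpredT) //=.
  rewrite exchange_big /=; apply: eq_bigr => V _.
  rewrite expr2 mulr_suml mulr_sumr [RHS]big_mkcond /=; apply: eq_bigr => S _.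
  case: ifP => VS /=; last by rewrite big_pred0.
  by rewrite mulr_sumr mulr_sumr; apply: eq_bigr => S' _; ring.
transitivity (\sum_(V : {set I} | F V) \prod_(i in V) sel_h i / sel_G ^+ 2).
  rewrite [RHS]big_mkcond; apply: eq_bigr => V _; rewrite sumc; case: (F V); last by rewrite !mul0r expr0n mulr0.
  rewrite prodfV mul1r !exprMn -exprM mulnC exprM sqrrN expr1n expr1n mul1r expr2 -expr2 exprVn.
  have : \prod_(i in V) sel_h i != 0 by apply/lt0r_neq0/prodr_gt0 => i _; apply: sel_h_gt0.
  move: (\prod_(i in V) sel_h i) (lt0r_neq0 G0) => x y0 x0; field; exact/andP.
rewrite -mulr_suml -/sel_G; move: (lt0r_neq0 G0) => y0; field; exact: y0.
Qed.

End SelbergSieve.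

(** * Counting periodic conditions in an interval *)

Section PeriodicCount.
Local Open Scope nat_scope.

Lemma count_iota_sum (a : pred nat) n : count a (iota 0 n) = \sum_(t < n) a t.
Proof. by rewrite -sum1_count big_mkcond /= -(big_mkord xpredT (fun t => nat_of_bool (a t))) /index_iota subn0; apply: eq_bigr => i _; case: (a i). Qed.

Lemma count_chinese d1 d2 (a b : pred nat) : 0 < d1 -> 0 < d2 -> coprime d1 d2 ->
  (forall t, a (t %% d1) = a t) -> (forall t, b (t %% d2) = b t) ->
  count (fun t => a t && b t) (iota 0 (d1 * d2)) = count a (iota 0 d1) * count b (iota 0 d2).
Proof.
move=> d10 d20 cop pa pb; rewrite !count_iota_sum.
pose f (t : 'I_(d1 * d2)) : 'I_d1 * 'I_d2 := (Ordinal (ltn_pmod t d10), Ordinal (ltn_pmod t d20)).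
have f_inj : injective f.
  move=> t u [e1 e2]; apply/val_inj => /=.
  have /eqP : t = u %[mod d1 * d2] by apply/eqP; rewrite chinese_remainder //; apply/andP; split; apply/eqP.
  by rewrite !modn_small // => /eqP.
have f_bij : bijective f by apply: inj_card_bij => //; rewrite card_prod !card_ord.
transitivity (\sum_(p : 'I_d1 * 'I_d2) a p.1 * b p.2).
  rewrite (reindex f) /=; last exact: onW_bij.
  by apply: eq_bigr => t _; rewrite pa pb; case: (a t); case: (b t).
by rewrite -(pair_bigA _ (fun (i : 'I_d1) (j : 'I_d2) => a i * b j)) /= big_distrl; apply: eq_bigr => i _; rewrite big_distrr.
Qed.

Lemma count_periodic d (a : pred nat) n : 0 < d -> (forall t, a (t %% d) = a t) ->
  n %/ d * count a (iota 0 d) <= count a (iota 0 n) <= (n %/ d).+1 * count a (iota 0 d).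
Proof.
move=> d0 pa.
have per m : count a (iota (m * d) d) = count a (iota 0 d).
  rewrite -[m * d]addn0 iotaDl count_map; apply: eq_count => t /=.
  by rewrite -pa modnMDl pa.
have full m : count a (iota 0 (m * d)) = m * count a (iota 0 d).
  elim: m => [|m IH]; first by rewrite mul0n.
  by rewrite mulSn addnC iotaD count_cat IH add0n per mulSn addnC.
have mono m k : m <= k -> count a (iota 0 m) <= count a (iota 0 k).
  by move=> mk; rewrite -(subnKC mk) iotaD count_cat leq_addr.
rewrite -!full !mono //; first by rewrite ltnW // ltn_ceil.
exact: leq_divM.
Qed.

End PeriodicCount.

Section CountRoots.
Local Open Scope ring_scope.
Variable R : realFieldType.

Lemma count_periodic_approx d (a : pred nat) n : (0 < d)%N -> (forall t, a (t %% d)%N = a t) ->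
  `|(count a (iota 0 n))%:R - n%:R * ((count a (iota 0 d))%:R / d%:R)| <= (count a (iota 0 d))%:R :> R.
Proof.
move=> d0 pa; have /andP[lo hi] := count_periodic d a n d0 pa.
have dR : 0 < d%:R :> R by rewrite ltr0n.
set K := count a (iota 0 d) in lo hi *; set c := count a _ in lo hi *.
have K0 : 0 <= K%:R :> R by [].
have lo' : (n %/ d)%:R * K%:R <= c%:R :> R by rewrite -natrM ler_nat.
have hi' : c%:R <= (n %/ d)%:R * K%:R + K%:R :> R by rewrite -natrM -natrD ler_nat; lia.
have nlo : (n %/ d)%:R <= n%:R / d%:R :> R by rewrite ler_pdivlMr // -natrM ler_nat leq_divM.
have nhi : n%:R / d%:R <= (n %/ d)%:R + 1 :> R.
  by rewrite ler_pdivrMr // natr1 -natrM ler_nat; have := ltn_ceil n d0; lia.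
rewrite (_ : n%:R * (K%:R / d%:R) = n%:R / d%:R * K%:R); last by ring.
have m1 := ler_wpM2r K0 nlo; have := ler_wpM2r K0 nhi; rewrite mulrDl mul1r => m2.
by rewrite ler_norml; apply/andP; split; lra.
Qed.

(** By the Chinese remainder theorem exactly kappa ^ |P| residue classes modulo the product of [P]
    are counted, and each of them errs by at most 1. *)
Lemma count_all_roots (P : seq nat) kappa (bad : nat -> pred nat) Y :
  uniq P -> all prime P -> (forall p t, bad p (t %% p)%N = bad p t) ->
  (forall p, p \in P -> count (bad p) (iota 0 p) = kappa) ->
  `|(count (fun t => all (fun p => bad p t) P) (iota 0 Y))%:R - Y%:R * \prod_(p <- P) (kappa%:R / p%:R)|
    <= \prod_(p <- P) kappa%:R :> R.
Proof.
move=> uP pP per cnt.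
have [d0 [dP [pd cd]]] : (0 < \prod_(p <- P) p)%N /\ (forall q, prime q -> q \notin P -> coprime q (\prod_(p <- P) p)) /\
   (forall t, all (fun p => bad p (t %% \prod_(p <- P) p)%N) P = all (fun p => bad p t) P) /\
   count (fun t => all (fun p => bad p t) P) (iota 0 (\prod_(p <- P) p)) = (kappa ^ size P)%N.
  elim: P uP pP cnt => [|p P IH] /=; first by rewrite big_nil; split => //; split => //; move=> *; exact: coprimen1.
  move=> /andP[pnP uP] /andP[pp pP] cnt.
  have [|d0 [dP [pd cd]]] := IH uP pP; first by move=> q qP; apply: cnt; rewrite in_cons qP orbT.
  rewrite big_cons; split; first by rewrite muln_gt0 prime_gt0.
  split.
    move=> q qq; rewrite in_cons negb_or => /andP[qp qP].
    by rewrite coprimeMr dP // andbT prime_coprime // dvdn_prime2.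
  split.
    move=> t; rewrite -(per p) modn_dvdm ?dvdn_mulr // per; congr (_ && _).
    by rewrite -pd -[in RHS]pd modn_dvdm ?dvdn_mull // pd.
  rewrite (count_chinese _ _ (bad p) (fun t => all (fun p => bad p t) P) (prime_gt0 pp) d0 (dP _ pp pnP) (per p) pd).
  by rewrite cnt ?mem_head // cd expnS.
have := count_periodic_approx _ (fun t => all (fun p => bad p t) P) Y d0 pd.
have kE (S : seq nat) : (kappa ^ size S)%N%:R = \prod_(p <- S) kappa%:R :> R.
  by elim: S => [|p S IH] /=; rewrite ?big_nil ?big_cons // expnS natrM IH.
by rewrite cd kE natr_prod prodf_div.
Qed.
End CountRoots.

Section SelbergInequality.
Local Open Scope ring_scope.
Variables (R : realFieldType) (I : finType) (g rho : I -> R) (F : pred {set I}).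
Hypothesis g_gt0 : forall i, 0 < g i.
Hypothesis g_lt1 : forall i, g i < 1.
Hypothesis F0 : F finset.set0.
Hypothesis rho_ge1 : forall i, 1 <= rho i.
Implicit Types (S T U V : {set I}).
Notation lambda := (sel_lambda R I g F).

Lemma natr_count (a : pred nat) (r : seq nat) : (count a r)%:R = \sum_(t <- r) (a t)%:R :> R.
Proof. by elim: r => [|t r IH] /=; rewrite ?big_nil ?big_cons // natrD IH. Qed.

Lemma prod_rho_setU S S' : \prod_(i in S :|: S') rho i <= \prod_(i in S) rho i * \prod_(i in S') rho i.
Proof.
have rho_ge0 i : 0 <= rho i by apply: le_trans (rho_ge1 i).
have e1 : (S :|: S') :&: S = S by apply/finset.setP => i; rewrite !inE; case: (i \in S); rewrite ?andbF.
have e2 : (S :|: S') :\: S = S' :\: S by apply/finset.setP => i; rewrite !inE; case: (i \in S).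
rewrite (big_setID S) /= e1 e2 [X in _ <= _ * X](big_setID S) /=.
rewrite ler_wpM2l ?prodr_ge0 // ler_peMl ?prodr_ge0 //.
by elim/big_rec: _ => // i x _ x1; apply: le_trans (rho_ge1 i) _; rewrite ler_peMr.
Qed.

(** As the weight of the empty set is 1, the square of the sum of the weights over subsets of [B t]
    dominates the indicator of an empty [B t]. Expanded, the main terms form the quadratic form
    evaluated above, and the remainders factor because rho >= 1. *)
Lemma selberg_sieve Y (B : nat -> {set I}) :
  (forall U, `|(count (fun t => U \subset B t) (iota 0 Y))%:R - Y%:R * \prod_(i in U) g i| <= \prod_(i in U) rho i) ->
  (count (fun t => B t == finset.set0) (iota 0 Y))%:R <=
    Y%:R / sel_G R I g F + (\sum_S `|lambda S| * \prod_(i in S) rho i) ^+ 2.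
Proof.
move=> approx.
pose N U : R := (count (fun t => U \subset B t) (iota 0 Y))%:R.
apply: (@le_trans _ _ (\sum_S \sum_S' lambda S * lambda S' * N (S :|: S'))).
  have -> : \sum_S \sum_S' lambda S * lambda S' * N (S :|: S') =
     \sum_(t <- iota 0 Y) (\sum_(S : {set I} | S \subset B t) lambda S) ^+ 2.
    have sq t : (\sum_(S : {set I} | S \subset B t) lambda S) ^+ 2 =
       \sum_S \sum_S' lambda S * lambda S' * (S :|: S' \subset B t)%:R.
      rewrite expr2 mulr_suml big_mkcond; apply: eq_bigr => S _.
      case: ifPn => SB; last first.
        by rewrite big1 // => S' _; rewrite finset.subUset (negbTE SB) mulr0.
      rewrite mulr_sumr big_mkcond; apply: eq_bigr => S' _.
      by rewrite finset.subUset SB /=; case: ifP => _; rewrite ?mulr1 ?mulr0.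
    rewrite (eq_bigr _ (fun t _ => sq t)) [RHS]exchange_big /=; apply: eq_bigr => S _.
    rewrite [RHS]exchange_big /=; apply: eq_bigr => S' _.
    by rewrite /N natr_count mulr_sumr.
  rewrite natr_count; apply: ler_sum => t _.
  case: eqP => [->|_]; last exact: sqr_ge0.
  rewrite (eq_bigl (pred1 finset.set0)); last by move=> S; rewrite finset.subset0.
  by rewrite big_pred1_eq sel_lambda0 // expr1n.
rewrite -(sel_quadratic R I g F g_gt0 g_lt1 F0) mulr_sumr -lerBlDl.
rewrite -sumrB expr2 mulr_suml; apply: ler_sum => S _.
rewrite mulr_sumr mulr_sumr -sumrB; apply: ler_sum => S' _.
apply: le_trans (ler_norm _) _.
rewrite (_ : _ - _ = lambda S * lambda S' * (N (S :|: S') - Y%:R * \prod_(i in S :|: S') g i)); last by ring.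
rewrite normrM (normrM (lambda S)) mulrACA; apply: ler_wpM2l; first exact: mulr_ge0.
exact: le_trans (approx _) (prod_rho_setU _ _).
Qed.

(* Rankin's trick: the sets outside F have weight at least c. *)
Lemma sel_G_rankin (r : I -> R) (c : R) : 0 < c -> (forall i, 0 <= r i) ->
  (forall S, ~~ F S -> c <= \prod_(i in S) r i) ->
  \prod_i (1 + g i * (r i - 1)) <= c / 2 ->
  (\prod_i (1 - g i))^-1 / 2 <= sel_G R I g F.
Proof.
move=> c0 r0 rc small.
have hp i := sel_h_gt0 R I g g_gt0 g_lt1 i.
have g1 i : 1 - g i != 0 by rewrite subr_eq0 gt_eqF.
have tot : \sum_(S : {set I}) \prod_(i in S) sel_h R I g i = (\prod_i (1 - g i))^-1.
  rewrite -prodfV.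
  transitivity (\prod_(i in [set: I]) (1 + sel_h R I g i)).
    by rewrite prod1D_subset; apply: eq_bigl => S; rewrite finset.subsetT.
  rewrite big_mkcond; apply: eq_bigr => i _; rewrite inE /sel_h.
  by have := g1 i => ?; field.
have totr : \sum_(S : {set I}) \prod_(i in S) (sel_h R I g i * r i) =
    (\prod_i (1 - g i))^-1 * \prod_i (1 + g i * (r i - 1)).
  rewrite -prodfV -big_split /=.
  transitivity (\prod_(i in [set: I]) (1 + sel_h R I g i * r i)).
    by rewrite prod1D_subset; apply: eq_bigl => S; rewrite finset.subsetT.
  rewrite big_mkcond; apply: eq_bigr => i _; rewrite inE /sel_h.
  by have := g1 i => ?; field.
have P0 : 0 < (\prod_i (1 - g i))^-1.
  by rewrite invr_gt0; apply: prodr_gt0 => i _; rewrite subr_gt0.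
have : \sum_(S : {set I} | ~~ F S) \prod_(i in S) sel_h R I g i <= (\prod_i (1 - g i))^-1 / 2.
  rewrite -(ler_pM2l c0) mulr_sumr.
  apply: (@le_trans _ _ (\sum_(S : {set I}) \prod_(i in S) (sel_h R I g i * r i))).
    rewrite big_mkcond; apply: ler_sum => S _; case: ifPn => FS; last first.
      by apply: prodr_ge0 => i _; rewrite mulr_ge0 // ltW.
    rewrite [leRHS]big_split /= mulrC; apply: ler_wpM2l; last exact: rc.
    by apply: prodr_ge0 => i _; exact: ltW.
  by rewrite totr mulrCA ler_wpM2l ?(ltW P0).
have : sel_G R I g F + \sum_(S : {set I} | ~~ F S) \prod_(i in S) sel_h R I g i = (\prod_i (1 - g i))^-1.
  by rewrite -tot [RHS](bigID F).
lra.
Qed.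

End SelbergInequality.

(** * Sums and products over primes *)

Section SumInjection.
Local Open Scope ring_scope.
Variable R : realFieldType.

Lemma ler_sum_subset (s r : seq nat) (H : nat -> R) : uniq s -> uniq r -> {subset s <= r} ->
  (forall m, 0 <= H m) -> \sum_(m <- s) H m <= \sum_(m <- r) H m.
Proof.
move=> us ur sr H0; rewrite [leRHS](bigID (mem s)) /=.
rewrite (_ : \sum_(m <- r | m \in s) H m = \sum_(m <- s) H m); first by rewrite lerDl; apply: sumr_ge0.
rewrite -big_filter; apply: perm_big.
apply: uniq_perm => //; first exact: filter_uniq.
by move=> x; rewrite mem_filter; case: (boolP (x \in s)) => //= /sr ->.
Qed.

Lemma ler_sum_inj (s r : seq nat) (h : nat -> nat) (G H : nat -> R) : uniq s -> uniq r ->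
  {in s &, injective h} -> (forall m, m \in s -> h m \in r) ->
  (forall m, m \in s -> G m <= H (h m)) -> (forall m, 0 <= H m) ->
  \sum_(m <- s) G m <= \sum_(m <- r) H m.
Proof.
move=> us ur hi hr GH H0; apply: (@le_trans _ _ (\sum_(m <- map h s) H m)).
  by rewrite big_map big_seq [leRHS]big_seq; apply: ler_sum => m /GH.
apply: ler_sum_subset => //; first by rewrite map_inj_in_uniq.
by move=> _ /mapP[m ms ->]; apply: hr.
Qed.

End SumInjection.

Section PrimeSums.
Local Open Scope ring_scope.
Variable R : realType.

Lemma ln_prod (r : seq nat) (P : pred nat) (F : nat -> nat) : (forall i, P i -> (0 < F i)%N) ->
  ln (\prod_(i <- r | P i) F i)%N%:R = \sum_(i <- r | P i) ln (F i)%:R :> R.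
Proof.
move=> F0; elim: r => [|i r IH]; first by rewrite !big_nil ln1.
rewrite !big_cons; case: ifP => // Pi; rewrite natrM lnM ?IH // posrE ltr0n ?F0 //.
exact: prodn_cond_gt0.
Qed.

Lemma ln_nat_ge0 n : 0 <= ln n%:R :> R.
Proof. by case: n => [|n]; [rewrite ln0 | rewrite ln_ge0 // ler1n]. Qed.

Lemma dvdn_prod_pfactor (r : seq nat) (e : nat -> nat) N : uniq r -> all prime r ->
  (forall p, p \in r -> p ^ e p %| N)%N -> (\prod_(p <- r) p ^ e p %| N)%N.
Proof.
elim: r => [|p r IH] /=; first by rewrite big_nil dvd1n.
move=> /andP[pr ur] /andP[pp rp] H; rewrite big_cons Gauss_dvd.
  rewrite H ?mem_head //= IH // => q qr; apply: H; by rewrite in_cons qr orbT.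
rewrite big_seq; apply: (big_ind (fun x => coprime (p ^ e p) x)).
- exact: coprimen1.
- by move=> x y; rewrite coprimeMr => -> ->.
- move=> q qr; apply/coprimeXl/coprimeXr; rewrite prime_coprime // dvdn_prime2 //; last exact: (allP rp).
  by apply: contraNneq pr => ->.
Qed.

(** Chebyshev's argument: p ^ (n %/ p) divides n! for every prime p, so the sum of (n %/ p) ln p is
    at most n ln n. The factor 2 pays for n / p <= 2 (n %/ p) when p <= n. *)
Lemma sum_ln_prime_div n : \sum_(1 <= p < n.+1 | prime p) ln p%:R / p%:R <= 2 * ln n%:R :> R.
Proof.
case: n => [|n]; first by rewrite big_geq // mulr_ge0 ?ln_nat_ge0.
set m := n.+1; have m0 : (0 < m%:R :> R) by rewrite ltr0n.
have le1 : (\prod_(1 <= p < m.+1 | prime p) p ^ (m %/ p) <= m ^ m)%N.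
  apply: (@leq_trans m`!).
    apply: dvdn_leq; first exact: fact_gt0.
    rewrite -big_filter; apply: (dvdn_prod_pfactor _ (fun p => m %/ p)%N).
    - by rewrite filter_uniq // iota_uniq.
    - by apply/allP => p; rewrite mem_filter => /andP[].
    - move=> p; rewrite mem_filter => /andP[pp _]; rewrite pfactor_dvdn ?fact_gt0 // logn_fact //.
      by rewrite big_nat_recl // expn1 leq_addr.
  have -> : (m ^ m = \prod_(1 <= i < m.+1) m)%N by rewrite prod_nat_const_nat subn1.
  rewrite fact_prod big_nat [X in (_ <= X)%N]big_nat; apply: leq_prod => i; lia.
have : ln (\prod_(1 <= p < m.+1 | prime p) p ^ (m %/ p))%N%:R <= ln (m ^ m)%N%:R :> R.
  rewrite ler_ln ?posrE ?ltr0n ?expn_gt0 ?ler_nat //.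
  by apply: prodn_cond_gt0 => p pp; rewrite expn_gt0 prime_gt0.
rewrite ln_prod; last by move=> p pp; rewrite expn_gt0 prime_gt0.
rewrite natrX lnXn // -(mulr_natr (ln _)) => H.
rewrite -(ler_pM2r m0); apply: (@le_trans _ _ (2 * (ln m%:R * m%:R))); last by rewrite mulrA.
have h2 : 0 <= 2 :> R by [].
have := ler_wpM2l h2 H; apply: le_trans.
rewrite mulr_suml mulr_sumr [leLHS]big_nat_cond [leRHS]big_nat_cond; apply: ler_sum => p /andP[/andP[p0 pm] pp].
rewrite natrX lnXn ?ltr0n // -(mulr_natr (ln _)) mulrCA -mulrA ler_wpM2l ?ln_nat_ge0 //.
rewrite mulrC ler_pdivrMr ?ltr0n // -[2]/(2%:R) -!natrM ler_nat.
have := divn_eq m p; have := ltn_pmod m p0; have : (0 < m %/ p)%N by rewrite divn_gt0.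
by nia.
Qed.

Lemma ln_le_harmonic n : ln n.+1%:R <= \sum_(1 <= k < n.+1) k%:R^-1 :> R.
Proof.
elim: n => [|n IH]; first by rewrite ln1 big_geq.
rewrite big_nat_recr //=; apply: le_trans (lerD IH (lexx _)).
have -> : n.+2%:R = n.+1%:R * (1 + n.+1%:R^-1) :> R.
  by rewrite -natr1; have : n.+1%:R != 0 :> R by []; move: (n.+1%:R) => x x0; field.
have i0 : 0 < n.+1%:R^-1 :> R by rewrite invr_gt0 ltr0n.
rewrite lnM ?posrE ?ltr0n ?addr_gt0 // lerD2l; by apply: le_ln1Dx; apply: lt_trans i0; rewrite ltrN10.
Qed.

Definition smooth (y n : nat) := all (fun p => (p <= y)%N) (primes n).

(** The Euler product is removed one prime at a time: multiplying by 1 - 1 / p, with p = y + 1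
    prime, compensates the terms with p dividing n, because n -> n / p maps them injectively into
    the smooth integers up to [N]. *)
Lemma smooth_sum y N :
  (\sum_(1 <= n < N.+1 | smooth y n) n%:R^-1) * \prod_(1 <= p < y.+1 | prime p) (1 - p%:R^-1) <= 1 :> R.
Proof.
elim: y => [|y IH].
  rewrite [X in _ * X]big_geq // mulr1.
  case: N => [|N]; first by rewrite big_geq.
  rewrite big_ltn_cond // [X in X + _]invr1.
  have -> : smooth 0 1 by [].
  rewrite big_nat_cond big1 ?addr0 // => n /andP[/andP[n1 _]]; rewrite /smooth.
  have := mem_primes (pdiv n) n; rewrite pdiv_prime // pdiv_dvd (ltnW n1) /= => h /allP/(_ _ h).
  by have := pdiv_gt0 n; case: (pdiv n).
have y0 : 0 < y.+1%:R :> R by rewrite ltr0n.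
rewrite [X in _ * X]big_mkcond big_nat_recr //= -big_mkcond /= mulrCA.
apply: le_trans IH; rewrite [leRHS]mulrC ler_wpM2l //.
  apply: prodr_ge0 => p pp; rewrite subr_ge0 invf_le1 ?ltr0n ?prime_gt0 //.
  by rewrite ler1n prime_gt0.
have smS n : smooth y n -> smooth y.+1 n by move=> /allP h; apply/allP => p /h; exact: leqW.
case: ifPn => [py|npy]; last first.
  rewrite mulr1 le_eqVlt; apply/orP; left; apply/eqP; apply: eq_bigl => n.
  apply/idP/idP; last exact: smS.
  move=> /allP h; apply/allP => p pn; have := h p pn; rewrite leq_eqVlt => /orP[/eqP e|//].
  by move: pn; rewrite e mem_primes (negbTE npy).
set f := \sum_(_ <= _ < _ | smooth y.+1 _) _.
rewrite mulrBr mulr1 lerBlDr.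
rewrite {1}/f (bigID (fun n => y.+1 %| n)%N) /= addrC; apply: lerD.
  rewrite big_mkcond [leRHS]big_mkcond; apply: ler_sum => n _.
  case: ifP => [/andP[s nd]|_]; last by case: ifP.
  case: ifPn => // /negP[]; apply/allP => p pn.
  have := allP s p pn; rewrite leq_eqVlt => /orP[/eqP e|//].
  by move: pn; rewrite e mem_primes (negbTE nd) !andbF.
rewrite /f mulr_suml -big_filter -[leRHS]big_filter.
apply: (ler_sum_inj _ _ _ (fun n => n %/ y.+1)%N).
- by rewrite filter_uniq // iota_uniq.
- by rewrite filter_uniq // iota_uniq.
- move=> m n; rewrite !mem_filter => /andP[/andP[_ dm] _] /andP[/andP[_ dn] _] e.
  by rewrite -(divnK dm) -(divnK dn) e.
- move=> m; rewrite !mem_filter !mem_index_iota => /andP[/andP[sm dm] /andP[m1 mN]].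
  apply/andP; split; last first.
    rewrite divn_gt0 // dvdn_leq //=; apply: leq_ltn_trans mN; exact: leq_div.
  apply/allP => p; rewrite mem_primes => /and3P[pp _ pd]; apply: (allP sm).
  by rewrite mem_primes pp m1 /=; apply: dvdn_trans pd _; apply: dvdn_div.
- move=> m; rewrite !mem_filter => /andP[/andP[sm dm] _].
  by rewrite -[X in X%:R^-1 <= _](divnK dm) natrM invfM.
- by move=> m; rewrite divr_ge0.
Qed.

Lemma euler_product_le n : ln n.+1%:R * \prod_(1 <= p < n.+1 | prime p) (1 - p%:R^-1) <= 1 :> R.
Proof.
apply: le_trans (smooth_sum n n); rewrite ler_wpM2r //.
  apply: prodr_ge0 => p pp; rewrite subr_ge0 invf_le1 ?ltr0n ?prime_gt0 //.
  by rewrite ler1n prime_gt0.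
apply: le_trans (ln_le_harmonic n) _; rewrite big_nat_cond [leRHS]big_nat_cond.
rewrite le_eqVlt; apply/orP; left; apply/eqP; apply: eq_bigl => k.
rewrite andbT; case: (boolP (_ <= k < _)%N) => //= /andP[k1 kn]; apply/esym/allP => p.
by rewrite mem_primes => /and3P[_ _ /(dvdn_leq k1)]; lia.
Qed.

End PrimeSums.

(** * Sifting by a fixed number of residue classes *)

Section SiftRoots.
Local Open Scope ring_scope.
Variable R : realType.

Lemma expR_le_1D2 (u : R) : 0 <= u <= 2^-1 -> expR u <= 1 + 2 * u.
Proof.
move=> /andP[u0 u1].
have h : 1 - u <= expR (- u) by exact: expR_ge1Dx.
have h1 : 0 < 1 - u by lra.
rewrite -[expR u]invrK -expRN; apply: (@le_trans _ _ (1 - u)^-1).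
  by rewrite lef_pV2 // posrE ?expR_gt0.
rewrite -div1r ler_pdivrMr //; nra.
Qed.

Lemma expR_sum (I : Type) (r : seq I) (P : pred I) (F : I -> R) :
  \prod_(i <- r | P i) expR (F i) = expR (\sum_(i <- r | P i) F i).
Proof. by elim/big_rec2: _ => [|i x y _ ->]; rewrite ?expR0 // expRD. Qed.

Variables (P : seq nat) (z kappa : nat).
Hypothesis z_ge2 : (2 <= z)%N.
Hypothesis kappa_gt0 : (0 < kappa)%N.
Hypothesis P_uniq : uniq P.
Hypothesis P_prime : all prime P.
Hypothesis P_le : all (fun p => p <= z)%N P.
Hypothesis P_gt : all (fun p => kappa < p)%N P.

Let I : finType := 'I_(size P).
Let w (i : I) := nth 0%N P i.
Let g (i : I) : R := kappa%:R / (w i)%:R.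
Let Q := (z ^ (6 * kappa))%N.
Let F (S : {set I}) := (\prod_(i in S) w i <= Q)%N.

Let wP i : w i \in P. Proof. exact: mem_nth. Qed.
Let w_gt0 i : (0 < w i)%N. Proof. exact/prime_gt0/(allP P_prime _ (wP i)). Qed.
Let w_gt0R i : 0 < (w i)%:R :> R. Proof. by rewrite ltr0n. Qed.
Let g_gt0 i : 0 < g i.
Proof. by rewrite divr_gt0 // ltr0n. Qed.
Let g_lt1 i : g i < 1.
Proof. by rewrite ltr_pdivrMr // mul1r ltr_nat; exact: allP P_gt _ (wP i). Qed.
Let F0 : F finset.set0.
Proof. by rewrite /F big_set0 expn_gt0 (leq_trans _ z_ge2). Qed.
Let lnz_gt0 : 0 < ln z%:R :> R.
Proof. by rewrite ln_gt0 // ltr1n. Qed.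

Lemma big_size_seq (T : Type) (idx : T) (op : Monoid.law idx) (H : nat -> T) :
  \big[op/idx]_(i : I) H (w i) = \big[op/idx]_(p <- P) H p.
Proof. by rewrite (big_nth 0%N) big_mkord. Qed.

(** Rankin's trick with r(p) = p ^ (1 / (2 ln z)), for which r(p) - 1 <= ln p / ln z when p <= z.
    The product of the 1 + g (r - 1) is then at most e ^ (2 kappa), while a set outside [F] has
    weight at least e ^ (3 kappa); this is the origin of the exponent in Q = z ^ (6 kappa). *)
Lemma roots_G_ge : (\prod_(p <- P) (1 - kappa%:R / p%:R))^-1 / 2 <= sel_G R I g F.
Proof.
rewrite -(big_size_seq _ _ _ (fun p => 1 - kappa%:R / p%:R)).
pose r (i : I) : R := expR (ln (w i)%:R / (2 * ln z%:R)).
have d0 : 0 < 2 * ln z%:R :> R by rewrite mulr_gt0.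
apply: (sel_G_rankin R I g F g_gt0 g_lt1 r (expR (3 * kappa%:R))).
- exact: expR_gt0.
- by move=> i; exact: expR_ge0.
- move=> S; rewrite /F -ltnNge => QS.
  rewrite /r expR_sum ler_expR -mulr_suml ler_pdivlMr //.
  have -> : \sum_(i in S) ln (w i)%:R = ln (\prod_(i in S) w i)%N%:R :> R.
    have [h1 _] : ln (\prod_(i in S) w i)%N%:R = \sum_(i in S) ln (w i)%:R :> R /\ (0 < \prod_(i in S) w i)%N.
      elim/big_rec2: _ => [|i x y _ [e x0]]; first by rewrite ln1.
      by rewrite muln_gt0 w_gt0 x0 natrM lnM ?posrE ?ltr0n // e.
    by rewrite h1.
  have -> : 3 * kappa%:R * (2 * ln z%:R) = ln Q%:R :> R.
    rewrite /Q natrX lnXn ?ltr0n ?(leq_trans _ z_ge2) // -(mulr_natr (ln _)) natrM; ring.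
  by rewrite ler_ln ?posrE ?ltr0n ?expn_gt0 ?(leq_trans _ z_ge2) ?ler_nat ?(leq_trans _ QS) // ltnW.
- have hk : expR (2 * kappa%:R) <= expR (3 * kappa%:R) / 2 :> R.
    have -> : 3 * kappa%:R = 2 * kappa%:R + kappa%:R :> R by ring.
    rewrite expRD -mulrA ler_peMr ?expR_ge0 //.
    rewrite ler_pdivlMr // mul1r; apply: le_trans (expR_ge1Dx _).
    have : 1 <= kappa%:R :> R by rewrite ler1n.
    lra.
  apply: le_trans hk.
  apply: (@le_trans _ _ (\prod_i expR (kappa%:R / ln z%:R * (ln (w i)%:R / (w i)%:R)))).
    apply: ler_prod => i _.
    have lw0 : 0 <= ln (w i)%:R :> R by exact: ln_nat_ge0.
    have lwz : ln (w i)%:R <= ln z%:R :> R.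
      by rewrite ler_ln ?posrE ?ltr0n ?(leq_trans _ z_ge2) // ler_nat; exact: allP P_le _ (wP i).
    have r1 : 1 <= r i by rewrite -expR0 ler_expR divr_ge0 // ltW.
    rewrite addr_ge0 ?mulr_ge0 ?subr_ge0 ?(ltW (g_gt0 i)) //=.
    apply: le_trans (expR_ge1Dx _); rewrite lerD2l.
    have -> : kappa%:R / ln z%:R * (ln (w i)%:R / (w i)%:R) = g i * (2 * (ln (w i)%:R / (2 * ln z%:R))) :> R.
      rewrite /g; have := lt0r_neq0 (w_gt0R i); have := lt0r_neq0 lnz_gt0 => ? ?; field; exact/andP.
    apply: ler_wpM2l; first exact/ltW.
    rewrite lerBlDl; apply: expR_le_1D2.
    rewrite divr_ge0 ?(ltW d0) //= ler_pdivrMr //; lra.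
  rewrite expR_sum ler_expR -mulr_sumr.
  rewrite (big_size_seq _ _ _ (fun p => ln p%:R / p%:R)).
  have hs : \sum_(p <- P) ln p%:R / p%:R <= 2 * ln z%:R :> R.
    apply: le_trans (sum_ln_prime_div R z); rewrite -[leRHS]big_filter.
    apply: ler_sum_subset => //; first by rewrite filter_uniq // iota_uniq.
      move=> p pP; rewrite mem_filter mem_index_iota (allP P_prime _ pP) ltnS (allP P_le _ pP) andbT.
      by rewrite prime_gt0 // (allP P_prime _ pP).
    by move=> p; rewrite divr_ge0 // ln_nat_ge0.
  rewrite mulrAC ler_pdivrMr // (_ : 2 * kappa%:R * _ = kappa%:R * (2 * ln z%:R)); last by ring.
  by apply: ler_wpM2l hs.
Qed.

(** The bound for the weights cancels the factors kappa and leaves the product of the primes in S.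
    As this product is at most Q, it is also at most Q ^ 2 divided by itself, and the sum of the
    inverses over all S is an Euler product below the telescoping product of 1 + 1 / k for k <=
    z. *)
Lemma roots_error_le : \sum_S `|sel_lambda R I g F S| * \prod_(i in S) kappa%:R <= (Q ^ 2 * z.+1)%N%:R :> R.
Proof.
have QR : 0 < Q%:R :> R by rewrite ltr0n expn_gt0 (leq_trans _ z_ge2).
apply: (@le_trans _ _ (\sum_(S : {set I}) (Q ^ 2)%:R * \prod_(i in S) (w i)%:R^-1)).
  apply: ler_sum => S _.
  have w0 : 0 < \prod_(i in S) (w i)%:R :> R by apply: prodr_gt0.
  have [FS|FS] := boolP (F S); last first.
    rewrite sel_lambda_eq0 ?normr0 ?mul0r //.
      by rewrite mulr_ge0 // prodr_ge0 // => i _; rewrite invr_ge0 ltW.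
    move=> T FT; apply: contra FS => ST; apply: leq_trans FT.
    rewrite [X in (_ <= X)%N](big_setID S) /= (finset.setIidPr ST) leq_pmulr //.
    by apply: prodn_cond_gt0 => i _.
  apply: (@le_trans _ _ (\prod_(i in S) (w i)%:R)).
    apply: le_trans (ler_wpM2r _ (sel_lambda_le R I g F g_gt0 g_lt1 F0 S)) _.
      by apply: prodr_ge0.
    rewrite -prodfV -big_split /=; apply: ler_prod => i _.
    have k0 : kappa%:R != 0 :> R by rewrite pnatr_eq0 -lt0n.
    have -> : (g i)^-1 * kappa%:R = (w i)%:R.
      by rewrite /g; have := lt0r_neq0 (w_gt0R i) => ?; field; exact/andP.
    by rewrite ltW //=.
  rewrite prodfV ler_pdivlMr // -expr2 -natr_prod -natrX ler_nat.
  by rewrite leq_exp2r.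
rewrite -mulr_sumr natrM ler_wpM2l //.
have -> : \sum_(S : {set I}) \prod_(i in S) (w i)%:R^-1 = \prod_(i in [set: I]) (1 + (w i)%:R^-1) :> R.
  by rewrite prod1D_subset; apply: eq_bigl => S; rewrite finset.subsetT.
have -> : z.+1%:R = \prod_(1 <= k < z.+1) (1 + k%:R^-1) :> R.
  elim: z => [|n IH]; first by rewrite big_geq.
  rewrite big_nat_recr //= -IH mulrDr mulr1 mulfV ?natr1 //.
apply: (@le_trans _ _ (\prod_(p <- P) (1 + p%:R^-1))).
  rewrite -(big_size_seq _ _ _ (fun p => 1 + p%:R^-1)) le_eqVlt; apply/orP; left.
  by apply/eqP; apply: eq_bigl => i; rewrite inE.
have pos m : 1 <= 1 + m%:R^-1 :> R by rewrite lerDl.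
rewrite [leRHS](bigID (mem P)) /= -[leLHS]mulr1; apply: ler_pM => //.
- by apply: prodr_ge0 => i _; exact: le_trans (pos i).
- rewrite -[leRHS]big_filter le_eqVlt; apply/orP; left; apply/eqP/perm_big.
  apply: uniq_perm => //; first by rewrite filter_uniq // iota_uniq.
  move=> p; rewrite mem_filter mem_index_iota; case: (boolP (p \in P)) => //= pP.
  by rewrite ltnS (allP P_le _ pP) prime_gt0 // (allP P_prime _ pP).
- by elim/big_rec: _ => // k x _ x1; rewrite mulr_ege1.
Qed.

Lemma sift_roots (bad : nat -> pred nat) Y :
  (forall p t, bad p (t %% p)%N = bad p t) ->
  (forall p, p \in P -> count (bad p) (iota 0 p) = kappa) ->
  (count (fun t => all (fun p => ~~ bad p t) P) (iota 0 Y))%:R <=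
    2 * Y%:R * \prod_(p <- P) (1 - kappa%:R / p%:R) + ((Q ^ 2 * z.+1) ^ 2)%N%:R :> R.
Proof.
move=> per cnt.
pose B t : {set I} := [set i | bad (w i) t]%SET.
have -> : count (fun t => all (fun p => ~~ bad p t) P) (iota 0 Y) = count (fun t => B t == finset.set0) (iota 0 Y).
  apply: eq_count => t; apply/allP/eqP => [h|/setP h p pP].
    by apply/setP => i; rewrite !inE; apply/negbTE/h.
  have ip : (index p P < size P)%N by rewrite index_mem.
  by have := h (Ordinal ip); rewrite !inE /w /= nth_index // => ->.
have Pi0 : 0 < \prod_(p <- P) (1 - kappa%:R / p%:R) :> R.
  rewrite -(big_size_seq _ _ _ (fun p => 1 - kappa%:R / p%:R)); apply: prodr_gt0 => i _.
  by rewrite subr_gt0 g_lt1.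
have G1 := sel_G_ge1 R I g F g_gt0 g_lt1 F0.
have k1 (i : I) : 1 <= kappa%:R :> R by rewrite ler1n.
apply: le_trans (selberg_sieve R I g (fun=> kappa%:R) F g_gt0 g_lt1 F0 k1 Y B _) _.
  move=> U; pose P' := [seq w i | i <- enum U].
  have -> : count (fun t => U \subset B t) (iota 0 Y) = count (fun t => all (fun p => bad p t) P') (iota 0 Y).
    apply: eq_count => t; rewrite all_map; apply/fintype.subsetP/allP => h i.
      by rewrite mem_enum => /h; rewrite inE.
    by move=> iU; rewrite inE; apply: h; rewrite mem_enum.
  have e (H : nat -> R) : \prod_(i in U) H (w i) = \prod_(p <- P') H p by rewrite big_map big_enum.
  rewrite (e (fun p => kappa%:R / p%:R)) (e (fun=> kappa%:R)).
  apply: count_all_roots => //.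
  - rewrite map_inj_uniq ?enum_uniq // => i j /eqP; rewrite nth_uniq // => /eqP; exact: val_inj.
  - by apply/allP => _ /mapP[i _ ->]; exact: allP P_prime _ (wP i).
  - by move=> p /mapP[i _ ->]; exact: cnt.
apply: lerD.
  rewrite (_ : 2 * Y%:R * _ = Y%:R * (2 * \prod_(p <- P) (1 - kappa%:R / p%:R))); last by ring.
  apply: ler_wpM2l => //.
  rewrite -[leRHS]invrK lef_pV2 ?posrE ?invr_gt0 ?mulr_gt0 ?(lt_le_trans ltr01 G1) // invfM.
  by apply: le_trans roots_G_ge; rewrite mulrC.
rewrite natrX ler_sqr ?nnegrE; first exact: roots_error_le.
  by apply: sumr_ge0 => S _; rewrite mulr_ge0 // prodr_ge0.
by [].
Qed.
End SiftRoots.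

(** * Sifting the bottom of a prime chain *)

Section ChainRoots.
Local Open Scope nat_scope.

(* A prime w dividing s_k (j = 0) makes the value at position k + 1 a unit modulo
   w; if w divides the chain restarted from 0 at position j' (j = j' + 1), the
   values at positions j' and k + 1 vanish together modulo w. In all other cases
   the size s + 1 values have distinct roots modulo w. *)
Definition deg_val (s : seq nat) (k j : nat) : nat :=
  if j is j'.+1 then chain 0 (drop (minn j' k) (take k.+1 s)) else nth 0 s k.

Definition degenerate (w : nat) (s : seq nat) : bool :=
  has (fun k => has (fun j => w %| deg_val s k j) (iota 0 (size s).+1)) (iota 0 (size s)).

Definition meets (s : seq nat) (w q : nat) : bool :=
  has (fun i => w %| chain q (take i s)) (iota 0 (size s).+1).

Lemma chain_mod d p q s : p = q %[mod d] -> chain p s = chain q s %[mod d].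
Proof.
elim: s p q => [|m s IH] p q //= e; apply: IH.
by rewrite -addn1 -[(m * q).+1]addn1; apply/eqP; rewrite eqn_modDr -modnMmr e modnMmr.
Qed.

Lemma chain_mod_inj d p q s : all (fun m => coprime d m) s ->
  chain p s = chain q s %[mod d] -> p = q %[mod d].
Proof.
elim: s p q => [|m s IH] p q //= /andP[cm cs] /(IH _ _ cs) /eqP.
rewrite -addn1 -[(m * q).+1]addn1 eqn_modDr => e; apply/eqP.
wlog pq : p q e / q <= p.
  move=> W; case: (leqP q p) => [|/ltnW] h; first exact: W.
  by rewrite eq_sym; apply: W => //; rewrite eq_sym.
rewrite eqn_mod_dvd ?leq_mul2l ?pq ?orbT // -mulnBr Gauss_dvdr // in e.
by rewrite eqn_mod_dvd.
Qed.

Lemma dvdn_mod_eq d m n : m = n %[mod d] -> (d %| m) = (d %| n).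
Proof. by rewrite /dvdn => ->. Qed.

Lemma meets_mod s w q : meets s w (q %% w) = meets s w q.
Proof. by apply: eq_has => i; apply/dvdn_mod_eq/chain_mod; rewrite modn_mod. Qed.

(** Modulo w the value of the chain is an affine function of t with invertible slope, hence a
    permutation of the residues. *)
Lemma count_single_root w W b s : prime w -> coprime w W -> all (fun m => coprime w m) s ->
  count (fun t => w %| chain (b + W * t) s) (iota 0 w) = 1.
Proof.
move=> pw cW cs; have w0 := prime_gt0 pw.
pose f (t : 'I_w) : 'I_w := Ordinal (ltn_pmod (chain (b + W * t) s) w0).
have f_inj : injective f.
  move=> t u [/(chain_mod_inj _ _ _ _ cs)/eqP]; rewrite eqn_modDl => /eqP e; apply: val_inj => /=.
  have := chain_mod_inj w (W * t) (W * u) [::] isT e.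
  have := chain_mod_inj w t u [:: W]; rewrite /= cW => /(_ isT) h _.
  have /h : (W * t).+1 = (W * u).+1 %[mod w].
    by rewrite -addn1 -[(W * u).+1]addn1; apply/eqP; rewrite eqn_modDr; apply/eqP.
  by rewrite !modn_small.
have f_bij : bijective f by exact: injF_bij.
rewrite count_iota_sum (reindex_onto (invF f_inj) f) /=; last by move=> i _; rewrite invF_f.
rewrite (bigD1 (Ordinal w0)) /=; last by rewrite f_invF eqxx.
rewrite big1 => [|i].
  have /(congr1 val) /= e := f_invF f_inj (Ordinal w0).
  by rewrite addn0 /dvdn e.
case/andP=> _ ine; have /(congr1 val) /= e := f_invF f_inj i.
by rewrite /dvdn e; case: eqP => // i0; case/negP: ine; apply/eqP/val_inj.
Qed.

Lemma count_has_disjoint (T : eqType) (r : seq T) (a : T -> pred nat) (u : seq nat) : uniq r ->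
  {in r &, forall i j t, a i t -> a j t -> i = j} ->
  count (fun t => has (fun i => a i t) r) u = \sum_(i <- r) count (a i) u.
Proof.
elim: r => [|i r IH] /=; first by rewrite big_nil (eq_count (a2 := pred0)) ?count_pred0.
move=> /andP[ir ur] H; rewrite big_cons -IH //; last first.
  by move=> x y xr yr; apply: H; rewrite in_cons ?xr ?yr orbT.
rewrite -count_predUI [X in _ = _ + X](eq_count (a2 := pred0)) ?count_pred0 ?addn0 //.
move=> t /=; apply/negP => /andP[ait /hasP[j jr ajt]].
by case/negP: ir; rewrite (H i j _ _ t) // in_cons ?eqxx // jr orbT.
Qed.

Lemma count_chain_roots w W b s : prime w -> coprime w W -> ~~ degenerate w s ->
  count (fun t => meets s w (b + W * t)) (iota 0 w) = (size s).+1.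
Proof.
move=> pw cW /hasPn nd.
have nd' k j : k < size s -> j <= size s -> ~~ (w %| deg_val s k j).
  move=> ks js; have /hasPn h : ~~ has (fun j => w %| deg_val s k j) (iota 0 (size s).+1).
    by apply: nd; rewrite mem_iota.
  by apply: h; rewrite mem_iota.
have cs : all (fun m => coprime w m) s.
  apply/(all_nthP 0) => k ks; rewrite prime_coprime //; exact: (nd' k 0).
rewrite (count_has_disjoint _ _ (fun i t => w %| chain (b + W * t) (take i s))); last 2 first.
- exact: iota_uniq.
- have key i j t : j <= size s -> i < j -> w %| chain (b + W * t) (take i s) ->
     w %| chain (b + W * t) (take j s) -> False.
    move=> js ij wi; have -> : take j s = take i s ++ drop i (take j s).
      by rewrite -[LHS](cat_take_drop i) take_takel // ltnW.
    rewrite chain_cat => wj; case: j js ij wj => // k ks ik.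
    rewrite (dvdn_mod_eq _ _ (chain 0 (drop i (take k.+1 s)))); last first.
      by apply: chain_mod; rewrite mod0n; apply/eqP.
    have := nd' k i.+1 ks (leq_trans ik ks); rewrite /= (minn_idPl _) //.
    by move=> /negP.
  move=> i j; rewrite !mem_iota !add0n !ltnS /= => is_ js t wi wj.
  case: (ltngtP i j) => // ij; first by case: (key i j t js ij wi wj).
  by case: (key j i t is_ ij wj wi).
rewrite (eq_bigr (fun=> 1)) ?sum_nat_seq_const ?size_iota ?muln1 //.
  by rewrite big_const_seq count_predT size_iota iter_addn_0 mul1n.
move=> i _; apply: count_single_root => //.
by apply/allP => m /mem_take /(allP cs).
Qed.

Lemma count_residue_classes (a : pred nat) W Y :
  count a (iota 0 (W * Y)) = \sum_(0 <= b < W) count (fun t => a (b + W * t)) (iota 0 Y).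
Proof.
elim: Y => [|Y IH]; first by rewrite muln0 /= big1.
rewrite mulnS addnC iotaD count_cat IH add0n.
have -> : iota (W * Y) W = [seq W * Y + b | b <- iota 0 W] by rewrite -iotaDl addn0.
rewrite count_map.
have -> : count (preim (addn (W * Y)) a) (iota 0 W) = \sum_(0 <= b < W) a (b + W * Y).
  by rewrite count_iota_sum big_mkord; apply: eq_bigr => b _; rewrite /= addnC.
rewrite -big_split; apply: eq_bigr => b _.
by rewrite -[Y.+1]addn1 iotaD count_cat /= add0n addn0.
Qed.

(** What a prime chain above w0 leaves modulo W = w0!: all its values are units. Unlike primality,
    this depends only on the residue of q. *)
Fixpoint coprime_chain (W q : nat) (s : seq nat) : bool :=
  coprime q W && (if s is m :: s' then coprime_chain W (m * q).+1 s' else true).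

Lemma coprime_chain_mod W p q s : p = q %[mod W] -> coprime_chain W p s = coprime_chain W q s.
Proof.
elim: s p q => [|m s IH] p q e /=; first by rewrite -coprime_modl e coprime_modl.
rewrite -coprime_modl e coprime_modl; congr (_ && _).
by apply: IH; exact: (chain_mod _ _ _ [:: m]).
Qed.

Lemma prime_coprime_fact p n : prime p -> n < p -> coprime p n`!.
Proof.
move=> pp; elim: n => [|n IH] np; first exact: coprimen1.
by rewrite factS coprimeMr IH ?(ltnW np) // andbT prime_coprime // gtnNdvd.
Qed.

Lemma prime_chain_gt q s i : prime_chain q s -> all (leq 1) s -> i <= size s ->
  prime (chain q (take i s)) /\ q <= chain q (take i s).
Proof.
elim: s q i => [|m s IH] q [|i] //= /andP[pq ps] => [_ _|/andP[m1 s1] _|/andP[m1 s1] is_]; rewrite ?pq //.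
have [h1 h2] := IH _ i ps s1 is_; split => //; apply: leq_trans h2.
by rewrite ltnW // ltnS leq_pmull.
Qed.

Lemma prime_chain_coprime w0 q s : prime_chain q s -> all (leq 1) s -> w0 < q ->
  coprime_chain w0`! q s.
Proof.
elim: s q => [|m s IH] q /=.
  by move=> /andP[pq _] _ wq; rewrite prime_coprime_fact.
move=> /andP[pq ps] /andP[m1 s1] wq; rewrite prime_coprime_fact //= IH //.
by apply: leq_trans wq _; rewrite ltnW // ltnS leq_pmull.
Qed.

Lemma prime_chain_meets w q s : prime_chain q s -> all (leq 1) s -> prime w -> w < q -> ~~ meets s w q.
Proof.
move=> qs s1 pw wq; apply/hasPn => i; rewrite mem_iota /= add0n ltnS => is_.
have [pp ge] := prime_chain_gt _ _ _ qs s1 is_.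
by rewrite dvdn_prime2 //; apply: contraTneq ge => <-; rewrite -ltnNge.
Qed.

End ChainRoots.

Section SiftChain.
Local Open Scope ring_scope.
Variable R : realType.

Definition sieving_primes (a z : nat) : seq nat := [seq p <- index_iota a.+1 z.+1 | prime p].

(* The primes up to w0 are handled exactly, by residues modulo w0!, so that
   averaging over s produces the factor totient W / W instead of a singular series. *)
Lemma sift_chain (w0 z : nat) (s : seq nat) (y : nat) :
  (2 <= z)%N -> ((size s).+1 <= w0)%N -> all (leq 1) s ->
  (count (fun q => prime_chain q s && (maxn w0 z < q)%N) (iota 0 y.+1))%:R <=
  (\sum_(0 <= b < w0`! | coprime_chain w0`! b s) 1)%N%:R *
   (2 * (y %/ w0`!).+1%:R *
     (\prod_(p <- sieving_primes w0 z | ~~ degenerate p s) (1 - (size s).+1%:R / p%:R)) +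
   (((z ^ (6 * (size s).+1)) ^ 2 * z.+1) ^ 2)%N%:R) :> R.
Proof.
move=> z2 nw s1; set W := w0`!; set C := (X in _ <= _ * X).
have W0 : (0 < W)%N by exact: fact_gt0.
set a := fun q => _.
apply: (@le_trans _ _ (count a (iota 0 (W * (y %/ W).+1)))%:R).
  rewrite ler_nat; have -> : (W * (y %/ W).+1 = y.+1 + (W * (y %/ W).+1 - y.+1))%N.
    by rewrite subnKC // mulnC ltn_ceil.
  by rewrite iotaD count_cat leq_addr.
rewrite count_residue_classes natr_sum natr_sum mulr_suml [leRHS]big_mkcond; apply: ler_sum => b _.
case: ifPn => [_|nb]; last first.
  rewrite (eq_count (a2 := pred0)) ?count_pred0 // => t; apply/negP => /andP[qs]; rewrite gtn_max => /andP[wq _].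
  have := prime_chain_coprime _ _ _ qs s1 wq; rewrite (coprime_chain_mod _ _ b) ?(negbTE nb) //.
  by rewrite addnC mulnC modnMDl.
rewrite mul1r /C.
pose P := [seq p <- sieving_primes w0 z | ~~ degenerate p s].
have PP p : p \in P -> [/\ prime p, (w0 < p)%N, (p <= z)%N & ~~ degenerate p s].
  by rewrite !mem_filter mem_index_iota ltnS => /and3P[-> -> /andP[-> ->]].
apply: (@le_trans _ _ (count (fun t => all (fun p => ~~ meets s p (b + W * t)) P) (iota 0 (y %/ W).+1))%:R).
  rewrite ler_nat; apply: sub_count => t /andP[qs]; rewrite gtn_max => /andP[_ zq].
  apply/allP => p /PP[pp _ pz _]; apply: prime_chain_meets => //; exact: leq_ltn_trans pz zq.
rewrite -big_filter -/P.
apply: sift_roots => //.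
- by rewrite !filter_uniq // iota_uniq.
- by apply/allP => p /PP[].
- by apply/allP => p /PP[].
- by apply/allP => p /PP[_ wp _ _]; apply: leq_trans wp.
- move=> p t; rewrite -meets_mod -[RHS]meets_mod; congr meets.
  by rewrite -modnDmr modnMmr modnDmr.
- move=> p /PP[pp wp _ nd]; apply: count_chain_roots => //; exact: prime_coprime_fact.
Qed.

End SiftChain.

(** * Rankin weights and averages over the multipliers *)

Section RankinWeights.
Local Open Scope ring_scope.
Variable R : realType.

(** This is m ^ (-1 - sigma); [rankin_mass] is the usual upper bound 1 + 1 / sigma for zeta(1 +
    sigma). *)
Definition rankin (sigma : R) (m : nat) : R := m%:R^-1 * expR (- (sigma * ln m%:R)).
Definition rankin_mass (sigma : R) : R := 1 + sigma^-1.

Lemma rankin_ge0 sigma m : 0 <= rankin sigma m.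
Proof. by rewrite mulr_ge0 ?invr_ge0 ?expR_ge0. Qed.

(** Discrete comparison with the integral of t ^ (-1 - sigma) from m to m + 1, obtained from 1 + u
    <= e ^ u alone. *)
Lemma rankin_telescope sigma m : 0 < sigma -> (0 < m)%N ->
  rankin sigma m.+1 <= sigma^-1 * (expR (- (sigma * ln m%:R)) - expR (- (sigma * ln m.+1%:R))).
Proof.
move=> s0 m0; rewrite -(ler_pM2l s0) [leRHS]mulrA mulfV ?gt_eqF // mul1r /rankin.
have M0 : 0 < m.+1%:R :> R by rewrite ltr0n.
have M0' : 0 < m%:R :> R by rewrite ltr0n.
have -> : expR (- (sigma * ln m%:R)) = expR (- (sigma * ln m.+1%:R)) * expR (sigma * (ln m.+1%:R - ln m%:R)) :> R.
  by rewrite -expRD; congr expR; ring.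
set e := expR (- (sigma * ln m.+1%:R)); have e0 : 0 < e by exact: expR_gt0.
have h : m.+1%:R^-1 <= ln m.+1%:R - ln m%:R :> R.
  have : ln (1 + - m.+1%:R^-1) <= - m.+1%:R^-1 :> R.
    by apply: le_ln1Dx; rewrite ltrN2 invf_lt1 // ltr1n.
  have -> : 1 + - m.+1%:R^-1 = m%:R / m.+1%:R :> R.
    have := lt0r_neq0 M0; rewrite -natr1 => n0; field; exact: n0.
  rewrite lnM ?posrE ?invr_gt0 // lnV ?posrE //; move: (ln m.+1%:R) (ln _) (m.+1%:R^-1) => a b c; lra.
have := expR_ge1Dx (sigma * (ln m.+1%:R - ln m%:R)).
have h' := ler_wpM2l (ltW s0) h.
move=> h2; have : e * (1 + sigma * m.+1%:R^-1) <= e * expR (sigma * (ln m.+1%:R - ln m%:R)).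
  rewrite ler_pM2l //; apply: le_trans h2; by rewrite lerD2l.
by move: (m.+1%:R^-1) => q; lra.
Qed.

Lemma rankin_sum sigma X : 0 < sigma -> \sum_(1 <= m < X.+1) rankin sigma m <= rankin_mass sigma.
Proof.
move=> s0; case: X => [|X]; first by rewrite big_geq // addr_ge0 // invr_ge0 ltW.
rewrite big_ltn //; apply: lerD.
  by rewrite /rankin ln1 mulr0 oppr0 expR0 invr1 mulr1.
apply: (@le_trans _ _ (sigma^-1 * (1 - expR (- (sigma * ln X.+1%:R))))); last first.
  rewrite ler_piMr ?invr_ge0 ?(ltW s0) //; have := expR_ge0 (- (sigma * ln X.+1%:R)); lra.
elim: X => [|X IH]; first by rewrite big_geq // ln1 mulr0 oppr0 expR0 subrr mulr0.
rewrite big_nat_recr //=.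
have := rankin_telescope sigma X.+1 s0 isT; lra.
Qed.

(** Members of one class modulo k lie in different intervals ]j k, (j + 1) k]. For j > 0 such a
    member has weight at most 1 / k times the weight of j; the member with j = 0 is only bounded by
    1, and this isolated 1 is what limits the equidistribution of small multipliers. *)
Lemma rankin_class_sum sigma X k (B : seq nat) : 0 < sigma -> (0 < k)%N -> uniq B ->
  (forall m, m \in B -> (0 < m <= X)%N) -> {in B &, forall m n, m = n %[mod k]} ->
  \sum_(m <- B) rankin sigma m <= 1 + rankin_mass sigma / k%:R.
Proof.
move=> s0 k0 uB BX Bk.
pose H (j : nat) : R := if j is 0%N then 1 else rankin sigma j / k%:R.
apply: (@le_trans _ _ (\sum_(0 <= j < X.+1) H j)); last first.
  rewrite big_ltn // lerD2l big_nat.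
  rewrite (eq_bigr (fun j => rankin sigma j / k%:R)); last by move=> [].
  by rewrite -big_nat -mulr_suml ler_wpM2r ?invr_ge0 // rankin_sum.
apply: (ler_sum_inj _ _ _ (fun m => m.-1 %/ k)%N) => //; first exact: iota_uniq.
- move=> m n mB nB e; have /eqP := Bk m n mB nB.
  have /andP[m0 _] := BX m mB; have /andP[n0 _] := BX n nB.
  rewrite -(prednK m0) -(prednK n0) -[m.-1.+1]addn1 -[n.-1.+1]addn1 eqn_modDr => /eqP e2.
  by congr (_ + _)%N; rewrite (divn_eq m.-1 k) (divn_eq n.-1 k) e e2.
- move=> m /BX/andP[m0 mX]; rewrite mem_index_iota /= ltnS.
  apply: leq_trans (leq_div _ _) _; lia.
- move=> m /BX/andP[m0 mX]; set j := (m.-1 %/ k)%N.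
  have jm : (j * k < m)%N by have := leq_divM m.-1 k; rewrite -/j; lia.
  rewrite /H; case ej : j jm => [|j'] jm; rewrite -?ej.
    rewrite /rankin mulr_ile1 ?invr_ge0 ?expR_ge0 //; first by rewrite invf_le1 ?ltr0n // ler1n.
    by rewrite -[leRHS]expR0 ler_expR oppr_le0 mulr_ge0 ?ln_nat_ge0 // ltW.
  rewrite /rankin mulrAC -invfM -natrM; apply: ler_pM; rewrite ?invr_ge0 ?expR_ge0 //.
    have j0 : (0 < j)%N by rewrite ej.
    have jk0 : (0 < j * k)%N by rewrite muln_gt0 ej k0.
    by rewrite lef_pV2 ?posrE ?ltr0n // ler_nat ej ltnW.
  have j0 : (0 < j)%N by rewrite ej.
  rewrite ler_expR lerN2 ler_pM2l // ler_ln ?posrE ?ltr0n ?ler_nat //.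
  by apply: leq_trans (ltnW jm); rewrite ej leq_pmulr.
- by case=> [|j] //=; rewrite divr_ge0 // rankin_ge0.
Qed.

(** The map a -> a p + 1 permutes the residues modulo W. The count being exactly phi(W) for every
    unit p, each link contributes the same factor, which is why the small primes average out. *)
Lemma count_coprime_affine W p : (0 < W)%N -> coprime p W ->
  (\sum_(0 <= a < W | coprime (a * p).+1 W) 1 = totient W)%N.
Proof.
move=> W0 cp; rewrite totient_count_coprime big_mkcond /= !big_mkord.
pose f (a : 'I_W) : 'I_W := Ordinal (ltn_pmod (a * p).+1 W0).
have f_inj : injective f.
  move=> a b [] e; apply: val_inj => /=.
  have : (p * a).+1 = (p * b).+1 %[mod W] by rewrite !(mulnC p).
  move=> e2; have := chain_mod_inj W a b [:: p]; rewrite /= coprime_sym cp => /(_ isT e2).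
  by rewrite !modn_small.
rewrite [RHS](reindex f) /=; last exact/onW_bij/injF_bij.
by apply: eq_bigr => a _; rewrite [in RHS]coprime_sym coprime_modl; case: coprime.
Qed.

(** After splitting modulo W, the condition [C] confines v to a single class modulo d W in each of
    the phi(W) admissible classes. *)
Lemma rankin_step sigma X W p d (C : pred nat) : 0 < sigma -> (0 < W)%N -> (0 < d)%N ->
  coprime p W -> coprime d W -> (forall u v, C u -> C v -> u = v %[mod d]) ->
  \sum_(1 <= v < X.+1) rankin sigma v * (coprime (v * p).+1 W && C v)%:R <=
    (totient W)%:R * (1 + rankin_mass sigma / (d * W)%:R).
Proof.
move=> s0 W0 d0 cp cd CC.
rewrite -(count_coprime_affine W p W0 cp) natr_sum mulr_suml.
have -> : \sum_(1 <= v < X.+1) rankin sigma v * (coprime (v * p).+1 W && C v)%:R =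
  \sum_(0 <= a < W) \sum_(1 <= v < X.+1) (v %% W == a)%N%:R * (rankin sigma v * (coprime (v * p).+1 W && C v)%:R).
  rewrite exchange_big /=; apply: eq_bigr => v _.
  rewrite -mulr_suml -[LHS]mul1r; congr (_ * _).
  rewrite big_mkord (bigD1 (Ordinal (ltn_pmod v W0))) //= eqxx big1 ?addr0 // => i iv.
  by case: eqP => // e; case/negP: iv; apply/eqP/val_inj.
rewrite [leRHS]big_mkcond /=; apply: ler_sum => a _.
case: ifPn => ca; last first.
  rewrite big1 // => v _; case: eqP => [e|_]; last by rewrite mul0r.
  have -> : coprime (v * p).+1 W = coprime (a * p).+1 W.
    by rewrite -coprime_modl -e -addn1 -modnDml -modnMml modnDml addn1 coprime_modl.
  by rewrite (negbTE ca) !mulr0.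
rewrite mul1r.
pose B := [seq v <- index_iota 1 X.+1 | (v %% W == a)%N && C v].
apply: (@le_trans _ _ (\sum_(v <- B) rankin sigma v)).
  rewrite big_filter [leRHS]big_mkcond /=; apply: ler_sum => v _.
  case: (_ == a)%N; rewrite ?mul0r ?mul1r //=.
  case: (C v); last by rewrite andbF mulr0.
  by rewrite andbT; case: coprime; rewrite ?mulr1 ?mulr0 ?rankin_ge0.
apply: (rankin_class_sum _ X) => //.
- by rewrite muln_gt0 d0.
- by rewrite filter_uniq // iota_uniq.
- by move=> m; rewrite mem_filter mem_index_iota ltnS => /andP[_].
- move=> u v; rewrite !mem_filter => /andP[/andP[/eqP eu Cu] _] /andP[/andP[/eqP ev Cv] _].
  apply/eqP; rewrite chinese_remainder // eu ev eqxx andbT; apply/eqP; exact: CC.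
Qed.

End RankinWeights.

(** * Averages over lists of multipliers *)

Section ListSums.
Local Open Scope ring_scope.
Variable R : realType.

(** The bottom multiplier is summed outermost: the next value of a chain depends only on the
    multipliers below it, so the conditions can be summed out link by link. *)
Fixpoint lsum (X n : nat) (F : seq nat -> R) : R :=
  if n is n'.+1 then \sum_(1 <= v < X.+1) lsum X n' (fun s => F (v :: s)) else F [::].

Definition in_box (X n : nat) (s : seq nat) := (size s == n) && all (fun v => 0 < v <= X)%N s.

Lemma ler_lsum X n (F G : seq nat -> R) : (forall s, in_box X n s -> F s <= G s) -> lsum X n F <= lsum X n G.
Proof.
elim: n F G => [|n IH] F G H /=; first exact: H.
rewrite big_nat [leRHS]big_nat; apply: ler_sum => v vX; apply: IH => s /andP[ss sX].
by apply: H; rewrite /in_box /= eqSS ss sX andbT.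
Qed.

Lemma eq_lsum X n (F G : seq nat -> R) : F =1 G -> lsum X n F = lsum X n G.
Proof. by elim: n F G => [|n IH] F G H /=; [exact: H | apply: eq_bigr => v _; apply: IH => s; exact: H]. Qed.

Lemma lsum_scale X n c (F : seq nat -> R) : lsum X n (fun s => c * F s) = c * lsum X n F.
Proof. by elim: n F => [|n IH] F //=; rewrite mulr_sumr; apply: eq_bigr => v _; rewrite IH. Qed.

Lemma lsum_add X n (F G : seq nat -> R) : lsum X n (fun s => F s + G s) = lsum X n F + lsum X n G.
Proof. by elim: n F G => [|n IH] F G //=; rewrite -big_split; apply: eq_bigr => v _; rewrite IH. Qed.

Lemma lsum0 X n : lsum X n (fun=> 0) = 0.
Proof. by elim: n => [|n IH] //=; rewrite big1. Qed.

Lemma lsum_sum X n (T : Type) (r : seq T) (P : pred T) (F : T -> seq nat -> R) :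
  lsum X n (fun s => \sum_(i <- r | P i) F i s) = \sum_(i <- r | P i) lsum X n (F i).
Proof.
elim: r => [|i r IH]; first by rewrite big_nil -[RHS](lsum0 X n); apply: eq_lsum => s; rewrite big_nil.
rewrite big_cons -IH; case: ifP => Pi.
  by rewrite -lsum_add; apply: eq_lsum => s; rewrite big_cons Pi.
by apply: eq_lsum => s; rewrite big_cons Pi.
Qed.

Lemma lsum_ge0 X n (F : seq nat -> R) : (forall s, 0 <= F s) -> 0 <= lsum X n F.
Proof. by elim: n F => [|n IH] F H /=; [exact: H | apply: sumr_ge0 => v _; exact: IH]. Qed.

Lemma lsum_ge_term X n (F : seq nat -> R) s : (forall s, 0 <= F s) -> in_box X n s -> F s <= lsum X n F.
Proof.
elim: n F s => [|n IH] F s F0 /andP[/eqP ss sX] /=; first by rewrite (size0nil ss).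
case: s ss sX => // v s /= [ss] /andP[vX sX].
rewrite (bigD1_seq v) /=; last exact: iota_uniq.
  apply: ler_wpDr; first by apply: sumr_ge0 => u _; apply: lsum_ge0.
  by apply: (IH (fun s => F (v :: s))) => //; rewrite /in_box ss eqxx.
by rewrite mem_index_iota ltnS.
Qed.

Fixpoint weight (sg : seq R) (s : seq nat) : R :=
  match sg, s with
  | sigma :: sg', v :: s' => rankin R sigma v * weight sg' s'
  | _, _ => 1
  end.

Lemma weight_ge0 sg s : 0 <= weight sg s.
Proof. by elim: sg s => [|x sg IH] [|v s] //=; rewrite mulr_ge0 ?rankin_ge0. Qed.

Variables (X W : nat) (eps : R).
Hypothesis W_gt0 : (0 < W)%N.
Hypothesis eps_le1 : eps <= 1.

(** The share of one class modulo W is mass / W, plus the isolated 1. A good exponent makes that 1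
    at most eps times mass / W; the factor 2 absorbs it for an unconstrained link, and a link
    constrained modulo d gains eps + 1 / d. *)
Definition mass_bound (sigma : R) : R := (totient W)%:R * (2 * rankin_mass R sigma / W%:R).
Definition good_exponent (sigma : R) := (0 < sigma) && (W%:R <= eps * rankin_mass R sigma).

Lemma rankin_mass_gt0 sigma : 0 < sigma -> 0 < rankin_mass R sigma.
Proof. by move=> s0; rewrite addr_gt0 ?invr_gt0. Qed.

Lemma mass_bound_ge0 sigma : good_exponent sigma -> 0 <= mass_bound sigma.
Proof.
by move=> /andP[s0 _]; rewrite mulr_ge0 // divr_ge0 // mulr_ge0 // ltW // rankin_mass_gt0.
Qed.

Lemma prod_mass_ge0 sg : all good_exponent sg -> 0 <= \prod_(sigma <- sg) mass_bound sigma.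
Proof. by move=> h; rewrite big_seq; apply: prodr_ge0 => x /(allP h); exact: mass_bound_ge0. Qed.

Lemma step_free sigma p : good_exponent sigma -> coprime p W ->
  \sum_(1 <= v < X.+1) rankin R sigma v * (coprime (v * p).+1 W)%:R <= mass_bound sigma.
Proof.
move=> /andP[s0 sW] cp.
have h := rankin_step R sigma X W p 1 xpredT s0 W_gt0 isT cp (coprime1n _) (fun u v _ _ => etrans (modn1 u) (esym (modn1 v))).
rewrite mul1n in h; apply: le_trans (le_trans h _).
  by apply: ler_sum => v _; rewrite andbT.
apply: ler_wpM2l => //; rewrite ler_pdivlMr ?ltr0n // mulrDl mul1r mulfVK ?pnatr_eq0 -?lt0n //.
have := rankin_mass_gt0 _ s0.
have : eps * rankin_mass R sigma <= rankin_mass R sigma by rewrite ler_piMl // ltW // rankin_mass_gt0.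
lra.
Qed.

Lemma step_constrained sigma p d (C : pred nat) : good_exponent sigma -> coprime p W ->
  (0 < d)%N -> coprime d W -> (forall u v, C u -> C v -> u = v %[mod d]) ->
  \sum_(1 <= v < X.+1) rankin R sigma v * (coprime (v * p).+1 W && C v)%:R <= mass_bound sigma * (eps + d%:R^-1).
Proof.
move=> /andP[s0 sW] cp d0 cd CC.
apply: le_trans (rankin_step R sigma X W p d C s0 W_gt0 d0 cp cd CC) _.
rewrite /mass_bound -mulrA; apply: ler_wpM2l => //.
have Z0 := rankin_mass_gt0 _ s0; set Z := rankin_mass R sigma in sW Z0 *.
have W0 : 0 < W%:R :> R by rewrite ltr0n.
have D0 : 0 < d%:R :> R by rewrite ltr0n.
have -> : 2 * Z / W%:R * (eps + d%:R^-1) = 2 * (eps * Z / W%:R) + 2 * (Z / (d * W)%:R).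
  rewrite natrM; have := lt0r_neq0 W0; have := lt0r_neq0 D0; move: (d%:R) (W%:R) => a b ? ?; field; exact/andP.
have h : 1 <= eps * Z / W%:R by rewrite ler_pdivlMr // mul1r.
have : 0 <= Z / (d * W)%:R by rewrite divr_ge0 // ltW.
lra.
Qed.

Lemma lsum_coprime_chain sg p : all good_exponent sg ->
  lsum X (size sg) (fun s => weight sg s * (coprime_chain W p s)%:R) <=
    (coprime p W)%:R * \prod_(sigma <- sg) mass_bound sigma.
Proof.
elim: sg p => [|sigma sg IH] p /=; first by rewrite big_nil mul1r mulr1 andbT.
move=> /andP[gs gsg]; rewrite big_cons.
have [cp|cp] := boolP (coprime p W); last first.
  rewrite mul0r big1 // => v _; rewrite (eq_lsum _ _ _ (fun=> 0)) ?lsum0 // => s /=.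
  by rewrite mulr0.
rewrite mul1r.
apply: (@le_trans _ _ (\sum_(1 <= v < X.+1) rankin R sigma v * (coprime (v * p).+1 W)%:R * \prod_(s <- sg) mass_bound s)).
  apply: ler_sum => v _; rewrite -mulrA.
  apply: le_trans (ler_wpM2l (rankin_ge0 R sigma v) (IH (v * p).+1 gsg)).
  by rewrite -lsum_scale; apply: ler_lsum => s _ /=; rewrite mulrA.
rewrite -mulr_suml ler_wpM2r ?prod_mass_ge0 //; exact: step_free.
Qed.

(** For given lower multipliers the condition fixes the multiplier at position [k] modulo d. Only
    this link gains the factor eps + 1 / d; the links above it are summed out by the unconstrained
    bound. *)
Lemma lsum_coprime_chain_constrained sg p d (C : pred (seq nat)) k : all good_exponent sg -> (k < size sg)%N ->
  (0 < d)%N -> coprime d W ->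
  (forall s u v, size s = k -> C (rcons s u) -> C (rcons s v) -> u = v %[mod d]) ->
  lsum X (size sg) (fun s => weight sg s * (coprime_chain W p s && C (take k.+1 s))%:R) <=
    (coprime p W)%:R * (\prod_(sigma <- sg) mass_bound sigma * (eps + d%:R^-1)).
Proof.
elim: sg p C k => [|sigma sg IH] p C k //= /andP[gs gsg] ks d0 cd CC; rewrite big_cons.
have [cp|cp] := boolP (coprime p W); last first.
  rewrite mul0r big1 // => v _; rewrite (eq_lsum _ _ _ (fun=> 0)) ?lsum0 // => s /=.
  by rewrite mulr0.
rewrite mul1r.
case: k ks CC => [|k] ks CC.
  apply: (@le_trans _ _ (\sum_(1 <= v < X.+1) rankin R sigma v * (coprime (v * p).+1 W && C [:: v])%:R * \prod_(s <- sg) mass_bound s)).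
    apply: ler_sum => v _; rewrite -mulrA.
    rewrite (eq_lsum _ _ _ (fun s => rankin R sigma v * (C [:: v])%:R * (weight sg s * (coprime_chain W (v * p).+1 s)%:R))); last first.
      move=> s /=; rewrite take0 /= -mulnb natrM; ring.
    rewrite lsum_scale -mulrA ler_wpM2l ?rankin_ge0 //.
    rewrite andbC -mulnb natrM -mulrA ler_wpM2l //; exact: lsum_coprime_chain.
  rewrite -mulr_suml mulrAC ler_wpM2r ?prod_mass_ge0 //; apply: step_constrained => //.
  by move=> u v; exact: (CC [::]).
apply: (@le_trans _ _ (\sum_(1 <= v < X.+1) rankin R sigma v * (coprime (v * p).+1 W)%:R * (\prod_(s <- sg) mass_bound s * (eps + d%:R^-1)))).
  apply: ler_sum => v _; rewrite -mulrA.
  have CC' s u w : size s = k -> C (v :: rcons s u) -> C (v :: rcons s w) -> u = w %[mod d].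
    by move=> sk; apply: (CC (v :: s)); rewrite /= sk.
  apply: le_trans (ler_wpM2l (rankin_ge0 R sigma v) (IH (v * p).+1 (fun s => C (v :: s)) k gsg ks d0 cd CC')).
  by rewrite -lsum_scale; apply: ler_lsum => s _ /=; rewrite mulrA.
rewrite -mulr_suml -mulrA; apply: ler_wpM2r; last exact: step_free.
have [s0 sW] := andP gs.
rewrite mulr_ge0 ?prod_mass_ge0 // addr_ge0 ?invr_ge0 //.
by rewrite -(pmulr_lge0 _ (rankin_mass_gt0 _ s0)) (le_trans _ sW).
Qed.

Lemma deg_val_take s k j : (k < size s)%N -> deg_val (take k.+1 s) k j = deg_val s k j.
Proof. by move=> ks; case: j => [|j] /=; rewrite ?nth_take // take_takel. Qed.

(** The restarted chain ends in m N + 1, with m the last multiplier and N independent of m. If d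
    divides this, then N is a unit modulo d and m is determined modulo d. *)
Lemma deg_val_class d s u v j : (d %| deg_val (rcons s u) (size s) j)%N ->
  (d %| deg_val (rcons s v) (size s) j)%N -> u = v %[mod d].
Proof.
case: j => [|j] /=; first by rewrite !nth_rcons ltnn eqxx /dvdn => /eqP -> /eqP ->.
rewrite !take_oversize ?size_rcons // !drop_rcons ?geq_minr // /chain -!cats1 !foldl_cat /=.
set N := foldl _ _ _ => du dv.
have cdN : coprime d N by apply: coprime_dvdl du _; apply: coprime_dvdr (coprimeSn _); exact: dvdn_mull.
apply: (chain_mod_inj d u v [:: N]); first by rewrite /= cdN.
by rewrite /= !(mulnC N); move: du dv; rewrite /dvdn => /eqP -> /eqP ->.
Qed.

(* Expanding the product over P and inserting one prime at a time, the modulus d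
   collects the primes already required to divide deg_val; eps accounts for the
   multipliers that are too small to be equidistributed modulo d W. *)
Lemma lsum_degenerate_average sg k j c (P : seq nat) : all good_exponent sg -> (k < size sg)%N ->
  uniq P -> all prime P -> all (fun p => coprime p W) P -> 0 <= eps -> 0 <= c ->
  \sum_(0 <= b < W) lsum X (size sg) (fun s => weight sg s * (coprime_chain W b s)%:R *
     \prod_(p <- P | (p %| deg_val s k j)%N) (1 + c / p%:R)) <=
  (totient W)%:R * \prod_(sigma <- sg) mass_bound sigma *
    (eps * \prod_(p <- P) (1 + c / p%:R) + \prod_(p <- P) (1 + c / p%:R ^+ 2)).
Proof.
move=> gsg ks uP pP cP e0 c0.
have key b : lsum X (size sg) (fun s => weight sg s * (coprime_chain W b s)%:R *
     \prod_(p <- P | (p %| deg_val s k j)%N) (1 + c / p%:R)) <=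
   (coprime b W)%:R * (\prod_(sigma <- sg) mass_bound sigma *
    (eps * \prod_(p <- P) (1 + c / p%:R) + \prod_(p <- P) (1 + c / p%:R ^+ 2))).
  have gen d : (0 < d)%N -> coprime d W -> all (fun p => coprime p d) P ->
    lsum X (size sg) (fun s => weight sg s * (coprime_chain W b s && (d %| deg_val s k j)%N)%:R *
     \prod_(p <- P | (p %| deg_val s k j)%N) (1 + c / p%:R)) <=
    (coprime b W)%:R * (\prod_(sigma <- sg) mass_bound sigma *
    (eps * \prod_(p <- P) (1 + c / p%:R) + d%:R^-1 * \prod_(p <- P) (1 + c / p%:R ^+ 2))).
    elim: P d uP pP cP => [|p P IH] d /=.
      move=> _ _ _ d0 cd _; rewrite !big_nil !mulr1.
      apply: le_trans (lsum_coprime_chain_constrained sg b d (fun s => d %| deg_val s k j)%N k gsg ks d0 cd _).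
        apply: ler_lsum => s /andP[/eqP ss _]; rewrite big_nil mulr1 deg_val_take ?ss //.
      by move=> s u v <-; exact: deg_val_class.
    move=> /andP[pnP uP] /andP[pp pP] /andP[cpW cP] d0 cd /andP[cpd cPd].
    have p0 : (0 < p)%N by exact: prime_gt0.
    have h1 := IH d uP pP cP d0 cd cPd.
    have h2 := IH (d * p)%N uP pP cP.
    have {}h2 := h2 _ _ _.
    rewrite !big_cons.
    set A := \prod_(p <- P) (1 + c / p%:R) in h1 h2 *; set B := \prod_(p <- P) (1 + c / p%:R ^+ 2) in h1 h2 *.
    rewrite (eq_lsum _ _ _ (fun s => weight sg s * (coprime_chain W b s && (d %| deg_val s k j)%N)%:R *
        \prod_(p <- P | (p %| deg_val s k j)%N) (1 + c / p%:R) +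
        c / p%:R * (weight sg s * (coprime_chain W b s && (d * p %| deg_val s k j)%N)%:R *
          \prod_(p <- P | (p %| deg_val s k j)%N) (1 + c / p%:R)))); last first.
      move=> s; rewrite big_cons Gauss_dvd 1?coprime_sym //.
      case: ifP => pd; last by rewrite !andbF mulr0 mul0r mulr0 addr0.
      by rewrite andbT; ring.
    rewrite lsum_add lsum_scale.
    have cp0 : 0 <= c / p%:R by rewrite divr_ge0.
    apply: le_trans (lerD h1 (ler_wpM2l cp0 (h2 _ _ _))) _.
    - by rewrite muln_gt0 d0.
    - by rewrite coprimeMl cd.
    - apply/allP => q qP; rewrite coprimeMr (allP cPd _ qP) /=.
      have qq := allP pP _ qP.
      by rewrite prime_coprime // dvdn_prime2 //; apply: contra pnP => /eqP <-.
    rewrite le_eqVlt; apply/orP; left; apply/eqP.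
    rewrite natrM; have : p%:R != 0 :> R by rewrite pnatr_eq0 -lt0n.
    have : d%:R != 0 :> R by rewrite pnatr_eq0 -lt0n.
    move: (d%:R) (p%:R) => x y x0 y0; field; exact/andP.
  have all1 : all (fun p => coprime p 1) P by apply/allP => p _; exact: coprimen1.
  have := gen 1%N isT (coprime1n _) all1; rewrite invr1 mul1r; apply: le_trans.
  by apply: ler_lsum => s _; rewrite dvd1n andbT.
apply: le_trans (ler_sum _ (fun b _ => key b)) _.
rewrite -mulr_suml -!mulrA; apply: ler_wpM2r.
  rewrite mulr_ge0 ?prod_mass_ge0 // addr_ge0 ?mulr_ge0 //; apply: prodr_ge0 => p _.
    by rewrite addr_ge0 // divr_ge0.
  by rewrite addr_ge0 // divr_ge0 // exprn_ge0.
by rewrite totient_count_coprime natr_sum; apply: ler_sum => b _; rewrite coprime_sym.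
Qed.
End ListSums.

(** * Densities and the contribution of degenerate primes *)

Section PrimeProducts.
Local Open Scope ring_scope.
Variable R : realType.

Lemma sieving_primesP a z p : (p \in sieving_primes a z) = [&& prime p, (a < p)%N & (p <= z)%N].
Proof. by rewrite mem_filter mem_index_iota ltnS. Qed.

Lemma sieving_primes_uniq a z : uniq (sieving_primes a z).
Proof. by rewrite filter_uniq // iota_uniq. Qed.

Lemma ln2_ge : 2^-1 <= ln 2 :> R.
Proof.
rewrite -[leLHS]expRK ler_ln ?posrE ?expR_gt0 //.
have := @expR_le_1D2 R 2^-1; rewrite lexx andbT invr_ge0 => /(_ (ler0n _ 2)); lra.
Qed.

Lemma sum_inv_sieving_primes a z : (1 < a)%N ->
  \sum_(p <- sieving_primes a z) p%:R^-1 <= 2 * ln z%:R / ln a%:R :> R.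
Proof.
move=> a1; have la : 0 < ln a%:R :> R by rewrite ln_gt0 // ltr1n.
rewrite ler_pdivlMr // mulr_suml; apply: le_trans (sum_ln_prime_div R z).
rewrite -[leRHS]big_filter.
apply: (@le_trans _ _ (\sum_(p <- sieving_primes a z) ln p%:R / p%:R)).
  rewrite big_seq [leRHS]big_seq; apply: ler_sum => p; rewrite sieving_primesP => /and3P[pp ap _].
  have p0 := prime_gt0 pp; have a0 := ltnW a1.
  by rewrite mulrC ler_wpM2r ?invr_ge0 // ler_ln ?posrE ?ltr0n // ler_nat ltnW.
apply: ler_sum_subset; first exact: sieving_primes_uniq.
- by rewrite filter_uniq // iota_uniq.
- move=> p; rewrite sieving_primesP mem_filter mem_index_iota ltnS => /and3P[-> ap ->].
  by rewrite andbT /=; lia.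
- by move=> p; rewrite divr_ge0 // ln_nat_ge0.
Qed.

Lemma prod_1D_le_expR (r : seq nat) (F : nat -> R) : (forall p, 0 <= F p) ->
  \prod_(p <- r) (1 + F p) <= expR (\sum_(p <- r) F p).
Proof.
move=> F0; rewrite -expR_sum; apply: ler_prod => p _.
by rewrite addr_ge0 //= expR_ge1Dx.
Qed.

(** Once ln a >= 8 c, Chebyshev's bound for the sum of 1 / p suffices: the product over the primes
    up to w = z ^ 2 is at most w ^ (1 / 4). *)
Lemma prod_1D_sieving_primes (c : R) a z : 0 <= c -> (1 < a)%N -> 8 * c <= ln a%:R -> (0 < z)%N ->
  (\prod_(p <- sieving_primes a (z ^ 2)) (1 + c / p%:R)) ^+ 2 <= z%:R.
Proof.
move=> c0 a1 ca z0.
have la : 0 < ln a%:R :> R by rewrite ln_gt0 // ltr1n.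
have zR : 0 < z%:R :> R by rewrite ltr0n.
set A := \prod_(_ <- _) _.
have A0 : 0 <= A by apply: prodr_ge0 => p _; rewrite addr_ge0 // divr_ge0.
have : A <= expR (2^-1 * ln z%:R).
  apply: le_trans (prod_1D_le_expR _ _ _) _; first by move=> p; rewrite divr_ge0.
  rewrite ler_expR -mulr_sumr.
  apply: le_trans (ler_wpM2l c0 (sum_inv_sieving_primes _ _ a1)) _.
  rewrite natrX lnXn // -(mulr_natr (ln _)) [leLHS]mulrA ler_pdivrMr //.
  have lz : 0 <= ln z%:R :> R by exact: ln_nat_ge0.
  have := ler_wpM2r lz ca; lra.
move=> h; have e0 : 0 <= expR (2^-1 * ln z%:R) :> R by exact: expR_ge0.
have : A ^+ 2 <= expR (2^-1 * ln z%:R) ^+ 2 by rewrite ler_sqr ?nnegrE.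
rewrite -expRM_natl mulrA mulfV // mul1r lnK // ?posrE //.
Qed.

Lemma sum_inv_sqr a z : (0 < a)%N -> \sum_(a.+1 <= k < z.+1) (k%:R ^+ 2)^-1 <= a%:R^-1 :> R.
Proof.
move=> a0; have aR : 0 < a%:R :> R by rewrite ltr0n.
have [az|za] := leqP a z; last by rewrite big_geq ?invr_ge0 // ltnW.
apply: (@le_trans _ _ (a%:R^-1 - z%:R^-1)); last by rewrite gerBl invr_ge0.
have {az} -> : z = (a + (z - a))%N by lia.
elim: (z - a)%N => [|m IH]; first by rewrite addn0 big_geq // subrr.
rewrite addnS big_nat_recr /=; last by lia.
apply: le_trans (lerD IH (lexx _)) _.
have k0 : 0 < (a + m)%:R :> R by rewrite ltr0n; lia.
rewrite -natr1; move: ((a + m)%N%:R) k0 => k k0.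
have h : (k + 1)^-1 ^+ 2 <= k^-1 - (k + 1)^-1.
  have -> : k^-1 - (k + 1)^-1 = k^-1 * (k + 1)^-1.
    by field; rewrite !gt_eqF // ltr_wpDl // ltW.
  by rewrite expr2 ler_wpM2r ?invr_ge0 ?addr_ge0 ?(ltW k0) // lef_pV2 ?posrE ?ltr_wpDl ?(ltW k0) //; lra.
by rewrite -exprVn; lra.
Qed.

(** The second factor 1 / p is the share of multipliers for which p divides a given [deg_val]. With
    it the sum over p > a converges and is at most 1 / a, so degenerate primes cost a bounded factor
    on average. *)
Lemma prod_1D_sqr_sieving_primes (c : R) a z : 0 <= c -> (0 < a)%N -> 2 * c <= a%:R ->
  \prod_(p <- sieving_primes a z) (1 + c / p%:R ^+ 2) <= 2.
Proof.
move=> c0 a0 ca; have aR : 0 < a%:R :> R by rewrite ltr0n.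
apply: le_trans (prod_1D_le_expR _ _ _) _; first by move=> p; rewrite divr_ge0 // exprn_ge0.
apply: (@le_trans _ _ (expR 2^-1)); last first.
  have := @expR_le_1D2 R 2^-1; rewrite lexx andbT invr_ge0 => /(_ (ler0n _ 2)); lra.
rewrite ler_expR -mulr_sumr.
have : \sum_(p <- sieving_primes a z) (p%:R ^+ 2)^-1 <= a%:R^-1 :> R.
  apply: le_trans (sum_inv_sqr a z a0); rewrite big_filter big_mkcond; apply: ler_sum => p _.
  by case: ifP => // _; rewrite invr_ge0 exprn_ge0.
move=> h; apply: le_trans (ler_wpM2l c0 h) _; rewrite ler_pdivrMr //; lra.
Qed.

Lemma expRN_le_1B (u : R) : 0 <= u <= 2^-1 -> expR (- (2 * u)) <= 1 - u.
Proof.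
move=> /andP[u0 u1]; have := expR_ge1Dx (2 * u) => h.
rewrite expRN -div1r ler_pdivrMr ?expR_gt0 //.
have : (1 - u) * (1 + 2 * u) <= (1 - u) * expR (2 * u) by rewrite ler_wpM2l //; lra.
nra.
Qed.

(** A crude bound by a power of z, sufficient for comparing the density with the sieve remainder. *)
Lemma prod_1B_sieving_primes_ge kappa a z : (1 < a)%N -> (2 * kappa <= a)%N -> 2 <= ln a%:R :> R -> (0 < z)%N ->
  (z%:R ^+ (2 * kappa))^-1 <= \prod_(p <- sieving_primes a z) (1 - kappa%:R / p%:R) :> R.
Proof.
move=> a1 ka la2 z0; have zR : 0 < z%:R :> R by rewrite ltr0n.
apply: (@le_trans _ _ (\prod_(p <- sieving_primes a z) expR (- (2 * (kappa%:R / p%:R))))); last first.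
  rewrite big_seq [leRHS]big_seq; apply: ler_prod => p; rewrite sieving_primesP => /and3P[pp ap _].
  have pR : 0 < p%:R :> R by rewrite ltr0n prime_gt0.
  rewrite expR_ge0 /= expRN_le_1B // divr_ge0 //= ler_pdivrMr // ler_pdivlMl //.
  by rewrite -[2]/(2%:R) -natrM ler_nat; lia.
rewrite expR_sum; have -> : z%:R ^+ (2 * kappa) = expR ((2 * kappa)%N%:R * ln z%:R) :> R.
  by rewrite expRM_natl lnK // posrE.
rewrite -expRN ler_expR.
have -> : \sum_(p <- sieving_primes a z) - (2 * (kappa%:R / p%:R)) =
    - ((2 * kappa)%N%:R * \sum_(p <- sieving_primes a z) p%:R^-1) :> R.
  by rewrite sumrN mulr_sumr; congr (- _); apply: eq_bigr => p _; rewrite natrM mulrA.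
rewrite lerN2 ler_wpM2l // (le_trans (sum_inv_sieving_primes _ _ a1)) //.
have lz : 0 <= ln z%:R :> R by exact: ln_nat_ge0.
rewrite ler_pdivrMr; last by lra.
have := ler_wpM2r lz la2; lra.
Qed.

Lemma bernoulli (a : R) k : 0 <= a <= 1 -> 1 - k%:R * a <= (1 - a) ^+ k.
Proof.
move=> /andP[a0 a1]; elim: k => [|k IH]; first by rewrite mul0r subr0 expr0.
rewrite exprS; have : (1 - a) * (1 - k%:R * a) <= (1 - a) * (1 - a) ^+ k by rewrite ler_wpM2l //; lra.
apply: le_trans; rewrite -natr1.
have k0 : 0 <= k%:R :> R by [].
have : 0 <= k%:R * (a * a) by rewrite !mulr_ge0.
lra.
Qed.

Lemma totient_prod n : (0 < n)%N -> (totient n)%:R / n%:R = \prod_(p <- primes n) (1 - p%:R^-1) :> R.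
Proof.
move=> n0; rewrite totientE // {3}(prod_prime_decomp n0) prime_decompE big_map /=.
rewrite !natr_prod -prodf_div big_seq [RHS]big_seq; apply: eq_bigr => p.
rewrite mem_primes => /and3P[pp _ pn].
have p0 : p%:R != 0 :> R by rewrite pnatr_eq0 -lt0n prime_gt0.
have : (0 < logn p n)%N by rewrite logn_gt0 mem_primes pp n0 pn.
case: (logn p n) => // k _ /=.
rewrite natrM expnS natrM natrX -subn1 natrB ?prime_gt0 //.
by move: (p%:R) p0 => x x0; field; rewrite x0 expf_neq0.
Qed.

Lemma primes_fact w0 : perm_eq (primes w0`!) [seq p <- index_iota 1 w0.+1 | prime p].
Proof.
apply: uniq_perm; first exact: primes_uniq; first by rewrite filter_uniq // iota_uniq.
move=> p; rewrite mem_primes mem_filter mem_index_iota fact_gt0 ltnS /=.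
case: (boolP (prime p)) => //= pp; rewrite prime_gt0 //=.
have [pw|wp] := leqP p w0; first by rewrite dvdn_fact // prime_gt0.
by have := prime_coprime_fact _ _ pp wp; rewrite prime_coprime // => /negbTE.
Qed.


(** The primes up to w0 come from phi(W) / W, the others from Bernoulli's inequality 1 - kappa / p
    <= (1 - 1 / p) ^ kappa. Together they form the kappa-th power of the Euler product up to z. *)
Lemma sifted_density kappa w0 z : (1 < z)%N -> (kappa <= w0 <= z)%N ->
  ((totient w0`!)%:R / (w0`!)%:R) ^+ kappa * \prod_(p <- sieving_primes w0 z) (1 - kappa%:R / p%:R)
  <= ((ln z%:R)^-1) ^+ kappa :> R.
Proof.
move=> z1 /andP[kw wz]; have lz : 0 < ln z%:R :> R by rewrite ln_gt0 // ltr1n.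
rewrite totient_prod ?fact_gt0 // (perm_big _ (primes_fact w0)) /=.
have p01 p : prime p -> 0 <= (p%:R^-1 : R) <= 1.
  by move=> pp; rewrite invr_ge0 ler0n /= invf_le1 ?ltr0n ?ler1n prime_gt0.
apply: (@le_trans _ _ ((\prod_(1 <= p < z.+1 | prime p) (1 - p%:R^-1)) ^+ kappa)).
  rewrite (big_cat_nat (n := w0.+1)) //= exprMn big_filter.
  apply: ler_wpM2l.
    by apply/exprn_ge0/prodr_ge0 => p /p01; rewrite subr_ge0 => /andP[].
  rewrite -prodrXl -[leRHS]big_filter big_seq [leRHS]big_seq; apply: ler_prod => p.
  rewrite sieving_primesP => /and3P[pp wp _].
  have pR : 0 < p%:R :> R by rewrite ltr0n prime_gt0.
  rewrite bernoulli ?p01 // andbT subr_ge0 ler_pdivrMr // mul1r ler_nat; lia.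
have P0 : 0 <= \prod_(1 <= p < z.+1 | prime p) (1 - p%:R^-1) :> R.
  by apply/prodr_ge0 => p /p01; rewrite subr_ge0 => /andP[].
rewrite lerXn2r ?nnegrE ?invr_ge0 ?(ltW lz) // -div1r ler_pdivlMr // mulrC.
apply: le_trans (euler_product_le R z); rewrite ler_wpM2r // ler_ln ?posrE ?ltr0n ?ler_nat //; exact: ltnW.
Qed.

End PrimeProducts.

(** * The product over degenerate primes *)

Section DegenerateFactor.
Local Open Scope ring_scope.
Variable R : realType.

Lemma exp2_size_primes n : (0 < n)%N -> (2 ^ size (primes n) <= n)%N.
Proof.
move=> n0; apply: (@leq_trans (\prod_(p <- primes n) p ^ 1)).
  have : all prime (primes n) by apply/allP => p; rewrite mem_primes => /andP[].
  elim: (primes n) => [|p r IH] /=; first by rewrite big_nil.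
  move=> /andP[pp rp]; rewrite big_cons expnS expn1 leq_mul // ?IH //; exact: prime_gt1.
apply: dvdn_leq => //; apply: (dvdn_prod_pfactor _ (fun=> 1%N)) => //; first exact: primes_uniq.
- by apply/allP => p; rewrite mem_primes => /andP[].
- by move=> p; rewrite mem_primes expn1 => /and3P[].
Qed.

Lemma prod_has_le (T : Type) (r : seq T) (P : seq nat) (D : T -> nat) (x : nat -> R) :
  (forall p, 1 <= x p) ->
  \prod_(p <- P | has (fun t => p %| D t)%N r) x p <= \prod_(t <- r) \prod_(p <- P | (p %| D t)%N) x p.
Proof.
move=> x1; have x0 p : 0 <= x p by exact: le_trans (x1 p).
under [leRHS]eq_bigr do rewrite big_mkcond.
rewrite [leRHS]exchange_big /= big_mkcond; apply: ler_prod => p _.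
have ge1 (r' : seq T) : 1 <= \prod_(t <- r') (if (p %| D t)%N then x p else 1).
  by elim/big_rec: _ => // t y _ y1; case: ifP => _; rewrite ?mul1r // mulr_ege1.
case: ifP => h; last by rewrite ler01 ge1.
rewrite x0 /=; elim: r h => [//|t r IH] /=; rewrite big_cons.
case: ifP => /= _ h; first by rewrite ler_peMr.
by rewrite mul1r IH.
Qed.

(** The product is at most the power of its largest factor. Passing to the sum of the powers leaves
    terms that each concern a single divisibility condition and can be averaged separately. *)
Lemma prod_le_sum_expr (T : Type) (r : seq T) (y : T -> R) : (0 < size r)%N -> (forall t, 0 <= y t) ->
  \prod_(t <- r) y t <= \sum_(t <- r) y t ^+ size r.
Proof.
move=> r0 y0.
have gen M : 0 <= M -> all (fun t => y t <= M) r -> \prod_(t <- r) y t <= M ^+ size r.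
  elim: r {r0} => [|t r IH] H /=; first by rewrite big_nil expr0.
  move=> /andP[tM rM]; rewrite big_cons exprS ler_pM ?IH //; exact: prodr_ge0.
have [M [M0 h1 h2]] : exists M, [/\ 0 <= M, all (fun t => y t <= M) r & forall k, M ^+ k <= \sum_(t <- r) y t ^+ k].
  elim: r r0 {gen} => // t [|u r] IH _.
    by exists (y t); split; rewrite /= ?lexx // => k; rewrite big_seq1.
  have [M [M0 h1 h2]] := IH isT.
  have s0 k : 0 <= \sum_(j <- u :: r) y j ^+ k by apply: sumr_ge0 => j _; exact: exprn_ge0.
  have [tM|/ltW Mt] := leP (y t) M.
    exists M; split => //; first by rewrite /= tM.
    by move=> k; rewrite big_cons ler_wpDl // exprn_ge0.
  exists (y t); split => //.
    apply/andP; split => //; apply: sub_all h1 => v /le_trans; exact.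
  by move=> k; rewrite big_cons ler_wpDr.
exact: le_trans (gen M M0 h1) (h2 _).
Qed.

(** Convexity: as a function of 1 / p in [0, 1], the left side lies below its chord. *)
Lemma expr_1D_div_le (a : R) p T : 0 <= a -> (0 < p)%N -> (1 + a / p%:R) ^+ T <= 1 + (1 + a) ^+ T / p%:R.
Proof.
move=> a0 p0; have pR : 0 < p%:R :> R by rewrite ltr0n.
have i0 : 0 < p%:R^-1 :> R by rewrite invr_gt0.
have i1 : p%:R^-1 <= 1 :> R by rewrite invf_le1 // ler1n.
apply: (@le_trans _ _ (1 + ((1 + a) ^+ T - 1) / p%:R)); last first.
  by rewrite lerD2l ler_wpM2r ?(ltW i0) // gerBl.
elim: T => [|T IH]; first by rewrite !expr0 subrr mul0r addr0.
have c0 : 1 <= (1 + a) ^+ T by apply: exprn_ege1; lra.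
rewrite !exprS; apply: le_trans (ler_wpM2l _ IH) _; first by rewrite addr_ge0 // mulr_ge0 // ltW.
move: (p%:R^-1) ((1 + a) ^+ T) i0 i1 c0 => i x i0 i1 x1.
have : 0 <= a * (x - 1) * (i * (1 - i)) by rewrite !mulr_ge0 // ?subr_ge0 // ltW.
lra.
Qed.

Lemma ler_prod_subset (u v : seq nat) (H : nat -> R) : uniq u -> uniq v -> {subset u <= v} ->
  (forall m, 1 <= H m) -> \prod_(m <- u) H m <= \prod_(m <- v) H m.
Proof.
move=> uu uv sv H1; have H0 m : 0 <= H m by exact: le_trans (H1 m).
rewrite [leRHS](bigID (mem u)) /=.
rewrite (_ : \prod_(m <- v | m \in u) H m = \prod_(m <- u) H m).
  rewrite ler_peMr //; first exact: prodr_ge0.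
  by elim/big_rec: _ => // m x _ x1; rewrite mulr_ege1.
rewrite -big_filter; apply: perm_big; apply: uniq_perm => //; first exact: filter_uniq.
by move=> x; rewrite mem_filter; case: (boolP (x \in u)) => //= /sv ->.
Qed.

(** A nonzero value up to X has at most [lam] prime factors, so the degenerate primes above [w1]
    contribute at most e ^ (1 / 2) <= 2. Those up to [w1] are distributed over the pairs (k, j), and
    the power that arises from turning the product over pairs into a sum is absorbed by [c]. *)
Lemma degenerate_factor_le (a c : R) w0 w1 z s X lam : 0 <= a -> all (leq 1) s -> (0 < size s)%N ->
  (forall k j, (k < size s)%N -> (j <= size s)%N -> (0 < deg_val s k j <= X)%N) ->
  (X < 2 ^ lam.+1)%N -> (0 < w1)%N ->
  2 * a * (size s * (size s).+1 * lam)%:R <= w1%:R ->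
  (1 + a) ^+ (size s * (size s).+1) <= c ->
  \prod_(p <- sieving_primes w0 z | degenerate p s) (1 + a / p%:R) <=
  2 * \sum_(k <- iota 0 (size s)) \sum_(j <- iota 0 (size s).+1)
     \prod_(p <- sieving_primes w0 w1 | (p %| deg_val s k j)%N) (1 + c / p%:R).
Proof.
move=> a0 s1 s0 Dpos Xlam w10 aw1 ac.
pose r := [seq (k, j) | k <- iota 0 (size s), j <- iota 0 (size s).+1].
pose D (t : nat * nat) := deg_val s t.1 t.2.
have rs : size r = (size s * (size s).+1)%N by rewrite size_allpairs !size_iota.
have degE p : degenerate p s = has (fun t => p %| D t)%N r.
  rewrite /degenerate /r; apply/idP/idP.
    move=> /hasP[k ks /hasP[j js h]]; apply/hasP; exists (k, j) => //.
    by apply/allpairsP; exists (k, j).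
  move=> /hasP[t /allpairsP[[k j] /= [ks js ->]] h].
  apply/hasP; exists k; first exact: ks.
  by apply: (introT (@hasP _ (fun j => p %| deg_val s k j)%N (iota 0 (size s).+1))); exists j.
have Dr t : t \in r -> (0 < D t <= X)%N.
  move=> /allpairsP[[k j] [ks js ->]]; apply: Dpos; first by move: ks; rewrite mem_iota.
  by move: js; rewrite mem_iota add0n ltnS.
have x1 p : 1 <= 1 + a / p%:R by rewrite lerDl divr_ge0.
have x0 p : 0 <= 1 + a / p%:R by exact: le_trans (x1 p).
have -> : \sum_(k <- iota 0 (size s)) \sum_(j <- iota 0 (size s).+1)
     \prod_(p <- sieving_primes w0 w1 | (p %| deg_val s k j)%N) (1 + c / p%:R) =
   \sum_(t <- r) \prod_(p <- sieving_primes w0 w1 | (p %| D t)%N) (1 + c / p%:R).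
  by rewrite big_allpairs.
rewrite (eq_bigl _ _ degE).
rewrite (bigID (fun p => p <= w1)%N) /= mulrC; apply: ler_pM; try exact: prodr_ge0.
  rewrite -big_filter; set L := [seq _ <- _ | _].
  have LP p : p \in L -> (w1 < p)%N /\ has (fun t => p %| D t)%N r.
    by rewrite mem_filter -ltnNge => /andP[/andP[]].
  have szL : (size L <= size r * lam)%N.
    apply: (@leq_trans (size (flatten [seq primes (D t) | t <- r]))).
      apply: uniq_leq_size; first by rewrite filter_uniq // sieving_primes_uniq.
      move=> p pL; have [_ /hasP[t tr pt]] := LP p pL.
      apply/flattenP; exists (primes (D t)); first exact: map_f.
      have := pL; rewrite mem_filter sieving_primesP => /andP[_ /andP[pp _]].
      by rewrite mem_primes pp pt; have /andP[->] := Dr t tr.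
    have : all (fun t => size (primes (D t)) <= lam)%N r.
      apply/allP => t tr; have /andP[D0 DX] := Dr t tr.
      rewrite -ltnS -(ltn_exp2l (m := 2)) //.
      by apply: leq_ltn_trans (leq_ltn_trans DX Xlam); exact: exp2_size_primes.
    elim: (r) => [|t r' IH] //= /andP[h1 h2]; rewrite size_cat mulSn leq_add //; exact: IH.
  apply: le_trans (prod_1D_le_expR _ _ _ _) _; first by move=> p; rewrite divr_ge0.
  apply: (@le_trans _ _ (expR 2^-1)); last first.
    have := @expR_le_1D2 R 2^-1; rewrite lexx andbT invr_ge0 => /(_ (ler0n _ 2)); lra.
  rewrite ler_expR.
  have w1R : 0 < w1%:R :> R by rewrite ltr0n.
  apply: (@le_trans _ _ (\sum_(p <- L) a / w1%:R)).
    rewrite big_seq [leRHS]big_seq; apply: ler_sum => p /LP[wp _].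
    have p0 : (0 < p)%N by exact: leq_ltn_trans wp.
    by rewrite ler_wpM2l // lef_pV2 ?posrE ?ltr0n // ler_nat ltnW.
  rewrite big_const_seq count_predT iter_addr_0 -(mulr_natr (_ / _)) mulrAC ler_pdivrMr //.
  have h : (size L)%:R <= (size s * (size s).+1 * lam)%:R :> R by rewrite ler_nat -rs.
  have := ler_wpM2l a0 h; lra.
apply: (@le_trans _ _ (\prod_(p <- sieving_primes w0 w1 | has (fun t => p %| D t)%N r) (1 + a / p%:R))).
  rewrite -big_filter -[leRHS]big_filter; apply: ler_prod_subset => //.
  - by rewrite filter_uniq // sieving_primes_uniq.
  - by rewrite filter_uniq // sieving_primes_uniq.
  - by move=> p; rewrite !mem_filter !mem_index_iota !ltnS => /andP[/andP[-> ->] /and3P[-> -> _]].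
apply: le_trans (prod_has_le _ _ _ _ _ x1) _.
apply: le_trans (prod_le_sum_expr _ _ _ _ _) _.
- by rewrite rs muln_gt0 s0.
- by move=> t; exact: prodr_ge0.
apply: ler_sum => t _; rewrite rs -prodrXl.
rewrite big_seq_cond [leRHS]big_seq_cond; apply: ler_prod => p /andP[]; rewrite sieving_primesP => /and3P[pp _ _] _.
rewrite exprn_ge0 //= (le_trans (expr_1D_div_le _ _ _ a0 (prime_gt0 pp))) // lerD2l ler_wpM2r ?invr_ge0 //.
Qed.

End DegenerateFactor.

(** * Counting integers above a short block *)

Section BlockCount.
Local Open Scope ring_scope.
Variable R : realType.

Definition short_block_number (X E J l N : nat) : Prop :=
  exists m0 q s, [/\ size s = (2 * l)%N, (X < q ^ E)%N, prime_chain q s &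
    [/\ all (leq 1) s, (0 < m0)%N, N = (m0 * chain q s)%N & ((\prod_(m <- take l s) m) ^ J <= X)%N]].

Definition bottom_ok (X E m0 : nat) (s : seq nat) (q : nat) : bool :=
  [&& prime_chain q s, (X < q ^ E)%N & (m0 * chain q s <= X)%N].

(** The range of q is exhaustive: the top of the chain is at least q times the product of [s], so
    every q accepted by [bottom_ok] is at most X / (m0 times this product). *)
Definition block_count (X E J l m0 : nat) (s : seq nat) : nat :=
  if ((\prod_(m <- take l s) m) ^ J <= X)%N
  then count (bottom_ok X E m0 s) (iota 0 (X %/ (m0 * \prod_(m <- s) m)).+1) else 0%N.

Lemma prod_seq_gt0 (s : seq nat) : all (leq 1) s -> (0 < \prod_(m <- s) m)%N.
Proof. by move=> s1; rewrite big_seq; apply: prodn_cond_gt0 => i /(allP s1). Qed.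

Lemma leq_mem_prod (s : seq nat) v : all (leq 1) s -> v \in s -> (v <= \prod_(m <- s) m)%N.
Proof.
elim: s => //= m s IH /andP[m1 s1]; rewrite in_cons big_cons => /orP[/eqP ->|/(IH s1) vs].
  by rewrite leq_pmulr // prod_seq_gt0.
by apply: leq_trans vs _; rewrite leq_pmull.
Qed.

Lemma bottom_ok_le X E m0 s q : (0 < m0)%N -> all (leq 1) s -> bottom_ok X E m0 s q ->
  [/\ (0 < q)%N, (m0 * \prod_(m <- s) m * q <= X)%N & (q <= X %/ (m0 * \prod_(m <- s) m))%N].
Proof.
move=> m00 s1 /and3P[/prime_chain_head /prime_gt0 q0 _ mX].
have h : (m0 * \prod_(m <- s) m * q <= X)%N.
  by apply: leq_trans mX; rewrite -mulnA leq_mul2l chain_ge ?orbT.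
by split => //; rewrite leq_divRL ?muln_gt0 ?m00 ?prod_seq_gt0 // mulnC.
Qed.

(** Double counting: every N in [B] has at least one representation by a triple (m0, s, q), and a
    triple represents a single N. *)
Lemma count_short_block_le X E J l (B : pred nat) :
  (forall N, B N -> (0 < N <= X)%N /\ short_block_number X E J l N) ->
  (count B (iota 1 X))%:R <= \sum_(1 <= m0 < X.+1) lsum R X (2 * l) (fun s => (block_count X E J l m0 s)%:R) :> R.
Proof.
move=> HB.
pose ind (N m0 : nat) (s : seq nat) : R := if ((\prod_(m <- take l s) m) ^ J <= X)%N then
  \sum_(q <- iota 0 (X %/ (m0 * \prod_(m <- s) m)).+1) (bottom_ok X E m0 s q && (N == m0 * chain q s)%N)%:R else 0.
have ind_ge0 N m0 s : 0 <= ind N m0 s by rewrite /ind; case: ifP => // _; apply: sumr_ge0.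
apply: (@le_trans _ _ (\sum_(N <- iota 1 X) \sum_(1 <= m0 < X.+1) lsum R X (2 * l) (ind N m0))).
  rewrite natr_count; apply: ler_sum => N _.
  have S0 : 0 <= \sum_(1 <= m0 < X.+1) lsum R X (2 * l) (ind N m0).
    by apply: sumr_ge0 => m0 _; apply: lsum_ge0.
  case BN: (B N) => //.
  have [/andP[N0 NX] [m0 [q [s [ss qE qs [s1 m00 eN blk]]]]]] := HB N BN.
  have ok : bottom_ok X E m0 s q by apply/and3P; split; rewrite // -eN.
  have [q0 mX qy] := bottom_ok_le _ _ _ _ _ m00 s1 ok.
  have Ps0 := prod_seq_gt0 s s1.
  have m0X : (m0 <= X)%N by apply: leq_trans mX; rewrite -mulnA leq_pmulr // muln_gt0 Ps0.
  have sX : (\prod_(m <- s) m <= X)%N.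
    by apply: leq_trans mX; rewrite mulnAC leq_pmull // muln_gt0 m00.
  rewrite (bigD1_seq m0) /= ?iota_uniq ?mem_index_iota ?m00 ?ltnS //.
  apply: ler_wpDr; first by apply: sumr_ge0 => m _; apply: lsum_ge0.
  apply: le_trans (lsum_ge_term _ _ _ (ind N m0) s (ind_ge0 N m0) _); last first.
    rewrite /in_box ss eqxx /=; apply/allP => v vs.
    by rewrite (allP s1 _ vs) (leq_trans (leq_mem_prod _ _ s1 vs)).
  have qi : q \in iota 0 (X %/ (m0 * \prod_(m <- s) m)).+1 by rewrite mem_iota add0n ltnS.
  rewrite /ind blk (bigD1_seq q qi (iota_uniq _ _)) /=.
  by rewrite ok -eN eqxx lerDl; apply: sumr_ge0.
rewrite exchange_big /=; apply: ler_sum => m0 _; rewrite -lsum_sum; apply: ler_lsum => s _.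
rewrite /ind /block_count; case: ifP => _; last by rewrite big1.
rewrite exchange_big natr_count /=; apply: ler_sum => q _.
case: (bottom_ok _ _ _ _ _); last by rewrite big1.
rewrite -natr_count (eq_count (a2 := pred1 (m0 * chain q s)%N)) //.
by rewrite count_uniq_mem ?iota_uniq //; case: (_ \in _).
Qed.

End BlockCount.

(** * The sieve bound for given multipliers *)

Section PairBound.
Local Open Scope ring_scope.
Variable R : realType.

(** The left side is the exponent of z in the sieve remainder, with z + 1 <= z ^ 2, times the
    inverse z ^ (2 k) of the density and a factor z for W. *)
Lemma sieve_exponent_le k : (0 < k)%N -> ((6 * k * 2 + 2) * 2 + 2 * k + 1 <= 32 * k)%N.
Proof. lia. Qed.

Lemma chain_gt0 q s : (0 < size s)%N -> (0 < chain q s)%N.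
Proof. by case/lastP: s => // s m _; rewrite -cats1 chain_cat. Qed.

(** A chain is monotone in its starting value, so restarting from 0 gives less than the true value;
    a restarted chain with at least one link is a successor, hence nonzero. *)
Lemma deg_val_range q s k j : all (leq 1) s -> (0 < q)%N -> (k < size s)%N ->
  (0 < deg_val s k j <= chain q s)%N.
Proof.
move=> s1 q0 ks.
have tail i : (chain q (take i s) <= chain q s)%N.
  rewrite -[X in (_ <= chain q X)%N](cat_take_drop i) chain_cat.
  have d1 : all (leq 1) (drop i s) by apply/allP => v /mem_drop /(allP s1).
  case: (posnP (chain q (take i s))) => [-> //|p0].
  by apply: leq_trans (chain_ge _ _ p0 d1); rewrite leq_pmull // prod_seq_gt0.
case: j => [|j] /=.
  have ms : nth 0%N s k \in s by exact: mem_nth.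
  rewrite (allP s1 _ ms) /=; apply: leq_trans (leq_mem_prod _ _ s1 ms) _.
  by apply: leq_trans (chain_ge _ _ q0 s1); rewrite leq_pmulr.
set i := minn j k; have ik : (i <= k)%N by exact: geq_minr.
apply/andP; split; first by apply: chain_gt0; rewrite size_drop size_takel // subn_gt0 ltnS.
apply: leq_trans (tail k.+1).
rewrite -[X in (_ <= chain q X)%N](cat_take_drop i (take k.+1 s)) chain_cat.
exact: leq_chain.
Qed.

(** The factors missing at degenerate primes are restored by 1 <= (1 - u) (1 + 2 u) for 0 <= u <= 1
    / 2. *)
Lemma sifted_product_le kappa (P : seq nat) (D : pred nat) : all prime P -> all (fun p => 2 * kappa <= p)%N P ->
  \prod_(p <- P | ~~ D p) (1 - kappa%:R / p%:R) <=
  \prod_(p <- P) (1 - kappa%:R / p%:R) * \prod_(p <- P | D p) (1 + (2 * kappa)%:R / p%:R) :> R.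
Proof.
move=> pP kP.
have u01 p : p \in P -> 0 <= (kappa%:R / p%:R : R) <= 2^-1.
  move=> pp; have p0 := prime_gt0 (allP pP _ pp); have pR : 0 < p%:R :> R by rewrite ltr0n.
  rewrite divr_ge0 //= ler_pdivrMr // ler_pdivlMl //.
  by rewrite -[2]/(2%:R) -natrM ler_nat (allP kP).
rewrite [X in _ <= X * _](bigID D) /= mulrAC -big_split /= ler_peMl //.
  rewrite big_seq_cond; apply: prodr_ge0 => p /andP[/u01 /andP[_ h] _]; lra.
rewrite big_seq_cond; apply: (big_ind (fun x : R => 1 <= x)) => //.
  by move=> x y x1 y1; rewrite mulr_ege1.
move=> p /andP[/u01 /andP[h0 h1] _]; rewrite natrM -mulrA.
move: (kappa%:R / p%:R) h0 h1 => u h0 h1; nra.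
Qed.

Variables (X E J l w0 w1 z lam c : nat).
Let n := (2 * l)%N.
Let kappa := n.+1.
Let W := (w0`!)%N.
Hypothesis l_gt0 : (0 < l)%N.
Hypothesis E_gt0 : (0 < E)%N.
Hypothesis X_lam : (X < 2 ^ lam.+1)%N.
(* With the sieve level z ^ (6 kappa), 32 kappa leaves room for the remainder. *)
Hypothesis z_X : ((z ^ (32 * kappa)) ^ E <= X)%N.
Hypothesis z_ge2 : (2 <= z)%N.
Hypothesis W_z : (W <= z)%N.
Hypothesis kappa_w0 : (4 * kappa <= w0)%N.
Hypothesis ln_w0 : 2 <= ln w0%:R :> R.
Hypothesis w1_gt0 : (0 < w1)%N.
Hypothesis w1_large : (2 * (2 * kappa) * (n * n.+1 * lam) <= w1)%N.
Hypothesis c_large : ((1 + 2 * kappa) ^ (n * n.+1) <= c)%N.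

Definition deg_factor (s : seq nat) : R :=
  \sum_(k <- iota 0 n) \sum_(j <- iota 0 n.+1)
     \prod_(p <- sieving_primes w0 w1 | (p %| deg_val s k j)%N) (1 + c%:R / p%:R).

Definition good_residues (s : seq nat) : R := \sum_(0 <= b < W) (coprime_chain W b s)%:R.

Definition density : R := \prod_(p <- sieving_primes w0 z) (1 - kappa%:R / p%:R).

Lemma deg_factor_ge0 s : 0 <= deg_factor s.
Proof.
apply: sumr_ge0 => k _; apply: sumr_ge0 => j _; apply: prodr_ge0 => p _.
by rewrite addr_ge0 // divr_ge0.
Qed.

Lemma good_residues_ge0 s : 0 <= good_residues s.
Proof. exact: sumr_ge0. Qed.

Lemma density_ge : (z%:R ^+ (2 * kappa))^-1 <= density.
Proof.
apply: prod_1B_sieving_primes_ge => //; last exact: leq_trans z_ge2.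
- by apply: leq_trans kappa_w0; rewrite mulnS.
- by apply: leq_trans kappa_w0; rewrite leq_mul2r orbT.
Qed.

(** If some q is admissible, the range of length y contains it, so y >= q > z ^ (32 kappa) and both
    the rounding modulo W and the sieve remainder are dominated by the main term. The constant is 10
    = (4 + 1) * 2: rounded main term, remainder, and the bound 2 [deg_factor] for the degenerate
    primes. *)
Lemma block_count_le m0 s : (0 < m0)%N -> in_box X n s ->
  (block_count X E J l m0 s)%:R <=
  10 * density * (X%:R / W%:R) * (m0 * \prod_(m <- s) m)%:R^-1 * good_residues s * deg_factor s.
Proof.
move=> m00 /andP[/eqP ss sX].
have s1 : all (leq 1) s by apply: sub_all sX => v /andP[].
have Ps0 := prod_seq_gt0 s s1.
have W0 : (0 < W)%N by exact: fact_gt0.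
have z0 : (0 < z)%N by lia.
have WR : 0 < W%:R :> R by rewrite ltr0n.
have V0 : 0 < density by apply: lt_le_trans density_ge; rewrite invr_gt0 exprn_gt0 // ltr0n.
have rhs0 : 0 <= 10 * density * (X%:R / W%:R) * (m0 * \prod_(m <- s) m)%:R^-1 * good_residues s * deg_factor s.
  by rewrite !mulr_ge0 ?deg_factor_ge0 ?good_residues_ge0 ?invr_ge0 // ltW.
rewrite /block_count; case: ifP => // _.
set y := (X %/ _)%N.
have [hq|hq] := boolP (has (bottom_ok X E m0 s) (iota 0 y.+1)); last first.
  by rewrite has_count -eqn0Ngt in hq; rewrite (eqP hq).
have [q0 _ ok0] := hasP hq.
have [q00 mX0 qy0] := bottom_ok_le _ _ _ _ _ m00 s1 ok0.
have big_q q : (X < q ^ E)%N -> (z ^ (32 * kappa) < q)%N.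
  by move=> qE; rewrite -(ltn_exp2r _ _ E_gt0); apply: leq_ltn_trans z_X qE.
have zy : (z ^ (32 * kappa) <= y)%N.
  have /and3P[_ qE _] := ok0; exact: leq_trans (ltnW (big_q _ qE)) qy0.
have zz : (z <= z ^ (32 * kappa))%N.
  by rewrite -{1}(expn1 z) leq_pexp2l //; lia.
have w0W : (w0 <= W)%N by exact: fact_geq.
apply: (@le_trans _ _ (count (fun q => prime_chain q s && (maxn w0 z < q)%N) (iota 0 y.+1))%:R).
  rewrite ler_nat; apply: sub_count => q /and3P[-> /big_q qz _] /=.
  by rewrite gtn_max !(leq_ltn_trans _ qz) // (leq_trans w0W) // (leq_trans W_z).
have ns : ((size s).+1 <= w0)%N by rewrite ss; apply: leq_trans kappa_w0; rewrite leq_pmull.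
apply: le_trans (sift_chain R w0 z s y z_ge2 ns s1) _.
rewrite ss -/kappa -/W natr_sum.
have -> : \sum_(0 <= b < W | coprime_chain W b s) 1%:R = good_residues s :> R.
  by rewrite /good_residues big_mkcond; apply: eq_bigr => b _; case: coprime_chain.
set G := good_residues s; have G0 : 0 <= G by exact: good_residues_ge0.
set PP := \prod_(p <- _ | _) _.
pose H : R := 2 * deg_factor s.
have HH : \prod_(p <- sieving_primes w0 z | degenerate p s) (1 + (2 * kappa)%:R / p%:R) <= H.
  rewrite /H /deg_factor -ss.
  apply: (degenerate_factor_le R (2 * kappa)%:R c%:R w0 w1 z s X lam) => //; rewrite ?ss //.
  - by rewrite muln_gt0.
  - move=> k j kn jn; have /andP[-> /=] := deg_val_range q0 s k j s1 q00 ltac:(by rewrite ss).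
    move=> h; apply: leq_trans h _; have /and3P[_ _] := ok0; apply: leq_trans.
    by rewrite leq_pmull.
  - by rewrite -[2]/(2%:R) -!natrM ler_nat.
  - by rewrite -[1]/(1%:R) -natrD -natrX ler_nat.
have H1 : 1 <= H.
  apply: le_trans HH; elim/big_rec: _ => // p x _ x1.
  by rewrite mulr_ege1 // lerDl divr_ge0.
have PPV : PP <= density * H.
  apply: le_trans (sifted_product_le kappa (sieving_primes w0 z) (degenerate^~ s) _ _) _.
  - by apply/allP => p; rewrite sieving_primesP => /and3P[].
  - apply/allP => p; rewrite sieving_primesP => /and3P[_ wp _].
    by apply: leq_trans (ltnW wp); apply: leq_trans kappa_w0; rewrite leq_mul2r orbT.
  - by rewrite ler_wpM2l // ltW.
have VH0 : 0 <= density * H by rewrite mulr_ge0 ?(ltW V0) // (le_trans _ H1).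
have yW : (W <= y)%N by apply: leq_trans W_z (leq_trans zz zy).
have t1 : (y %/ W).+1%:R <= 2 * (y%:R / W%:R) :> R.
  rewrite mulrA ler_pdivlMr // -[2]/(2%:R) -!natrM ler_nat mulSn mul2n -addnn.
  exact: leq_add yW (leq_divM y W).
have t2 : (((z ^ (6 * kappa)) ^ 2 * z.+1) ^ 2)%N%:R <= y%:R / W%:R * density :> R.
  apply: le_trans (ler_wpM2l _ density_ge); last by rewrite divr_ge0.
  rewrite ler_pdivlMr ?exprn_gt0 ?ltr0n // ler_pdivlMr // -natrX -!natrM ler_nat.
  apply: leq_trans zy; have z1 : (z.+1 <= z ^ 2)%N by rewrite -mulnn (leq_trans _ (leq_mul z_ge2 (leqnn z))) // mul2n -addnn -addn1 leq_add2l.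
  apply: (@leq_trans (((z ^ (6 * kappa)) ^ 2 * z ^ 2) ^ 2 * z ^ (2 * kappa) * z ^ 1)).
    by rewrite expn1 !leq_mul // leq_exp2r // leq_mul.
  by rewrite -!expnM -!expnD -!expnM -!expnD leq_pexp2l // sieve_exponent_le.
have yX : y%:R <= X%:R * (m0 * \prod_(m <- s) m)%:R^-1 :> R.
  by rewrite ler_pdivlMr ?ltr0n ?muln_gt0 ?m00 // -natrM ler_nat leq_divM.
have r0 : 0 <= y%:R / W%:R :> R by rewrite divr_ge0.
apply: (@le_trans _ _ (G * (5 * (y%:R / W%:R) * (density * H)))).
  apply: ler_wpM2l => //.
  have PP0 : 0 <= PP.
    rewrite /PP big_seq_cond; apply: prodr_ge0 => p /andP[]; rewrite sieving_primesP => /and3P[pp wp _] _.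
    rewrite subr_ge0 ler_pdivrMr ?ltr0n ?prime_gt0 // mul1r ler_nat.
    by apply: leq_trans (ltnW wp); apply: leq_trans kappa_w0; rewrite leq_pmull.
  have a1 : 2 * (y %/ W).+1%:R * PP <= 4 * (y%:R / W%:R) * (density * H).
    by apply: ler_pM => //; rewrite ?mulr_ge0 //; lra.
  have a2 : y%:R / W%:R * density <= y%:R / W%:R * (density * H).
    by rewrite ler_wpM2l // ler_peMr // ltW.
  have := le_trans t2 a2; lra.
have yXW : y%:R / W%:R <= X%:R / W%:R * (m0 * \prod_(m <- s) m)%:R^-1 :> R.
  by rewrite mulrAC ler_wpM2r // invr_ge0.
have -> : 10 * density * (X%:R / W%:R) * (m0 * \prod_(m <- s) m)%:R^-1 * G * deg_factor s =
   G * (5 * (X%:R / W%:R * (m0 * \prod_(m <- s) m)%:R^-1) * (density * H)) by rewrite /H; ring.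
by rewrite ler_wpM2l // ler_wpM2r // ler_wpM2l.
Qed.

End PairBound.

(** * Replacing size conditions by Rankin weights *)

Section RankinInsertion.
Local Open Scope ring_scope.
Variable R : realType.

Lemma weight_cat (sg1 sg2 : seq R) s1 s2 : size s1 = size sg1 ->
  weight R (sg1 ++ sg2) (s1 ++ s2) = weight R sg1 s1 * weight R sg2 s2.
Proof.
elim: sg1 s1 => [|x sg IH] [|v s] //=; first by rewrite mul1r.
by move=> [] /IH ->; rewrite mulrA.
Qed.

Lemma weight_nseq l (sigma : R) s : size s = l -> all (leq 1) s ->
  weight R (nseq l sigma) s = (\prod_(m <- s) m)%:R^-1 * expR (- (sigma * ln (\prod_(m <- s) m)%:R)).
Proof.
elim: l s => [|l IH] [|v s] //=; first by rewrite big_nil ln1 mulr0 oppr0 expR0 invr1 mulr1.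
move=> [] /IH h /andP[v0 s1]; rewrite h // big_cons natrM.
have Ps := prod_seq_gt0 s s1.
rewrite lnM ?posrE ?ltr0n // mulrDr opprD expRD invfM /rankin; ring.
Qed.

(* The exponents are the optimal ones for l + 1 variables with product at most X
   and l variables with product at most X ^ (1 / J). *)
Lemma rankin_insertion X l J m0 s : (1 < X)%N -> (0 < l)%N -> size s = (2 * l)%N -> all (leq 1) s -> (0 < m0)%N ->
  ((\prod_(m <- take l s) m) ^ J <= X)%N -> (m0 * \prod_(m <- s) m <= X)%N ->
  (m0 * \prod_(m <- s) m)%:R^-1 <=
  expR (2 * l).+1%:R * rankin R (l.+1%:R / ln X%:R) m0 *
    weight R (nseq l ((l * J)%:R / ln X%:R) ++ nseq l (l.+1%:R / ln X%:R)) s.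
Proof.
move=> X1 l0 ss s1 m00 blk mX.
have LX : 0 < ln X%:R :> R by rewrite ln_gt0 // ltr1n.
have st : size (take l s) = l by rewrite size_takel // ss; lia.
have sd : size (drop l s) = l by rewrite size_drop ss; lia.
have /andP[t1 d1] : all (leq 1) (take l s) && all (leq 1) (drop l s) by rewrite -all_cat cat_take_drop.
rewrite -[in X in _ <= X](cat_take_drop l s) weight_cat ?size_nseq // !weight_nseq //.
have prodE : (\prod_(m <- s) m = \prod_(m <- take l s) m * \prod_(m <- drop l s) m)%N.
  by rewrite -big_cat cat_take_drop.
have := prod_seq_gt0 _ t1; have := prod_seq_gt0 _ d1.
rewrite prodE in mX *; move: (\prod_(m <- take l s) m)%N (\prod_(m <- drop l s) m)%N blk mX => A B AX mAB B0 A0.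
rewrite /rankin; set tau := (l * J)%:R / _; set sigma := l.+1%:R / _.
have e : expR (2 * l).+1%:R * (m0%:R^-1 * expR (- (sigma * ln m0%:R))) *
   (A%:R^-1 * expR (- (tau * ln A%:R)) * (B%:R^-1 * expR (- (sigma * ln B%:R)))) =
   (m0 * (A * B))%:R^-1 * expR ((2 * l).+1%:R - tau * ln A%:R - sigma * (ln m0%:R + ln B%:R)) :> R.
  have -> : (2 * l).+1%:R - tau * ln A%:R - sigma * (ln m0%:R + ln B%:R) =
    (2 * l).+1%:R + (- (tau * ln A%:R)) + (- (sigma * ln m0%:R)) + (- (sigma * ln B%:R)) :> R by ring.
  rewrite !expRD !natrM !invfM; ring.
rewrite e ler_peMr ?invr_ge0 // -[leLHS]expR0 ler_expR.
have h1 : tau * ln A%:R <= l%:R.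
  rewrite /tau mulrAC ler_pdivrMr // natrM -mulrA ler_wpM2l //.
  rewrite mulrC mulr_natr -lnXn ?ltr0n // -natrX ler_ln ?posrE ?ltr0n ?expn_gt0 ?A0 ?ler_nat //.
  exact: ltnW.
have h2 : sigma * (ln m0%:R + ln B%:R) <= l.+1%:R.
  rewrite /sigma mulrAC ler_pdivrMr // ler_wpM2l // -lnM ?posrE ?ltr0n // -natrM.
  rewrite ler_ln ?posrE ?ltr0n ?muln_gt0 ?m00 ?B0 ?ler_nat ?(ltnW X1) //.
  by apply: leq_trans mAB; rewrite leq_mul2l leq_pmull ?orbT.
have -> : (2 * l).+1%:R = l%:R + l.+1%:R :> R by rewrite -natrD; congr _%:R; lia.
by rewrite -addrA -opprD subr_ge0 lerD.
Qed.

End RankinInsertion.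

(** * Summation over all multipliers *)

Section Assembly.
Local Open Scope ring_scope.
Variable R : realType.
Variables (X E J l w0 w1 z lam c : nat).
Let n := (2 * l)%N.
Let kappa := n.+1.
Let W := (w0`!)%N.
Hypothesis l_gt0 : (0 < l)%N.
Hypothesis E_gt0 : (0 < E)%N.
Hypothesis J_gt0 : (0 < J)%N.
Hypothesis X_gt1 : (1 < X)%N.
Hypothesis X_lam : (X < 2 ^ lam.+1)%N.
Hypothesis z_X : ((z ^ (32 * kappa)) ^ E <= X)%N.
Hypothesis z_ge2 : (2 <= z)%N.
Hypothesis W_z : (W <= z)%N.
Hypothesis kappa_w0 : (4 * kappa <= w0)%N.
Hypothesis ln_w0 : 2 <= ln w0%:R :> R.
Hypothesis w1_gt0 : (0 < w1)%N.
Hypothesis w1_large : (2 * (2 * kappa) * (n * n.+1 * lam) <= w1)%N.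
Hypothesis c_large : ((1 + 2 * kappa) ^ (n * n.+1) <= c)%N.
Let sigma : R := l.+1%:R / ln X%:R.
Let tau : R := (l * J)%:R / ln X%:R.
(** The least value for which every exponent k / ln X with k <= (l + 1) J is seen to be good, using
    ln X / k as a lower bound for its mass. *)
Let eps : R := (W * (l.+1 * J))%:R / ln X%:R.
Hypothesis eps_small : eps * \prod_(p <- sieving_primes w0 w1) (1 + c%:R / p%:R) <= 1.
Hypothesis c_w0 : (2 * c <= w0)%N.

Let LX : 0 < ln X%:R :> R.
Proof. by rewrite ln_gt0 // ltr1n. Qed.
Let W0 : (0 < W)%N. Proof. exact: fact_gt0. Qed.
Let WR : 0 < W%:R :> R. Proof. by rewrite ltr0n. Qed.

Let eps_ge0 : 0 <= eps.
Proof. by rewrite divr_ge0 // ltW. Qed.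

Let eps_le1 : eps <= 1.
Proof.
apply: le_trans eps_small; rewrite ler_peMr //.
by elim/big_rec: _ => // p x _ x1; rewrite mulr_ege1 // lerDl divr_ge0.
Qed.

Let sg := nseq l tau ++ nseq l sigma.

Let sg_good : all (good_exponent R W eps) sg.
Proof.
have aux k : (0 < k <= l.+1 * J)%N -> good_exponent R W eps (k%:R / ln X%:R).
  move=> /andP[k0 kl]; have kR : 0 < k%:R :> R by rewrite ltr0n.
  rewrite /good_exponent divr_gt0 //= /rankin_mass invf_div /eps.
  have -> : W%:R = (W * (l.+1 * J))%:R / ln X%:R * (ln X%:R / (l.+1 * J)%:R) :> R.
    rewrite [in RHS]natrM mulrA mulfVK ?gt_eqF // mulfK //.
    by rewrite gt_eqF // ltr0n muln_gt0.
  apply: ler_wpM2l => //; apply: (@le_trans _ _ (ln X%:R / k%:R)); last by rewrite lerDr.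
  by rewrite ler_wpM2l ?(ltW LX) // lef_pV2 ?posrE ?ltr0n ?muln_gt0 // ler_nat.
rewrite /sg all_cat !all_nseq !aux ?orbT //.
- by rewrite leq_pmulr.
- by rewrite muln_gt0 l_gt0 J_gt0 leq_mul2r leqnSn orbT.
Qed.

Let sizesg : size sg = n.
Proof. by rewrite size_cat !size_nseq /n mul2n addnn. Qed.

(** 30 = 10 * 3: the 10 of the sieve bound, and 3 = 1 + 2 for the two terms of the average belonging
    to one pair (k, j). There are n (n + 1) such pairs. *)
Let bound : R := 30 * (n * n.+1)%:R * expR kappa%:R * X%:R * (((totient W)%:R / W%:R) ^+ kappa * density R l w0 z)
   * (2 ^+ n * (rankin_mass R tau) ^+ l * (rankin_mass R sigma) ^+ l.+1).

Lemma count_short_block_numbers (B : pred nat) :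
  (forall N, B N -> (0 < N <= X)%N /\ short_block_number X E J l N) ->
  (count B (iota 1 X))%:R <= bound.
Proof.
move=> HB; apply: le_trans (count_short_block_le R X E J l B HB) _.
set V := density R l w0 z.
have V0 : 0 < V.
  by apply: lt_le_trans (density_ge R l w0 z z_ge2 kappa_w0 ln_w0); rewrite invr_gt0 exprn_gt0 // ltr0n (leq_trans _ z_ge2).
have s0 : 0 < sigma by rewrite divr_gt0 // ltr0n.
pose K : R := 10 * V * (X%:R / W%:R) * expR kappa%:R.
have K0 : 0 <= K by rewrite !mulr_ge0 ?expR_ge0 ?invr_ge0 // ltW.
have pair m0 s : (0 < m0)%N -> in_box X n s -> (block_count X E J l m0 s)%:R <=
    K * rankin R sigma m0 * (weight R sg s * good_residues R w0 s * deg_factor R l w0 w1 c s).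
  move=> m00 sb.
  have rhs0 : 0 <= K * rankin R sigma m0 * (weight R sg s * good_residues R w0 s * deg_factor R l w0 w1 c s).
    apply: mulr_ge0; first by apply: mulr_ge0 K0 _; exact: rankin_ge0.
    by rewrite !mulr_ge0 ?weight_ge0 ?deg_factor_ge0 ?good_residues_ge0.
  (* A nonzero count provides the two inequalities on which Rankin's trick rests: the lower product
     is short, and the full product with m0 is at most X. *)
  case: (posnP (block_count X E J l m0 s)) => [-> //|bpos].
  have /andP[/eqP ss sX] := sb.
  have s1 : all (leq 1) s by apply: sub_all sX => v /andP[].
  have [blk mX] : ((\prod_(m <- take l s) m) ^ J <= X)%N /\ (m0 * \prod_(m <- s) m <= X)%N.
    move: bpos; rewrite /block_count; case: ifP => // h; rewrite -has_count => /hasP[q _ /bottom_ok_le].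
    move=> /(_ m00 s1) [q0 h2 _]; split => //; apply: leq_trans h2; by rewrite leq_pmulr.
  have h := block_count_le R X E J l w0 w1 z lam c l_gt0 E_gt0 X_lam z_X z_ge2 W_z kappa_w0 ln_w0 w1_gt0 w1_large c_large m0 s m00 sb.
  apply: le_trans h _.
  rewrite -/V -/W.
  have -> : K * rankin R sigma m0 * (weight R sg s * good_residues R w0 s * deg_factor R l w0 w1 c s) =
    10 * V * (X%:R / W%:R) * ((expR kappa%:R * rankin R sigma m0 * weight R sg s) * (good_residues R w0 s * deg_factor R l w0 w1 c s)).
    by rewrite /K; ring.
  have lhsE (a b d e : R) : a * b * d * e = a * (b * (d * e)) by ring.
  rewrite lhsE.
  apply: ler_wpM2l; first by rewrite !mulr_ge0 ?invr_ge0 // ltW.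
  apply: ler_wpM2r; first by rewrite mulr_ge0 ?deg_factor_ge0 ?good_residues_ge0.
  exact: rankin_insertion.
apply: (@le_trans _ _ (\sum_(1 <= m0 < X.+1) K * rankin R sigma m0 *
    lsum R X n (fun s => weight R sg s * good_residues R w0 s * deg_factor R l w0 w1 c s))).
  rewrite big_nat [leRHS]big_nat; apply: ler_sum => m0 /andP[m00 _].
  by rewrite -lsum_scale; apply: ler_lsum => s sb; exact: pair.
rewrite -mulr_suml -mulr_sumr.
pose M : R := (totient W)%:R * \prod_(s <- sg) mass_bound R W s.
have M0 : 0 <= M by rewrite mulr_ge0 // (prod_mass_ge0 R W eps).
have avg : lsum R X n (fun s => weight R sg s * good_residues R w0 s * deg_factor R l w0 w1 c s) <= (n * n.+1)%:R * (M * 3).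
  apply: (@le_trans _ _ (\sum_(k <- iota 0 n) \sum_(j <- iota 0 n.+1) M * 3)); last first.
    rewrite !big_const_seq !count_predT !size_iota !iter_addr_0 -mulrnA mulr_natl.
    by rewrite mulnC.
  rewrite (eq_lsum _ _ _ _ (fun s => \sum_(k <- iota 0 n) \sum_(j <- iota 0 n.+1) \sum_(0 <= b < W)
     weight R sg s * (coprime_chain W b s)%:R *
       \prod_(p <- sieving_primes w0 w1 | (p %| deg_val s k j)%N) (1 + c%:R / p%:R))); last first.
    move=> s; rewrite /deg_factor mulr_sumr; apply: eq_bigr => k _; rewrite mulr_sumr; apply: eq_bigr => j _.
    by rewrite /good_residues mulr_sumr mulr_suml.
  rewrite lsum_sum big_seq [leRHS]big_seq; apply: ler_sum => k; rewrite mem_iota /= add0n => kn.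
  rewrite lsum_sum; apply: ler_sum => j _; rewrite lsum_sum -sizesg.
  apply: le_trans (lsum_degenerate_average R X W eps W0 eps_le1 sg k j c%:R (sieving_primes w0 w1) sg_good _ _ _ _ eps_ge0 _) _.
  - by rewrite sizesg.
  - exact: sieving_primes_uniq.
  - by apply/allP => p; rewrite sieving_primesP => /and3P[].
  - by apply/allP => p; rewrite sieving_primesP => /and3P[pp wp _]; exact: prime_coprime_fact.
  - by [].
  rewrite -/M; apply: ler_wpM2l => //.
  have w00 : (0 < w0)%N by apply: leq_trans kappa_w0.
  have := prod_1D_sqr_sieving_primes R c%:R w0 w1 (ler0n _ _) w00; rewrite -[2 * c%:R]/(2%:R * c%:R) -natrM ler_nat => /(_ c_w0) h.
  by apply: le_trans (lerD eps_small h) _; lra.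
have rs : \sum_(1 <= m0 < X.+1) rankin R sigma m0 <= rankin_mass R sigma by exact: rankin_sum.
have rs0 : 0 <= \sum_(1 <= m0 < X.+1) rankin R sigma m0 by apply: sumr_ge0 => m _; exact: rankin_ge0.
have L0 : 0 <= lsum R X n (fun s => weight R sg s * good_residues R w0 s * deg_factor R l w0 w1 c s).
  by apply: lsum_ge0 => s; rewrite !mulr_ge0 ?weight_ge0 ?deg_factor_ge0 ?good_residues_ge0.
apply: (@le_trans _ _ (K * rankin_mass R sigma * ((n * n.+1)%:R * (M * 3)))).
  apply: ler_pM L0 _ avg; first exact: mulr_ge0 K0 rs0.
  exact: ler_wpM2l K0 _ _ rs.
rewrite le_eqVlt; apply/orP; left; apply/eqP.
have big_nseq_expr k (x : R) : \prod_(s <- nseq k x) mass_bound R W s = mass_bound R W x ^+ k.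
  by elim: k => [|k IH]; rewrite /= ?big_nil ?big_cons // IH exprS.
rewrite /M /sg big_cat /= !big_nseq_expr /mass_bound /bound /K.
have -> : rankin_mass R sigma ^+ l.+1 = rankin_mass R sigma * rankin_mass R sigma ^+ l by rewrite exprS.
rewrite -/V -/W.
(* One factor phi(W) / W belongs to the residue of the bottom prime, the other n to the
   multipliers. *)
have -> : ((totient W)%:R / W%:R) ^+ kappa = (totient W)%:R / W%:R * ((totient W)%:R / W%:R) ^+ l * ((totient W)%:R / W%:R) ^+ l :> R.
  by rewrite /kappa /n exprS mul2n -addnn exprD mulrA.
have -> : 2 ^+ n = 2 ^+ l * 2 ^+ l :> R by rewrite /n mul2n -addnn exprD.
have mE x : ((totient W)%:R * (2 * rankin_mass R x / W%:R)) ^+ l =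
    ((totient W)%:R / W%:R) ^+ l * 2 ^+ l * rankin_mass R x ^+ l :> R.
  by rewrite -!exprMn; congr (_ ^+ _); ring.
rewrite !mE.
move: (2 ^+ l) (rankin_mass R sigma ^+ l) (rankin_mass R tau ^+ l) (((totient W)%:R / W%:R) ^+ l) => a1 a2 a3 a4.
ring.
Qed.

End Assembly.

(** * Rarity of the integers above a short block of given length *)

Section Rarity.
Local Open Scope ring_scope.
Variable R : realType.

Lemma leq_summands a b d m : (a + b + d + 1 <= m)%N -> [/\ a <= m, b <= m, d <= m & 0 < m]%N.
Proof. by move=> h; split; lia. Qed.

Lemma degeneracy_count_le l : ((2 * l) * (2 * l).+1 <= 6 * 4 ^ l)%N.
Proof.
have h : (l < 2 ^ l)%N by exact: ltn_expl.
have -> : (4 ^ l = 2 ^ l * 2 ^ l)%N by exact: (expnMn 2 2 l).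
move: (2 ^ l)%N h => t h.
have -> : (6 * (t * t) = (2 * t) * (3 * t))%N by ring.
by apply: leq_mul; lia.
Qed.

(** The power (Q / Lx) ^ (2 l + 1), with Q = a (2 l + 1) E, is distributed over the 2 l + 1 masses:
    Zs Q / Lx is at most 4 a E and Zt Q / Lx at most 6 a E / J, so l disappears. The polynomial 2 l
    (2 l + 1) is at most 6 * 4 ^ l, whence 180 = 30 * 6 and a further power C ^ l. *)
Lemma main_term_le (l E J a : nat) (Lx Lz Zs Zt D : R) : (0 < l)%N -> (0 < E)%N -> (0 < J)%N -> (0 < a)%N -> 0 < Lz -> 0 < Lx ->
  Lx <= (a * (2 * l).+1 * E)%N%:R * Lz -> 0 <= D -> D <= (Lz^-1) ^+ (2 * l).+1 ->
  0 <= Zs -> Zs <= 2 * (Lx / l.+1%:R) -> 0 <= Zt -> Zt <= 2 * (Lx / (l * J)%:R) ->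
  30 * ((2 * l) * (2 * l).+1)%:R * expR (2 * l).+1%:R * D * (2 ^+ (2 * l) * Zt ^+ l * Zs ^+ l.+1) <=
  180 * (4 * a%:R) * expR 1 * E%:R * (16 * expR 1 ^+ 2 * (4 * a%:R * (6 * a%:R)) * E%:R ^+ 2 / J%:R) ^+ l.
Proof.
move=> l0 E0 J0 a0 Lz0 Lx0 LxLz D0 DL Zs0 ZsL Zt0 ZtL.
have lR : 0 < l%:R :> R by rewrite ltr0n.
have JR : 0 < J%:R :> R by rewrite ltr0n.
have ER : 0 < E%:R :> R by rewrite ltr0n.
pose Q : R := (a * (2 * l).+1 * E)%N%:R.
have aR : 0 < a%:R :> R by rewrite ltr0n.
have Q0 : 0 < Q by rewrite ltr0n !muln_gt0 a0 E0.
have LzL : Lz^-1 <= Q / Lx by rewrite ler_pdivlMr // mulrC ler_pdivrMr.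
have DQ : D <= (Q / Lx) ^+ (2 * l).+1.
  by apply: le_trans DL _; rewrite lerXn2r ?nnegrE ?divr_ge0 ?invr_ge0 // ltW.
have b1 : Zs * (Q / Lx) <= 4 * a%:R * E%:R.
  apply: (@le_trans _ _ (2 * (Lx / l.+1%:R) * (Q / Lx))); first by rewrite ler_wpM2r // divr_ge0 // ltW.
  have -> : 2 * (Lx / l.+1%:R) * (Q / Lx) = 2 * Q / l.+1%:R.
    have : l.+1%:R != 0 :> R by [].
    by move: (l.+1%:R) (lt0r_neq0 Lx0) => b x0 b0; field; apply/andP.
  rewrite ler_pdivrMr ?ltr0n //.
  have -> : 4 * a%:R * E%:R * l.+1%:R = 2 * (a * (2 * l.+1) * E)%:R :> R by rewrite !natrM; ring.
  by rewrite ler_wpM2l // ler_nat leq_mul2r leq_mul2l mulnS; apply/orP; right; apply/orP; right; rewrite -add1n leq_add2r.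
have b2 : Zt * (Q / Lx) <= 6 * a%:R * E%:R / J%:R.
  apply: (@le_trans _ _ (2 * (Lx / (l * J)%:R) * (Q / Lx))); first by rewrite ler_wpM2r // divr_ge0 // ltW.
  have -> : 2 * (Lx / (l * J)%:R) * (Q / Lx) = 2 * Q / l%:R / J%:R.
    rewrite natrM; move: (lt0r_neq0 lR) (lt0r_neq0 JR) (lt0r_neq0 Lx0) => ? ? ?; field; by apply/and3P; split.
  apply: ler_wpM2r; first by rewrite invr_ge0 ltW.
  rewrite ler_pdivrMr //.
  have -> : 6 * a%:R * E%:R * l%:R = 2 * (a * (3 * l) * E)%:R :> R by rewrite !natrM; ring.
  rewrite ler_wpM2l // ler_nat leq_mul2r leq_mul2l; apply/orP; right; apply/orP; right.
  by rewrite -[X in (_ <= X)%N]/((1 + 2) * l)%N mulnDl mul1n -add1n leq_add2r.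
have QL0 : 0 <= Q / Lx by rewrite divr_ge0 // ltW.
have main : D * (Zt ^+ l * Zs ^+ l.+1) <= (6 * a%:R * E%:R / J%:R) ^+ l * (4 * a%:R * E%:R) ^+ l.+1.
  apply: (@le_trans _ _ ((Q / Lx) ^+ (2 * l).+1 * (Zt ^+ l * Zs ^+ l.+1))).
    by rewrite ler_wpM2r // mulr_ge0 // exprn_ge0.
  have -> : (Q / Lx) ^+ (2 * l).+1 * (Zt ^+ l * Zs ^+ l.+1) = (Zt * (Q / Lx)) ^+ l * (Zs * (Q / Lx)) ^+ l.+1.
    have -> : (2 * l).+1 = (l + l.+1)%N by rewrite addnS mul2n addnn.
    by move: (Q / Lx) => x; rewrite exprD !exprMn; move: (x ^+ l) (x ^+ _) (Zt ^+ l) (Zs ^+ _) => b1' b2' b3' b4'; ring.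
  have x0 : 0 <= Zt * (Q / Lx) by exact: mulr_ge0.
  have y0 : 0 <= Zs * (Q / Lx) by exact: mulr_ge0.
  apply: ler_pM; [exact: exprn_ge0 | exact: exprn_ge0 | | ].
  - by rewrite lerXn2r ?nnegrE // (le_trans x0).
  - by rewrite lerXn2r ?nnegrE // (le_trans y0).
have cnt : ((2 * l) * (2 * l).+1)%:R <= 6 * 4 ^+ l :> R.
  by rewrite -[4]/(4%:R) -natrX -[6]/(6%:R) -natrM ler_nat degeneracy_count_le.
have eE : expR (2 * l).+1%:R = expR 1 * (expR 1 ^+ 2) ^+ l :> R.
  by rewrite -exprM -exprS -expRM_natl mulr1.
have e0 : 0 < expR 1 :> R by exact: expR_gt0.
apply: (@le_trans _ _ (30 * (6 * 4 ^+ l) * (expR 1 * (expR 1 ^+ 2) ^+ l) * 4 ^+ l * ((6 * a%:R * E%:R / J%:R) ^+ l * (4 * a%:R * E%:R) ^+ l.+1))).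
  have -> : 30 * ((2 * l) * (2 * l).+1)%:R * expR (2 * l).+1%:R * D * (2 ^+ (2 * l) * Zt ^+ l * Zs ^+ l.+1) =
    30 * ((2 * l) * (2 * l).+1)%:R * expR (2 * l).+1%:R * 2 ^+ (2 * l) * (D * (Zt ^+ l * Zs ^+ l.+1)) by ring.
  have p4 : 2 ^+ (2 * l) = 4 ^+ l :> R by rewrite exprM; congr (_ ^+ _); ring.
  rewrite eE p4; apply: ler_pM main.
  - by rewrite !mulr_ge0 ?exprn_ge0 ?expR_ge0.
  - by rewrite !mulr_ge0 ?exprn_ge0.
  - rewrite ler_wpM2r ?exprn_ge0 // ler_wpM2r ?mulr_ge0 ?exprn_ge0 ?expR_ge0 // ler_wpM2l //.
rewrite le_eqVlt; apply/orP; left; apply/eqP.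
rewrite (exprS (4 * a%:R * E%:R)) [in RHS](_ : 16 * expR 1 ^+ 2 * (4 * a%:R * (6 * a%:R)) * E%:R ^+ 2 / J%:R =
  4 * 4 * expR 1 ^+ 2 * (6 * a%:R * E%:R / J%:R) * (4 * a%:R * E%:R)); last by ring.
have pE (x u v : R) : (4 * 4 * x * u * v) ^+ l = 4 ^+ l * 4 ^+ l * x ^+ l * u ^+ l * v ^+ l by rewrite !exprMn.
rewrite pE.
move: (4 ^+ l) ((expR 1 ^+ 2) ^+ l) ((6 * a%:R * E%:R / J%:R) ^+ l) ((4 * a%:R * E%:R) ^+ l) => a1 a2 a3 a4; ring.
Qed.

(** The constant [c] depends on l only, and [w0] on [c]; then lam, the binary logarithm of X, grows.
    The cut [w1] = lam ^ 2 exceeds the multiple of lam that makes the degenerate primes beyond it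
    harmless, yet the Euler product up to it is at most the square root of lam, which the factor 1 /
    ln X in eps beats. *)
Lemma short_blocks_rare (l E J : nat) : (0 < l)%N -> (0 < E)%N -> (0 < J)%N ->
  exists lam0, forall X : nat, (lam0 <= trunc_log 2 X)%N -> forall B : pred nat,
    (forall N, B N -> (0 < N <= X)%N /\ short_block_number X E J l N) ->
    (count B (iota 1 X))%:R <=
      180 * (4 * 64) * expR 1 * E%:R * (16 * expR 1 ^+ 2 * (4 * 64 * (6 * 64)) * E%:R ^+ 2 / J%:R) ^+ l * X%:R :> R.
Proof.
move=> l0 E0 J0.
pose n := (2 * l)%N; pose kappa := n.+1; pose T := (n * n.+1)%N.
have T0 : (0 < T)%N by rewrite /T /n muln_gt0 muln_gt0 l0.
have ln2 := ln2_ge R.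
have [c c_large] : exists c, ((1 + 2 * kappa) ^ T <= c)%N by eexists; exact: leqnn.
have c_ge : (1 + 2 * kappa <= c)%N.
  by apply: leq_trans c_large; rewrite -{1}(expn1 (1 + 2 * kappa)) leq_pexp2l.
have c0 : (0 < c)%N by apply: leq_trans c_ge.
have [w0 w0_gt lnw0] : exists2 w0, (16 * c < w0)%N & 8 * c%:R <= ln w0%:R :> R.
  (* As ln 2 >= 1 / 2, the exponent 16 c gives ln w0 >= 8 c. *)
  exists (2 ^ (16 * c))%N; first exact: ltn_expl.
  rewrite natrX lnXn // -(mulr_natr (ln _)) natrM.
  have := ler_wpM2r (ler0n R (16 * c)) ln2; rewrite natrM; lra.
pose W := (w0`!)%N; pose N := (32 * kappa * E)%N; pose q := (W * (l.+1 * J))%N.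
have W0 : (0 < W)%N by exact: fact_gt0.
have w0W : (w0 <= W)%N by exact: fact_geq.
have N0 : (0 < N)%N by rewrite /N !muln_gt0 E0.
have q0 : (0 < q)%N by rewrite /q !muln_gt0 W0 J0.
(* The summands serve in turn [W <= z], [w1_large], [eps_small] and 0 < lam. *)
exists (N * W + 4 * kappa * T + 4 * q ^ 2 + 1)%N => X; set lam := trunc_log 2 X => lam_large B HB.
have [lam1 lam2 lam3 lam0] := leq_summands _ _ _ _ lam_large.
have X0 : (0 < X)%N.
  by rewrite lt0n; apply: contraTneq lam0 => X_eq0; rewrite /lam X_eq0 trunc_log0.
have Xlo : (2 ^ lam <= X)%N by exact: trunc_logP.
have Xhi : (X < 2 ^ lam.+1)%N by exact: trunc_log_ltn.
have X1 : (1 < X)%N by apply: leq_trans Xlo; rewrite -{1}(expn1 2) leq_exp2l.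
(* Up to rounding z is X ^ (1 / N), with N = 32 kappa E as the sieve remainder demands. *)
pose z := (2 ^ (lam %/ N))%N; pose w1 := (lam ^ 2)%N.
have Wa : (W <= lam %/ N)%N by rewrite leq_divRL // mulnC.
have Wz : (W <= z)%N by apply: leq_trans Wa (ltnW (ltn_expl _ _)).
have a0 : (0 < lam %/ N)%N by exact: leq_trans W0 Wa.
have z2 : (2 <= z)%N by rewrite /z -{1}(expn1 2) leq_exp2l.
have zX : ((z ^ (32 * kappa)) ^ E <= X)%N.
  apply: leq_trans Xlo; rewrite /z -!expnM leq_exp2l //; exact: leq_divM.
have kw0 : (4 * kappa <= w0)%N.
  apply: leq_trans (ltnW w0_gt); apply: leq_trans (leq_mul (leqnn 16) c_ge).
  by rewrite mulnDr mulnA; apply: leq_trans (leq_addl _ _); rewrite leq_mul2r orbT.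
have lnw2 : 2 <= ln w0%:R :> R.
  apply: le_trans lnw0; have : 1 <= c%:R :> R by rewrite ler1n.
  lra.
have w1_gt0 : (0 < w1)%N by rewrite expn_gt0 lam0.
have w1_large : (2 * (2 * kappa) * (n * n.+1 * lam) <= w1)%N.
  have -> : (2 * (2 * kappa) * (n * n.+1 * lam) = 4 * kappa * T * lam)%N by rewrite /T !mulnA.
  by rewrite /w1 -mulnn leq_mul2r lam2 orbT.
have cw0 : (2 * c <= w0)%N by apply: leq_trans (ltnW w0_gt); rewrite leq_mul2r orbT.
have LXlo : lam%:R / 2 <= ln X%:R :> R.
  apply: (@le_trans _ _ (ln (2 ^ lam)%N%:R)); last first.
    by rewrite ler_ln ?posrE ?ltr0n ?expn_gt0 // ler_nat.
  rewrite natrX lnXn // -(mulr_natr (ln _)) mulrC; apply: ler_wpM2r => //; exact: ln2.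
have LX0 : 0 < ln X%:R :> R by rewrite ln_gt0 // ltr1n.
have w01 : (1 < w0)%N by apply: leq_trans w0_gt; rewrite ltnS muln_gt0.
have eps_small : (W * (l.+1 * J))%:R / ln X%:R * \prod_(p <- sieving_primes w0 w1) (1 + c%:R / p%:R) <= 1 :> R.
  have := prod_1D_sieving_primes R c%:R w0 lam (ler0n _ _) w01 lnw0 lam0.
  rewrite -/w1; set A := \prod_(_ <- _) _ => A2.
  have A0 : 0 <= A by apply: prodr_ge0 => p _; rewrite addr_ge0 // divr_ge0.
  rewrite mulrAC ler_pdivrMr // mul1r -/q; apply: le_trans LXlo.
  have qA0 : 0 <= q%:R * A by rewrite mulr_ge0.
  rewrite -ler_sqr ?nnegrE ?divr_ge0 // exprMn.
  have h : 4 * q%:R ^+ 2 <= lam%:R :> R by rewrite -natrX -[4]/(4%:R) -natrM ler_nat.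
  have := ler_wpM2l (exprn_ge0 2 (ler0n R q)) A2.
  have := ler_wpM2r (ler0n R lam) h.
  rewrite [X in _ -> _ -> _ <= X](_ : _ = lam%:R * lam%:R / 4); last by field.
  lra.
have hc := count_short_block_numbers R X E J l w0 w1 z lam c l0 E0 J0 X1 Xhi zX z2 Wz kw0 lnw2 w1_gt0 w1_large c_large eps_small cw0 B HB.
apply: le_trans hc _.
have eps1 : (l.+1 * J)%:R <= ln X%:R :> R.
  have A1 : 1 <= \prod_(p <- sieving_primes w0 w1) (1 + c%:R / p%:R) :> R.
    by elim/big_rec: _ => // p x _ x1; rewrite mulr_ege1 // lerDl divr_ge0.
  have e0 : 0 <= (W * (l.+1 * J))%:R / ln X%:R :> R by rewrite divr_ge0 // ltW.
  have := le_trans (ler_wpM2l e0 A1) eps_small; rewrite mulr1 ler_pdivrMr // mul1r; apply: le_trans.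
  by rewrite ler_nat leq_pmull.
have Lz0 : 0 < ln z%:R :> R by rewrite ln_gt0 // ltr1n.
(* 64 = 2 * 32: as lam >= N, the two roundings, of lam / N and of the logarithm of X, together cost
   at most a factor 2. *)
have LXz : ln X%:R <= (64 * (2 * l).+1 * E)%N%:R * ln z%:R :> R.
  apply: (@le_trans _ _ (ln (2 ^ lam.+1)%N%:R)).
    by rewrite ler_ln ?posrE ?ltr0n ?expn_gt0 // ler_nat ltnW.
  rewrite /z !natrX !lnXn // -!(mulr_natr (ln _)) mulrCA ler_wpM2l //; first by apply: le_trans ln2; rewrite invr_ge0.
  rewrite -natrM ler_nat -[X in (_ <= X)%N]/(64 * kappa * E * (lam %/ N))%N.
  have -> : (64 * kappa * E = 2 * N)%N by rewrite /N !mulnA.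
  have := ltn_ceil lam N0; rewrite mulSn.
  have : (N <= lam %/ N * N)%N by rewrite leq_pmull.
  by rewrite -mulnA mul2n -addnn (mulnC N) => h1 h2; apply: leq_trans h2 _; rewrite leq_add2r.
have Dl : ((totient W)%:R / W%:R) ^+ kappa * density R l w0 z <= ((ln z%:R)^-1) ^+ kappa :> R.
  apply: sifted_density => //; rewrite (leq_trans w0W Wz) andbT.
  by apply: leq_trans kw0; rewrite leq_pmull.
have D0 : 0 <= ((totient W)%:R / W%:R) ^+ kappa * density R l w0 z :> R.
  rewrite mulr_ge0 ?exprn_ge0 ?divr_ge0 //.
  by apply: le_trans (density_ge R l w0 z z2 kw0 lnw2); rewrite invr_ge0 exprn_ge0.
have Zle k : (0 < k <= l.+1 * J)%N -> 0 <= rankin_mass R (k%:R / ln X%:R) <= 2 * (ln X%:R / k%:R).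
  move=> /andP[k0 kl]; have kR : 0 < k%:R :> R by rewrite ltr0n.
  rewrite /rankin_mass invf_div addr_ge0 ?divr_ge0 ?(ltW LX0) //=.
  have : 1 <= ln X%:R / k%:R :> R by rewrite ler_pdivlMr // mul1r; apply: le_trans eps1; rewrite ler_nat.
  lra.
have /andP[Zs0 Zs1] : 0 <= rankin_mass R (l.+1%:R / ln X%:R) <= 2 * (ln X%:R / l.+1%:R).
  by apply: Zle; rewrite /= leq_pmulr.
have /andP[Zt0 Zt1] : 0 <= rankin_mass R ((l * J)%:R / ln X%:R) <= 2 * (ln X%:R / (l * J)%:R).
  by apply: Zle; rewrite muln_gt0 l0 J0 leq_mul2r leqnSn orbT.
have := main_term_le l E J 64 _ _ _ _ _ l0 E0 J0 isT Lz0 LX0 LXz D0 Dl Zs0 Zs1 Zt0 Zt1.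
move=> /(ler_wpM2r (ler0n R X)); apply: le_trans.
rewrite le_eqVlt; apply/orP; left; apply/eqP.
rewrite -/n -/kappa -/W -/T; ring.
Qed.

End Rarity.

(** * Choice of the parameters *)

Section Threshold.
Local Open Scope ring_scope.
Variable R : realType.

Lemma uniform_short_blocks (l0 E J m : nat) : (0 < l0)%N -> (0 < E)%N -> (0 < J)%N ->
  exists lam0, forall j X, (j < m)%N -> (lam0 <= trunc_log 2 X)%N -> forall B : pred nat,
    (forall N, B N -> (0 < N <= X)%N /\ short_block_number X E J (l0 * 2 ^ j) N) ->
    (count B (iota 1 X))%:R <= 180 * (4 * 64) * expR 1 * E%:R *
      (16 * expR 1 ^+ 2 * (4 * 64 * (6 * 64)) * E%:R ^+ 2 / J%:R) ^+ (l0 * 2 ^ j) * X%:R :> R.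
Proof.
move=> l00 E0 J0; elim: m => [|m [lam IH]]; first by exists 0%N.
have lm0 : (0 < l0 * 2 ^ m)%N by rewrite muln_gt0 l00 expn_gt0.
have [lam' H] := short_blocks_rare R (l0 * 2 ^ m) E J lm0 E0 J0.
exists (maxn lam lam') => j X; rewrite ltnS leq_eqVlt geq_max => /orP[/eqP ->|jm] /andP[h1 h2].
  exact: H.
exact: IH.
Qed.

(** The real power becomes an integer exponent through x <= x ^ (eps E) = (x ^ eps) ^ E < p ^ E. *)
Lemma large_max_pdiv (eps x : R) E m : 1 <= x -> 0 < eps -> 1 <= eps * E%:R ->
  ~~ ((max_pdiv m)%:R <= x `^ eps) ->
  [/\ prime (max_pdiv m), (max_pdiv m %| m)%N & x < (max_pdiv m ^ E)%N%:R].
Proof.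
move=> x1 eps0 eE; rewrite -ltNge => h.
have x0 : 0 < x by exact: lt_le_trans x1.
have p1 : 1 <= x `^ eps by rewrite -(powRr0 x) ler_powR // ltW.
(* At 0 and 1 [max_pdiv] takes the default value 1, which x ^ eps >= 1 excludes. *)
have m1 : (1 < m)%N.
  by have := le_lt_trans p1 h; rewrite ltr1n; case: m {h} => [|[|m]].
have E0 : (0 < E)%N by case: (E) eE => //; rewrite mulr0 ler10.
split; [exact: max_pdiv_prime | exact: max_pdiv_dvd |].
apply: (@le_lt_trans _ _ ((x `^ eps) ^+ E)).
  rewrite -powR_mulrn ?powR_ge0 // -powRrM -{1}(powRr1 (ltW x0)) ler_powR //.
by rewrite natrX ltrXn2r ?nnegrE ?powR_ge0 // -lt0n.
Qed.

Lemma count_has_le (T : eqType) (r : seq T) (a : pred nat) (b : T -> pred nat) (u : seq nat) :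
  (forall N, N \in u -> a N -> has (fun j => b j N) r) -> (count a u <= \sum_(j <- r) count (b j) u)%N.
Proof.
elim: u => [|N u IH] H /=; first by rewrite big1.
rewrite big_split /=; apply: leq_add; last by apply: IH => M Mu; apply: H; rewrite in_cons Mu orbT.
case aN: (a N) => //; have /hasP[j jr bj] := H N (mem_head _ _) aN.
by rewrite (big_rem j jr) /= bj.
Qed.

End Threshold.

Local Open Scope classical_set_scope.
Local Open Scope ring_scope.

Theorem theorem5 (R : realType) (eps delta : R)
    (eps_gt0 : 0 < eps) (delta_gt0 : 0 < delta) :
  exists2 k : nat, (0 < k)%N &
    \forall x \near (+oo : set_system R),
      (1 - delta) * x <= (count_le x
        (fun n => (max_pdiv (iter k totient n))%:R <= x `^ eps))%:R.
Proof.
pose E := (Num.truncn eps^-1).+1.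
have eE : 1 <= eps * E%:R.
  by rewrite mulrC -ler_pdivrMr // div1r ltW // truncnS_gt.
pose K : R := 180 * (4 * 64) * expR 1 * E%:R.
have e0 : 0 < expR 1 :> R by exact: expR_gt0.
have K0 : 0 < K by rewrite !mulr_gt0.
pose r : R := 16 * expR 1 ^+ 2 * (4 * 64 * (6 * 64)) * E%:R ^+ 2.
have r0 : 0 < r by rewrite !mulr_gt0 ?exprn_gt0.
(* J exceeds 2 r, so the ratio r / J that is raised to the power l is at most 1 / 2. *)
pose J := (Num.truncn (2 * r)).+1.
have JR : 0 < J%:R :> R by rewrite ltr0n.
have rJ : r / J%:R <= 2^-1.
  by rewrite ler_pdivrMr // ler_pdivlMl // ltW // truncnS_gt.
have rJ0 : 0 <= r / J%:R by rewrite divr_ge0 // ltW.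
(* J is chosen before l0, so it is enough to bound each of the J lengths by the worst proportion K /
   2 ^ l0; by 2 ^ l0 >= l0 the total is at most delta / 2. *)
pose l0 := (Num.truncn (2 * (J%:R * K / delta))).+1.
have l0R : 0 < l0%:R :> R by rewrite ltr0n.
have small : J%:R * (K * 2^-1 ^+ l0) <= delta / 2.
  have h1 : 2 * (J%:R * K / delta) <= l0%:R by rewrite ltW // truncnS_gt.
  have h2 : 2^-1 ^+ l0 <= l0%:R^-1 :> R.
    rewrite exprVn lef_pV2 ?posrE ?exprn_gt0 // -natrX ler_nat ltnW // ltn_expl //.
  apply: (@le_trans _ _ (J%:R * (K * l0%:R^-1))).
    by rewrite ler_wpM2l ?(ltW JR) // ler_wpM2l // ltW.
  rewrite mulrA ler_pdivrMr //.
  move: h1; rewrite mulrA ler_pdivrMr // => h1; lra.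
exists (E * (l0 * 2 ^ J).+1)%N => //.
have [lam Hlam] := uniform_short_blocks R l0 E J J isT isT isT.
near=> x.
have x1 : 1 <= x by near: x; apply: nbhs_pinfty_ge; rewrite num_real.
have xlam : (2 ^ lam)%N%:R <= x by near: x; apply: nbhs_pinfty_ge; rewrite num_real.
(* The other half of delta pays for the loss of at most 1 when x is replaced by its integer part. *)
have xdelta : 2 / delta <= x by near: x; apply: nbhs_pinfty_ge; rewrite num_real.
have x0 : 0 <= x by exact: le_trans x1.
rewrite /count_le; set X := Num.truncn x.
have Xx : X%:R <= x by rewrite truncn_le.
have xX : x < X.+1%:R by exact: truncnS_gt.
have Xlam : (lam <= trunc_log 2 X)%N.
  by apply: trunc_log_max => //; rewrite -ltnS -(ltr_nat R); exact: le_lt_trans xX.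
rewrite /index_iota subSS subn0; set P := fun n : nat => _.
pose B j : pred nat := fun N => `[< (0 < N <= X)%N /\ short_block_number X E J (l0 * 2 ^ j) N >].
have bad : (count (predC P) (iota 1 X) <= \sum_(j <- iota 0 J) count (B j) (iota 1 X))%N.
  apply: count_has_le => N; rewrite mem_iota add1n ltnS => NX nP.
  have [pp pd pE] := large_max_pdiv R eps x E _ x1 eps_gt0 eE nP.
  have pX : (X < max_pdiv (iter (E * (l0 * 2 ^ J).+1) totient N) ^ E)%N.
    by rewrite -(ltr_nat R); exact: le_lt_trans pE.
  have [j [m0 [q [s [jJ ss qE qs [s1 m00 eN blk]]]]]] :=
    large_prime_factor_short_block X E J l0 N _ isT isT NX pp pX pd.
  apply/hasP; exists j; first by rewrite mem_iota.
  by apply/asboolP; split => //; exists m0, q, s.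
have badR : (count (predC P) (iota 1 X))%:R <= delta / 2 * x.
  apply: (@le_trans _ _ (\sum_(j <- iota 0 J) K * 2^-1 ^+ l0 * x)).
    apply: (@le_trans _ _ (\sum_(j <- iota 0 J) count (B j) (iota 1 X))%N%:R); first by rewrite ler_nat.
    rewrite natr_sum big_seq [leRHS]big_seq; apply: ler_sum => j; rewrite mem_iota add0n => jJ.
    apply: le_trans (Hlam j X jJ Xlam (B j) _) _; first by move=> N /asboolP.
    rewrite -/K -/r; apply: ler_pM => //; first by rewrite mulr_ge0 ?exprn_ge0 // ltW.
    apply: ler_wpM2l; first exact: ltW.
    apply: (@le_trans _ _ (2^-1 ^+ (l0 * 2 ^ j))); first by rewrite lerXn2r ?nnegrE.
    by rewrite ler_wiXn2l ?invf_le1 ?ler1n // leq_pmulr // expn_gt0.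
  rewrite big_const_seq count_predT size_iota iter_addr_0 -(mulr_natr (_ * _)).
  have -> : K * 2^-1 ^+ l0 * x * J%:R = J%:R * (K * 2^-1 ^+ l0) * x by ring.
  exact: ler_wpM2r.
have tot : (count P (iota 1 X))%:R = X%:R - (count (predC P) (iota 1 X))%:R :> R.
  by rewrite -[X in X%:R - _](size_iota 1) -(count_predC P) natrD addrK.
rewrite tot; have dx : 1 <= delta / 2 * x.
  by move: xdelta; rewrite ler_pdivrMr // => h; lra.
move: xX; rewrite -natr1 => xX; lra.
Unshelve. all: by end_near.
Qed.
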